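(* Assume $\rho_1 < \frac{c_2}{c_1+c_2}$ and $\rho_2 < \frac{c_1}{c_1+c_2}$. Then, for $\mathrm{Re}\, s \ge 0$ (with the value at $s=0$ understood by continuity), the Laplace-Stieltjes transform (LST) of the steady-state workload $V_1$ of the first queue is $$\mathbb{E}(e^{-sV_1})=\frac{s\left[\lambda_1 \mathbb{E}(B_1)(c_1+c_2)-c_2\right]\left[c_1+c_2+\lambda_1(1-\tilde{b}_1(s))\right]}{\left[\left(c_2+\lambda_1(1-\tilde{b}_1(s))\right)\left(c_1+\lambda_1(1-\tilde{b}_1(s))-s\right)-c_1c_2\right](c_1+c_2)},$$ and, symmetrically, the LST of the steady-state workload $V_2$ of the second queue is $$\mathbb{E}(e^{-sV_2})=\frac{s\left[\lambda_2 \mathbb{E}(B_2)(c_1+c_2)-c_1\right]\left[c_1+c_2+\lambda_2(1-\tilde{b}_2(s))\right]}{\left[\left(c_1+\lambda_2(1-\tilde{b}_2(s))\right)\left(c_2+\lambda_2(1-\tilde{b}_2(s))-s\right)-c_1c_2\right](c_1+c_2)}.$$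
   Context: Model (two-queue polling with exponential timers). Customers arrive at queue $i$ according to independent Poisson processes with rates $\lambda_i>0$, $i=1,2$. Service times at queue $i$ are i.i.d. positive random variables distributed as $B_i$, with finite mean and LST $\tilde b_i(s)=\mathbb{E}(e^{-sB_i})$, $\mathrm{Re}\, s\ge 0$. All arrival processes, service times and residing times are independent. A single server alternates between the queues: it stays at queue $i$ for an exponentially distributed residing time $T_i$ with rate $c_i>0$, regardless of the queue contents (it stays even if the queue is empty), and then switches instantaneously to the other queue (no switch-over time). While at queue $i$ the server serves only customers of queue $i$, at unit speed, in first-come-first-served order. A service interrupted by a switch is resumed where it stopped at the next visit (preemptive-resume). $\rho_i=\lambda_i\mathbb{E}(B_i)$. The workload $V_i(t)$ is the total amount of remaining service time present in queue $i$ at time $t$; $V_i$ denotes a random variable with the steady-state distribution of the workload of queue $i$ at an arbitrary epoch. *)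

(* Defs.v *)
From HB Require Import structures.
From mathcomp Require Import all_boot all_order all_algebra.
From mathcomp Require Import complex.
From mathcomp Require Import all_classical all_reals all_analysis.
Set Implicit Arguments.
Unset Strict Implicit.
Unset Printing Implicit Defensive.
Import Order.TTheory GRing.Theory Num.Theory.
Import numFieldNormedType.Exports.
Local Open Scope classical_set_scope.
Local Open Scope complex_scope.
Local Open Scope ring_scope.

Definition queue := bool.
Definition Q1 : queue := false.
Definition Q2 : queue := true.

Definition mutually_independent (d : measure_display) (T : measurableType d)
    (R : realType) (P : probability T R) (I : choiceType)
    (X : I -> {RV P >-> R}) : Prop :=
  forall (s : seq I) (E : I -> set R), uniq s ->
    (forall j, measurable (E j)) ->
    P (\bigcap_(j in [set` s]) (X j @^-1` E j)) =
    (\prod_(j <- s) P (X j @^-1` E j))%E.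

Definition exponential_rv (d : measure_display) (T : measurableType d)
    (R : realType) (P : probability T R) (X : {RV P >-> R}) (rate : R) : Prop :=
  forall E : set R, measurable E -> P (X @^-1` E) = exponential_prob rate E.

(* The Poisson arrival processes are given by their i.i.d. exponential
   interarrival times.  [residing i k] is the length of the [k]-th stay of the
   server at queue [i].  At time 0 the server starts a stay at queue [start],
   and queue [i] holds an arbitrary deterministic amount of work [backlog i]. *)
Record polling_model (d : measure_display) (T : measurableType d)
    (R : realType) (P : probability T R) := PollingModel {
  lambda : queue -> R;
  c : queue -> R;
  interarrival : queue -> nat -> {RV P >-> R};
  service : queue -> nat -> {RV P >-> R};
  residing : queue -> nat -> {RV P >-> R};
  start : queue;
  backlog : queue -> R;
  lambda_gt0 : forall i, 0 < lambda i;
  c_gt0 : forall i, 0 < c i;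
  backlog_ge0 : forall i, 0 <= backlog i;
  interarrival_law : forall i k, exponential_rv (interarrival i k) (lambda i);
  residing_law : forall i k, exponential_rv (residing i k) (c i);
  service_gt0 : forall i k, {ae P, forall w, 0 < service i k w};
  service_law : forall i k (E : set R), measurable E ->
    P (service i k @^-1` E) = P (service i 0%N @^-1` E);
  service_integrable : forall i,
    P.-integrable [set: T] (EFin \o (service i 0%N : T -> R));
  primitives_independent : mutually_independent
    (fun j : (queue * nat) + (queue * nat) + (queue * nat) =>
       match j with
       | inl (inl (i, k)) => interarrival i k
       | inl (inr (i, k)) => service i k
       | inr (i, k) => residing i k
       end)
}.

Definition mean_service (d : measure_display) (T : measurableType d)
    (R : realType) (P : probability T R) (M : polling_model P) (i : queue) : R :=
  fine ('E_P[service M i 0%N])%E.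

Definition rho (d : measure_display) (T : measurableType d)
    (R : realType) (P : probability T R) (M : polling_model P) (i : queue) : R :=
  lambda M i * mean_service M i.

(* The server makes visits number 0, 1, 2, ... to alternating queues. *)
Definition visited (d : measure_display) (T : measurableType d)
    (R : realType) (P : probability T R) (M : polling_model P) (m : nat) : queue :=
  start M (+) odd m.

Definition switch_epoch (d : measure_display) (T : measurableType d)
    (R : realType) (P : probability T R) (M : polling_model P)
    (m : nat) (w : T) : R :=
  \sum_(k < m) residing M (visited M k) k./2 w.

Definition server_at (d : measure_display) (T : measurableType d)
    (R : realType) (P : probability T R) (M : polling_model P)
    (i : queue) (w : T) : set R :=
  \bigcup_(m in [set m | visited M m = i])
    `[switch_epoch M m w, switch_epoch M m.+1 w[%classic.

(* Time spent by the server at queue [i] during [0, t]: a clock that runs at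
   unit speed when the server is at queue [i] and stands still otherwise. *)
Definition clock (d : measure_display) (T : measurableType d)
    (R : realType) (P : probability T R) (M : polling_model P)
    (i : queue) (t : R) (w : T) : R :=
  fine (lebesgue_measure (`[0, t]%classic `&` server_at M i w)).

Definition arrival_epoch (d : measure_display) (T : measurableType d)
    (R : realType) (P : probability T R) (M : polling_model P)
    (i : queue) (n : nat) (w : T) : R :=
  \sum_(k < n.+1) interarrival M i k w.

(* Reading of the clock of queue [i] when customer [n] leaves.  FCFS: service of
   customer [n] starts as soon as it is present and all work in front of it is
   done.  Preemptive-resume: from then on the clock has to advance by exactly
   the service time, whatever the number of interruptions. *)
Fixpoint completion (d : measure_display) (T : measurableType d)
    (R : realType) (P : probability T R) (M : polling_model P)
    (i : queue) (n : nat) (w : T) : R :=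
  Num.max (if n is m.+1 then completion M i m w else backlog M i)
          (clock M i (arrival_epoch M i n w) w)
  + service M i n w.

Definition remaining_service (d : measure_display) (T : measurableType d)
    (R : realType) (P : probability T R) (M : polling_model P)
    (i : queue) (n : nat) (t : R) (w : T) : R :=
  Num.min (service M i n w) (Num.max 0 (completion M i n w - clock M i t w)).

(* Almost surely the sum has finitely many nonzero terms. *)
Definition workload (d : measure_display) (T : measurableType d)
    (R : realType) (P : probability T R) (M : polling_model P)
    (i : queue) (t : R) (w : T) : R :=
  Num.max 0 (backlog M i - clock M i t w) +
  fine (\sum_(n <oo | (arrival_epoch M i n w <= t)%R)
          (remaining_service M i n t w)%:E)%E.

Definition cvg_in_law (d d' : measure_display) (T : measurableType d)
    (T' : measurableType d') (R : realType) (P : probability T R)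
    (P' : probability T' R) (X : R -> T -> R) (Y : T' -> R) : Prop :=
  forall f : R -> R, continuous f -> [bounded f x | x in [set: R]] ->
    ('E_P[f \o X t] @[t --> +oo%R] --> 'E_P'[f \o Y])%E.

(* [V] has the limiting distribution of the workload of queue [i]; it may live
   on another probability space. *)
Definition steady_state_workload (d d' : measure_display)
    (T : measurableType d) (T' : measurableType d') (R : realType)
    (P : probability T R) (P' : probability T' R)
    (M : polling_model P) (i : queue) (V : {RV P' >-> R}) : Prop :=
  cvg_in_law P P' (workload M i) V.

Definition cexp (R : realType) (z : R[i]) : R[i] :=
  (expR (complex.Re z))%:C * (cos (complex.Im z) +i* sin (complex.Im z)).

Definition cexpectation (d : measure_display) (T : measurableType d)
    (R : realType) (P : probability T R) (X : T -> R[i]) : R[i] :=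
  fine ('E_P[fun w => complex.Re (X w)])%E +i*
  fine ('E_P[fun w => complex.Im (X w)])%E.

Definition lst (d : measure_display) (T : measurableType d) (R : realType)
    (P : probability T R) (X : T -> R) (s : R[i]) : R[i] :=
  cexpectation P (fun w => cexp (- s * (X w)%:C)).

(* [X] has LST [F] on the closed right half-plane, where [F 0] is to be read as
   the limit of [F] at 0 within the half-plane. *)
Definition has_lst (d : measure_display) (T : measurableType d) (R : realType)
    (P : probability T R) (X : T -> R) (F : R[i] -> R[i]) : Prop :=
  (forall s : R[i], 0 <= complex.Re s -> s != 0 -> lst P X s = F s) /\
  (F : R[i]^o -> R[i]^o) s
    @[s --> within [set s : R[i]^o | 0 <= complex.Re s /\ s != 0]
              (nbhs (0 : R[i]^o))]
    --> (lst P X 0 : R[i]^o).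

(* Main.v *)
(* Fix a queue with arrival rate lam, switching rate con away from it and coff
   towards it; let W be its workload, "on" the indicator of the server being
   there and e(x) = exp(-s x). Averages are taken over [0, t] and t -> oo, which
   costs O(1/t) for bounded functions.
   - Drift balance: between arrivals W decreases at rate 1_on while positive, so
     for smooth F with F'(0) = 0 the averages of F'(W) 1_on and of
     lam E(F(W + B) - F(W)) agree. The choice F(x) = exp(-s x) - s exp(-x), with
     vanishing derivative at 0, avoids local times at the boundary.
   - Switch balance: an off visit starts at rate con and ends at rate coff, and
     W only jumps during it, so con f(W) 1_on - coff f(W) 1_off
     + lam E(f(W + B) - f(W)) 1_off averages to 0 for every bounded f.
   Rates come out of one formula for exponential clocks: if X is exponential of
   rate lam and independent of (sigma, Z), then
   E Z(sigma + X) = lam E int 1(sigma <= v < sigma + X) Z(v) dv.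
   With f = e and L = lam (1 - E exp(-s B)) the two balances give
   (s (coff + L) - L (con + coff + L)) E e(V) = s (con + coff + L) kappa, where
   kappa does not depend on s. Letting s -> 0+ identifies kappa with
   coff / (con + coff) - rho, which is positive by assumption; hence the left
   factor does not vanish and the transform is determined. *)

(* Only convergence in law of the workload at single times is given. The joint behaviour of workload
   and server position is unknown, so averages against 1_on need not converge; they are eliminated
   between the balances, up to O(1/t), before any limit is taken. The price of exp(-x) in F is one
   more such average, of exp(-W) 1_on, and the switch balance at s = 1 removes it. Heuristically
   kappa is the stationary probability that the server is present and the queue empty, which is why
   it cannot depend on s.

   Exact identities are available for finitely many arrivals and switches only. The balances are
   therefore written for the workload [W N] produced by the first N customers and summed over the
   first N visits; N is then chosen for each t so that more than that is needed before t with
   probability at most 1/t, an error of the same order as the boundary terms.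

   The exponential formula asks for a pair independent of one clock. For an arrival this is the path
   without later customers; for a switch the path depends on the visit length itself and has to be
   altered first. *)
Require Import Defs.
From HB Require Import structures.
From mathcomp Require Import all_boot all_order all_algebra.
From mathcomp Require Import complex.
From mathcomp Require Import all_classical all_reals all_analysis.
From mathcomp Require Import measurable_realfun.
From mathcomp Require Import ring lra.
Set Implicit Arguments.
Unset Strict Implicit.
Unset Printing Implicit Defensive.
Import Order.TTheory GRing.Theory Num.Theory.
Import numFieldNormedType.Exports.
Local Open Scope classical_set_scope.
Local Open Scope complex_scope.
Local Open Scope ring_scope.

(** * Independence and exponential clocks *)

Section independence.
Context d (T : measurableType d) (R : realType) (P : probability T R).

Definition cylinder (I : choiceType) (X : I -> {RV P >-> R}) (j0 : I) :
    set (set T) :=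
  [set A | exists s E, [/\ uniq s, j0 \notin s, forall j, measurable (E j) &
     A = \bigcap_(j in [set` s]) (X j @^-1` E j)]].

(* [T] with the sigma-algebra generated by all variables but [X j0] *)
Definition others (I : choiceType) (X : I -> {RV P >-> R}) (j0 : I) :=
  g_sigma_algebraType (cylinder X j0).

Definition indep (d' : measure_display) (U : measurableType d')
    (X : T -> R) (Y : T -> U) : Prop :=
  forall E F, measurable E -> measurable F ->
    P (X @^-1` E `&` Y @^-1` F) = (P (X @^-1` E) * P (Y @^-1` F))%E.

Variables (I : choiceType) (X : I -> {RV P >-> R}) (j0 : I).
Hypothesis indX : mutually_independent X.

Lemma bigcap_RV_measurable (s : seq I) (E : I -> set R) :
  (forall j, measurable (E j)) ->
  measurable (\bigcap_(j in [set` s]) (X j @^-1` E j)).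
Proof.
move=> mE; apply: fin_bigcap_measurable => //.
by move=> j _; rewrite -[_ @^-1` _]setTI; exact: measurable_funP.
Qed.

Lemma cylinder_measurable : cylinder X j0 `<=` measurable.
Proof.
by move=> A [s [E [us js mE ->]]]; exact: bigcap_RV_measurable.
Qed.

Lemma cylinder_setI : setI_closed (cylinder X j0).
Proof.
move=> _ _ [s1 [E1 [us1 js1 mE1 ->]]] [s2 [E2 [us2 js2 mE2 ->]]].
exists (undup (s1 ++ s2)), (fun j => (if j \in s1 then E1 j else setT) `&`
  (if j \in s2 then E2 j else setT)); split.
- exact: undup_uniq.
- by rewrite mem_undup mem_cat negb_or js1.
- by move=> j; apply: measurableI; case: ifP.
apply/seteqP; split=> w /=.
  move=> [h1 h2] j /=; rewrite mem_undup mem_cat => js.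
  by split; case: ifP => // jsi; [exact: (h1 j)|exact: (h2 j)].
move=> h; split=> j js.
  have : j \in undup (s1 ++ s2) by rewrite mem_undup mem_cat js.
  by move=> /(h j) /= []; rewrite js.
have : j \in undup (s1 ++ s2) by rewrite mem_undup mem_cat js orbT.
by move=> /(h j) /= [_]; rewrite js.
Qed.

Lemma cylinder_setT : cylinder X j0 setT.
Proof.
by exists [::], (fun=> setT); split=> //; apply/seteqP; split.
Qed.

Lemma sub_others : <<s cylinder X j0 >> `<=` measurable.
Proof.
apply: smallest_sub; first exact: sigma_algebra_measurable.
exact: cylinder_measurable.
Qed.

(** Both sides are finite measures in [A]. Mutual independence, applied to [j0 :: s], makes them
    agree on the cylinders, which form a pi-system containing [setT]; uniqueness of measures extends
    this to the generated sigma-algebra. *)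
Lemma indep_others_set (E A : set T) (B : set R) : measurable B ->
  <<s cylinder X j0 >> A -> P (A `&` X j0 @^-1` B) = (P (X j0 @^-1` B) * P A)%E.
Proof.
move=> mB sA.
have mXB : measurable (X j0 @^-1` B).
  by rewrite -[_ @^-1` _]setTI; exact: measurable_funP.
pose p : {nonneg R} := NngNum (fine_ge0 (measure_ge0 P (X j0 @^-1` B))).
have pE : (p%:num)%:E = P (X j0 @^-1` B) by rewrite /= fineK// fin_num_measure.
have -> : P (A `&` X j0 @^-1` B) = mrestr P mXB A by [].
rewrite -pE -[RHS]/(mscale p P A).
have pr : cylinder X j0 `<=` measurable := cylinder_measurable.
apply: (@g_sigma_algebra_measure_unique _ R T (cylinder X j0) pr (fun=> setT) _ _ (mrestr P mXB) (mscale p P)) => //.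

- by move=> _; exact: cylinder_setT.
- by rewrite bigcup_const//; exists 0%N.
- exact: cylinder_setI.
- move=> _ [s [F [us js mF ->]]].
  transitivity (P (X j0 @^-1` B) * P (\bigcap_(j in [set` s]) (X j @^-1` F j)))%E; last by rewrite -pE.
  rewrite /mrestr.
  have := @indX (j0 :: s) (fun j => if j == j0 then B else F j).
  rewrite /= us js => /(_ isT).
  rewrite big_cons eqxx => h.
  transitivity (P (\bigcap_(j in [set` j0 :: s])
      X j @^-1` (if j == j0 then B else F j))).
    congr (P _).
    apply/seteqP; split=> w /=.
      move=> [h1 h2] j /=; rewrite inE => /orP[/eqP ->|js']; first by rewrite eqxx.
      by case: eqP => [->//|_]; exact: (h1 j).
    move=> h1; split; last by have /= := h1 j0 (mem_head _ _); rewrite eqxx.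
    move=> j js'; have /= := h1 j; rewrite inE js' orbT => /(_ isT).
    by case: eqP => // jj; move: js; rewrite -jj js'.
  rewrite h; last by move=> j; case: ifP.
  rewrite indX//; congr (_ * _)%E; rewrite !big_seq; apply: eq_bigr => j js'.
  by case: eqP => // jj; move: js; rewrite -jj js'.
- move=> n; apply: (@le_lt_trans _ _ (P setT)); last by rewrite probability_setT ltry.
  by apply: le_measure; rewrite ?inE//; exact: measurableI.
Qed.

Lemma indep_others : indep (X j0) (id : T -> others X j0).
Proof.
move=> E F mE mF; rewrite setIC indep_others_set//.
Qed.

Lemma measurable_id_others : measurable_fun setT (id : T -> others X j0).
Proof. by move=> _ A mA; rewrite setTI; exact: sub_others. Qed.

Lemma measurable_others j : j != j0 ->
  measurable_fun setT (X j : others X j0 -> R).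
Proof.
move=> jj0 _ A mA; rewrite setTI; apply: sub_sigma_algebra.
exists [:: j], (fun=> A); split=> //.
  by rewrite inE eq_sym.
apply/seteqP; split=> w /=; first by move=> h k; rewrite /= inE => /eqP ->.
by apply; rewrite /= inE.
Qed.

End independence.

(** * Integration of independent and exponential variables *)

Section indep_integral.
Local Open Scope ereal_scope.
Context d (T : measurableType d) (R : realType) (P : probability T R).
Context d' (U : measurableType d').

(** Independence identifies the joint law with the product law; Tonelli then integrates [X] out with
    [Y] frozen. *)
Lemma indep_integral (X : {mfun T >-> R}) (Y : {mfun T >-> U}) (f : R * U -> \bar R) :
  indep P X Y -> measurable_fun setT f -> (forall z, 0 <= f z) ->
  \int[P]_w f (X w, Y w) = \int[P]_w \int[distribution P X]_x f (x, Y w).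
Proof.
move=> XY mf f0.
have mXY : measurable_fun setT (fun w => (X w, Y w)) by exact: measurable_fun_pair.
pose XYm := isMeasurableFun.Build _ _ _ _ _ mXY.
pose XY' : {mfun T >-> (R * U)%type} := HB.pack (fun w => (X w, Y w)) XYm.
transitivity (\int[distribution P XY']_z f z).
  by rewrite ge0_integral_distribution.
transitivity (\int[distribution P X \x distribution P Y]_z f z).
  apply: eq_measure_integral => A mA _; apply/esym.
  refine (@product_measure_unique _ _ _ _ R (distribution P X)
    (distribution P Y) (distribution P XY') _ A mA).
  by move=> E F mE mF; rewrite /distribution /pushforward -XY.
rewrite fubini_tonelli2//.
rewrite ge0_integral_distribution//.
  exact: measurable_fun_fubini_tonelli_G.
by move=> y; apply: integral_ge0.
Qed.
End indep_integral.

Section translation.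
Local Open Scope ereal_scope.
Context (R : realType).
Notation mu := (@lebesgue_measure R).

Lemma lebesgue_integral_translate (a : R) (f : R -> \bar R) :
  measurable_fun setT f -> (forall x, 0 <= f x) ->
  \int[mu]_x f (a + x)%R = \int[mu]_x f x.
Proof.
move=> mf f0.
have ma : measurable_fun [set: measurableTypeR R] (fun x : measurableTypeR R => (a + x)%R : measurableTypeR R).
  exact: measurable_funD.
have -> : \int[mu]_x f x = \int[pushforward mu (fun x : measurableTypeR R => (a + x)%R : measurableTypeR R)]_x f x.
  apply: eq_measure_integral => A mA _.
  apply: (@lebesgue_measure_unique R (pushforward mu (fun x : measurableTypeR R => (a + x)%R : measurableTypeR R))) => //.
  move=> _ [[x y] /= _ <-].
  rewrite /pushforward.
  rewrite (_ : _ @^-1` _ = `](x - a)%R, (y - a)%R]%classic); last first.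
    by apply/seteqP; split=> z /=; rewrite !in_itv/= => /andP[? ?]; apply/andP; split; lra.
  rewrite !lebesgue_measure_itv/= !lte_fin ltrBlDr subrK.
  case: ifP => // _; rewrite -!EFinD; congr _%:E; lra.
rewrite ge0_integral_pushforward//.
Qed.
End translation.

Section density.
Local Open Scope ereal_scope.
Context d (T : measurableType d) (R : realType).
Variables (mu nu : {measure set T -> \bar R}) (g : T -> R).
Import HBNNSimple.
Hypothesis mg : measurable_fun setT g.
Hypothesis g0 : forall x, (0 <= g x)%R.
Hypothesis nuE : forall A, measurable A -> nu A = \int[mu]_(x in A) (g x)%:E.

(** The exponential law is given as a set function. Approximation by simple functions turns its
    density into a factor under the integral sign. *)
Lemma ge0_integral_density (f : T -> \bar R) :
  measurable_fun setT f -> (forall x, 0 <= f x) ->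
  \int[nu]_x f x = \int[mu]_x (f x * (g x)%:E).
Proof.
move=> mf f0; pose h := nnsfun_approx measurableT mf.
have mgE : measurable_fun setT (EFin \o g) by exact/measurable_EFinP.
have cvgh x : (h n x)%:E @[n --> \oo] --> f x by exact: cvg_nnsfun_approx.
have ndh x : {homo (fun n => (h n x)%:E) : m n / (m <= n)%N >-> m <= n}.
  by move=> m n mn; rewrite lee_fin; exact/lefP/nd_nnsfun_approx.
have -> : \int[nu]_x f x = lim (\int[nu]_x (h n x)%:E @[n --> \oo]).
  rewrite -monotone_convergence//.
  - by apply: eq_integral => x _; apply/esym/cvg_lim.
  - by move=> n; exact/measurable_EFinP.
  - by move=> n x _; rewrite lee_fin.
have -> : \int[mu]_x (f x * (g x)%:E) =
    lim (\int[mu]_x ((h n x)%:E * (g x)%:E) @[n --> \oo]).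
  rewrite -monotone_convergence//.
  - apply: eq_integral => x _; apply/esym/cvg_lim => //.
    by apply: cvgeZr => //; exact: cvgh.
  - by move=> n; apply/emeasurable_funM => //; exact/measurable_EFinP.
  - by move=> n x _; rewrite mule_ge0// lee_fin.
  - by move=> x _ m n mn; rewrite lee_wpmul2r// ?lee_fin//; exact: ndh.
suff suf n : \int[nu]_x (h n x)%:E = \int[mu]_x ((h n x)%:E * (g x)%:E).
  by under eq_fun do rewrite suf.
have mh r : measurable (h n @^-1` [set r]).
  by rewrite -[_ @^-1` _]setTI; exact: measurable_funP.
transitivity (\int[nu]_x (\sum_(y \in range (h n)) (y * \1_(h n @^-1` [set y]) x)%:E)).
  by apply: eq_integral => t tE; rewrite /= fimfunE -fsumEFin.
have indich r : measurable_fun setT (fun x => (r * \1_(h n @^-1` [set r]) x)%:E).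
  by apply/measurable_EFinP; exact: measurable_funM.
rewrite ge0_integral_fsum//; last by move=> m y Ey; exact: nnfun_muleindic_ge0.
transitivity (\int[mu]_x (\sum_(y \in range (h n))
    (y * \1_(h n @^-1` [set y]) x)%:E * (g x)%:E)); last first.
  apply: eq_integral => x _; rewrite /= fimfunE -fsumEFin//.
  by rewrite -ge0_mule_fsuml// => y; exact: nnfun_muleindic_ge0.
rewrite ge0_integral_fsum//; last 2 first.
- by move=> r; apply: emeasurable_funM.
- by move=> r x _; rewrite mule_ge0 ?lee_fin//; exact: nnfun_muleindic_ge0.
apply: eq_fsbigr => r rh.
rewrite integralZl_indic_nnsfun// integral_indic// setIT nuE//.
have r0 : (0 <= r)%R by move: rh; rewrite inE => -[x _ <-].
under [RHS]eq_integral do rewrite EFinM -muleA.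
rewrite ge0_integralZl//.
- congr (_ * _); rewrite integral_mkcond; apply: eq_integral => x _.
  rewrite patchE indicE; case: ifPn => _; by rewrite ?mul1e ?mul0e.
- by apply: emeasurable_funM => //; exact/measurable_EFinP.
- by move=> x _; rewrite mule_ge0 ?lee_fin.
Qed.

End density.

Section compensator.
Local Open Scope ereal_scope.
Context d (T : measurableType d) (R : realType) (P : probability T R).
Context d' (U : measurableType d').
Notation mu := (@lebesgue_measure R).

Lemma exponential_prob_gt (lam x : R) : (0 < lam)%R -> (0 <= x)%R ->
  exponential_prob lam `]x, +oo[ = (expR (- lam * x))%:E.
Proof.
move=> lam0 x0; rewrite /exponential_prob.
have mpdf : measurable_fun setT (EFin \o exponential_pdf lam).
  by apply/measurable_EFinP; exact: measurable_exponential_pdf.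
rewrite integral_itv_obnd_cbnd; last exact: measurable_funTS.
have cexp (z : R) : {for z, continuous (fun y : R => - expR (- lam * y))%R}.
  apply: cvgN; apply: continuous_comp; last exact: continuous_expR.
  by apply: cvgM; [exact: cvg_cst|exact: cvg_id].
rewrite (@ge0_continuous_FTC2y _ _ (fun y => - expR (- lam * y))%R _ 0%R).
- by rewrite EFinN oppeK add0e.
- by move=> y _; apply: exponential_pdf_ge0; exact: ltW.
- apply: (@continuous_subspaceW R^o _ _ [set` `[0%R, +oo[%R]); last exact: within_continuous_exponential_pdf.
  by move=> y /=; rewrite !in_itv/= !andbT; exact: le_trans.
- rewrite -oppr0; apply: cvgN.
  rewrite (_ : (fun x => expR (- lam * x))%R =
               (fun z => expR (- z)) \o (fun z => lam * z))%R; last first.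
    by apply: eq_fun => y; rewrite mulNr.
  apply: (@cvg_comp _ _ _ _ _ _ (pinfty_nbhs R)); last exact: cvgr_expR.
  exact: gt0_cvgMry.
- by move=> z _; exact: ex_derive.
- by apply/cvg_at_right_filter; exact: cexp.
- by move=> z zx; apply: derive1_exponential_pdf; move: zx; rewrite !in_itv/= !andbT; exact: le_lt_trans.
Qed.

Lemma exponential_integral (lam : R) (X : {RV P >-> R}) (f : R -> \bar R) :
  (0 < lam)%R -> exponential_rv X lam ->
  measurable_fun setT f -> (forall x, 0 <= f x) ->
  \int[distribution P X]_x f x = \int[mu]_x (f x * (exponential_pdf lam x)%:E).
Proof.
move=> lam0 Xlam mf f0; have h : measurable_fun setT X by exact: measurable_funPT.
have mX : measurable_fun setT (X : T -> measurableTypeR R).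
  by move=> mT A mA; exact: (h mT A mA).
rewrite ge0_integral_distribution//.
transitivity (\int[pushforward P (X : T -> measurableTypeR R)]_x f x).
  by rewrite ge0_integral_pushforward.
refine (@ge0_integral_density _ (measurableTypeR R) R mu
  (pushforward P (X : T -> measurableTypeR R)) (exponential_pdf lam)
  _ _ _ f mf f0) => //.
- exact: measurable_exponential_pdf.
- by move=> x; apply: exponential_pdf_ge0; exact: ltW.
Unshelve. exact: mX. Qed.

(** With [Y] frozen, both sides integrate [Z (sig + v, y)] against a function of v: the density of
    [X] on the left, [lam] times the survival probability of [X] at v on the right. For the
    exponential law the two coincide, its hazard rate being constant. *)
Lemma compensator (lam : R) (X : {RV P >-> R}) (Y : {mfun T >-> U})
    (sig : U -> R) (Z : R * U -> \bar R) :
  (0 < lam)%R -> exponential_rv X lam -> indep P X Y ->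
  measurable_fun setT sig -> measurable_fun setT Z -> (forall z, 0 <= Z z) ->
  \int[P]_w Z (sig (Y w) + X w, Y w)%R =
  lam%:E * \int[P]_w \int[mu]_v
    (if (sig (Y w) <= v < sig (Y w) + X w)%R then Z (v, Y w) else 0).
Proof.
move=> lam0 Xlam XY msig mZ Z0.
have msnd : measurable_fun setT (fun p : R * U => sig p.2) by exact: measurableT_comp.
have mZs : measurable_fun setT (fun p : R * U => Z (sig p.2 + p.1, p.2)%R).
  apply: measurableT_comp => //; apply: measurable_fun_pair => //.
  exact: measurable_funD.
rewrite (indep_integral (f := fun p => Z (sig p.2 + p.1, p.2)%R))//.
(* Time is counted from [sig]: [p.1.1] is the total length of the exponential clock and [p.2] the
   time elapsed on it. *)
pose g (p : (R * U) * R) : \bar R :=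
  if (0 <= p.2 < p.1.1)%R then Z (sig p.1.2 + p.2, p.1.2)%R else 0.
have mg : measurable_fun setT g.
  apply: measurable_fun_ifT => //.
    apply: measurable_and.
      by apply: measurable_fun_ler => //.
    apply: measurable_fun_ltr => //; exact: measurableT_comp.
  apply: measurableT_comp => //; apply: measurable_fun_pair => //.
    apply: measurable_funD => //.
    by do 2 apply: measurableT_comp => //.
  by apply: measurableT_comp => //.
have g0 p : 0 <= g p by rewrite /g; case: ifP.
have -> : \int[P]_w \int[mu]_v
    (if (sig (Y w) <= v < sig (Y w) + X w)%R then Z (v, Y w) else 0) =
  \int[P]_w (fun q => \int[mu]_v g (q, v)) (X w, Y w).
  apply: eq_integral => w _.
  rewrite -(lebesgue_integral_translate (sig (Y w))).
  - by apply: eq_integral => v _; rewrite /g/= lerDl ltrD2l.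
  - apply: measurable_fun_ifT => //.
      by apply: measurable_and; [exact: measurable_fun_ler|exact: measurable_fun_ltr].
    by apply: measurableT_comp.
  - by move=> v; case: ifP.
have mG : measurable_fun setT (fun q : R * U => \int[mu]_v g (q, v)).
  exact: (@measurable_fun_fubini_tonelli_F _ _ _ _ _ mu g).
rewrite (indep_integral (f := fun q => \int[mu]_v g (q, v)))//; last by move=> q; exact: integral_ge0.
rewrite -ge0_integralZl//; last 3 first.
- apply: (@measurableT_comp _ _ _ _ _ _ (fun y => \int[distribution P X]_x \int[mu]_v g (x, y, v))) => //.
  apply: (@measurable_fun_fubini_tonelli_G _ _ _ _ _ (distribution P X) (fun q => \int[mu]_v g (q, v))) => //.
  by move=> q; exact: integral_ge0.
- by move=> w _; apply: integral_ge0 => x _; apply: integral_ge0.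
- by rewrite lee_fin ltW.
apply: eq_integral => w _.
set y := Y w.
rewrite (exponential_integral lam0 Xlam)//; last first.
  apply: (measurableT_comp mZs); exact: measurable_fun_pair.
rewrite (@fubini_tonelli _ _ _ _ _ (distribution P X) mu (fun p => g (p.1, y, p.2)))//; last first.
  apply: measurableT_comp => //.
  apply: measurable_fun_pair => //; apply: measurable_fun_pair => //.
rewrite -ge0_integralZl//; last 3 first.
- apply: (@measurable_fun_fubini_tonelli_G _ _ _ _ _ (distribution P X) (fun p => g (p.1, y, p.2))) => //.
  by apply: measurableT_comp => //; apply: measurable_fun_pair => //; apply: measurable_fun_pair.
- by move=> v _; exact: integral_ge0.
- by rewrite lee_fin ltW.
apply: eq_integral => v _ /=.
have [v0|v0] := ltP v 0%R.
  rewrite lt0_exponential_pdf// mule0 integral0_eq ?mule0// => x _.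
  by rewrite /g/= leNgt v0.
have -> : \int[distribution P X]_x g (x, y, v) = Z (sig y + v, y)%R * (expR (- lam * v))%:E.
  rewrite -exponential_prob_gt// -Xlam//.
  transitivity (\int[distribution P X]_(x in `]v, +oo[) cst (Z (sig y + v, y)%R) x).
    rewrite [RHS]integral_mkcond; apply: eq_integral => x _.
    by rewrite patchE /g/= v0/= mem_setE in_itv/= andbT.
  by rewrite integral_cst.
by rewrite exponential_pdfE// muleCA EFinM.
Qed.

End compensator.

(** * Bounded measurable functions *)

Section bounded_measurable.
Context d (T : measurableType d) (R : realType).

(** One class that is stable under all operations used below and integrable on every set of finite
    measure, so that integrability conditions reduce to closure lemmas. *)
Definition bmf (f : T -> R) :=
  measurable_fun setT f /\ exists M, forall x, `|f x| <= M.

Lemma bmf_integrable (mu : {measure set T -> \bar R}) (D : set T) (f : T -> R) :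
  measurable D -> (mu D < +oo)%E -> bmf f -> mu.-integrable D (EFin \o f).
Proof.
move=> mD muD [mf [M fM]]; apply: measurable_bounded_integrable => //.
  exact: measurable_funTS.
exists M; split; first exact: num_real.
by move=> x Mx y _; exact: le_trans (fM y) (ltW Mx).
Qed.

Lemma bmf_cst (c : R) : bmf (fun=> c).
Proof. by split; [exact: measurable_cst|exists `|c|]. Qed.

Lemma bmfD (f g : T -> R) : bmf f -> bmf g -> bmf (fun x => f x + g x).
Proof.
move=> [mf [M fM]] [mg [N gN]]; split; first exact: measurable_funD.
by exists (M + N) => x; rewrite (le_trans (ler_normD _ _))// lerD.
Qed.

Lemma bmfM (f g : T -> R) : bmf f -> bmf g -> bmf (fun x => f x * g x).
Proof.
move=> [mf [M fM]] [mg [N gN]]; split; first exact: measurable_funM.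
by exists (M * N) => x; rewrite normrM ler_pM.
Qed.

Lemma bmfN (f : T -> R) : bmf f -> bmf (fun x => - f x).
Proof.
move=> [mf [M fM]]; split; first exact: measurableT_comp.
by exists M => x; rewrite normrN.
Qed.

Lemma bmfB (f g : T -> R) : bmf f -> bmf g -> bmf (fun x => f x - g x).
Proof. by move=> bf bg; apply: bmfD => //; exact: bmfN. Qed.

Lemma bmf_indic (A : set T) : measurable A -> bmf (\1_A : T -> R).
Proof.
move=> mA; split; first exact: measurable_indic.
by exists 1 => x; rewrite indicE; case: (_ \in _); rewrite ?normr1 ?normr0.
Qed.

Lemma bmf_if (c : T -> bool) (f g : T -> R) : measurable_fun setT c ->
  bmf f -> bmf g -> bmf (fun x => if c x then f x else g x).
Proof.
move=> mc [mf [M fM]] [mg [N gN]]; split; first exact: measurable_fun_ifT.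
by exists (Num.max M N) => x; case: ifP => _; rewrite le_max ?fM ?gN ?orbT.
Qed.

Lemma bmf_sum (n : nat) (f : nat -> T -> R) : (forall k, bmf (f k)) ->
  bmf (fun x => \sum_(k < n) f k x).
Proof.
move=> bf; elim: n => [|n IH].
  by under eq_fun do rewrite big_ord0; exact: bmf_cst.
by under eq_fun do rewrite big_ord_recr/=; exact: bmfD.
Qed.

End bounded_measurable.

Lemma bmf_comp d d' (T : measurableType d) (U : measurableType d') (R : realType)
  (f : U -> R) (g : T -> U) : bmf f -> measurable_fun setT g -> bmf (f \o g).
Proof.
move=> [mf [M fM]] mg; split; first exact: measurableT_comp.
by exists M => x /=; exact: fM.
Qed.

(** * Workload paths *)

Section clock.
Context (R : realType).
Notation mu := (@lebesgue_measure R).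
Variable O : set R.
Hypothesis mO : measurable O.

Definition clk (t : R) : R := fine (mu (`[0, t]%classic `&` O)).

Lemma mu_itv_lty (D : set R) (u v : R) (i j : bool) : measurable D ->
  (mu ([set` Interval (BSide i u) (BSide j v)] `&` D) < +oo)%E.
Proof.
move=> mD; apply: (@le_lt_trans _ _ (mu [set` Interval (BSide i u) (BSide j v)])).
  by apply: le_measure; rewrite ?inE//; exact: measurableI.
by rewrite lebesgue_measure_itv; case: ifP => _; rewrite ?ltry// -EFinB ltry.
Qed.

Lemma clkD (u v : R) : 0 <= u -> u <= v ->
  clk v = clk u + fine (mu (`[u, v[%classic `&` O)).
Proof.
move=> u0 uv; rewrite /clk -fineD; last 2 first.
- by rewrite ge0_fin_numE// mu_itv_lty.
- by rewrite ge0_fin_numE// mu_itv_lty.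
congr fine.
have mI (I : interval R) : measurable ([set` I] `&` O) by exact: measurableI.
have ae0 (x : R) (D : set R) : D `<=` [set x] -> measurable D -> mu D = 0%E.
  move=> Dx mD; apply/eqP; rewrite -measure_le0 -(lebesgue_measure_set1 x).
  by apply: le_measure; rewrite ?inE.
(* The closed right endpoint in [clk] is a null set; half-open intervals concatenate without
   overlap. *)
have half (w : R) : 0 <= w ->
    mu (`[0, w]%classic `&` O) = mu (`[0, w[%classic `&` O).
  move=> w0; have -> : `[0, w]%classic `&` O =
      (`[0, w[%classic `&` O) `|` ([set w] `&` O).
    rewrite -setIUl; congr (_ `&` _); apply/seteqP; split=> z /=.
      rewrite !in_itv/= => /andP[z0]; rewrite le_eqVlt => /predU1P[->|zw].
        by right.
      by left; rewrite z0.
    by move=> [|->]; rewrite !in_itv/= ?w0 ?lexx// => /andP[-> /ltW].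
  rewrite measureU//.
  - rewrite -[RHS]adde0; congr (_ + _)%E; apply: (ae0 w) => //.
    exact: measurableI.
  - exact: measurableI.
  - exact: measurableI.
  - apply/seteqP; split=> z //= [[]].
    by rewrite in_itv/= => /andP[_ zw] _ [zw' _]; rewrite zw' ltxx in zw.
rewrite !half//; last exact: le_trans uv.
rewrite -measureU; [|exact: mI|exact: mI|].
  congr (mu _); rewrite -setIUl; congr (_ `&` _).
  apply/seteqP; split=> z /=.
    rewrite !in_itv/= => /andP[z0 zv]; have [zu|uz] := ltP z u.
      by left; rewrite z0.
    by right; rewrite zv.
  by move=> []; rewrite !in_itv/= => /andP[h1 h2]; apply/andP; split; lra.
apply/seteqP; split=> z //= [[+ _] [+ _]].
by rewrite !in_itv/= => /andP[_ zu] /andP[uz _]; lra.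
Qed.

Lemma clk_le (u v : R) : 0 <= u -> u <= v -> clk u <= clk v.
Proof. by move=> u0 uv; rewrite (clkD u0 uv) lerDl fine_ge0. Qed.

Lemma clk_lip (u v : R) : 0 <= u -> u <= v -> clk v <= clk u + (v - u).
Proof.
move=> u0 uv; rewrite (clkD u0 uv) lerD2l.
rewrite -lee_fin fineK; last by rewrite ge0_fin_numE// mu_itv_lty.
apply: (@le_trans _ _ (mu `[u, v[%classic)).
  by apply: le_measure; rewrite ?inE//; exact: measurableI.
rewrite lebesgue_measure_itv/= lte_fin; case: ifP => _; rewrite ?lee_fin ?subr_ge0//.
Qed.

End clock.

Section measurable_clock.
Context d (Y : measurableType d) (R : realType).
Notation mu := (@lebesgue_measure R).

(** The clock is the measure of a section of the measurable set [A] cut at [tau], and section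
    measures are measurable. *)
Lemma measurable_clk (A : set (Y * R)) (tau : Y -> R) :
  measurable A -> measurable_fun setT tau ->
  measurable_fun setT (fun y => clk [set z | A (y, z)] (tau y)).
Proof.
move=> mA mtau.
pose B := A `&` [set p | 0 <= p.2 <= tau p.1].
have mB : measurable B.
  apply: measurableI => //.
  rewrite (_ : [set _ | _] = (fun p : Y * R => 0 <= p.2 <= tau p.1) @^-1` [set true]); last first.
    by apply/seteqP; split=> p.
  rewrite -[X in measurable X]setTI.
  have mb : measurable_fun setT (fun p : Y * R => 0 <= p.2 <= tau p.1).
    apply: measurable_and; first exact: measurable_fun_ler.
    by apply: measurable_fun_ler => //; exact: measurableT_comp.
  exact: mb.
apply: (eq_measurable_fun (fine \o (fun y => mu (xsection B y)))) => [y _|].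
  rewrite /clk/=; congr (fine (mu _)); apply/seteqP; split=> z /=.
    by rewrite xsectionE => -[h1 h2]; split => //; rewrite in_itv.
  by rewrite in_itv/= => -[h1 h2]; rewrite xsectionE/=; split.
apply: measurableT_comp => //.
exact: (measurable_fun_xsection mu).
Qed.

End measurable_clock.

(** * Chain rule along the clock *)

Section chain_rule.
Context (R : realType).
Notation mu := (@lebesgue_measure R).

(** Cutting the interval into n equal pieces leaves a total of order 1/n. This replaces the
    fundamental theorem of calculus along the clock, which is Lipschitz but differentiable only
    almost everywhere. *)
Lemma quadratic_additive0 (Psi : R -> R -> R) (K : R) :
  (forall u v w, 0 <= u -> u <= v -> v <= w -> Psi u w = Psi u v + Psi v w) ->
  (forall u v, 0 <= u -> u <= v -> `|Psi u v| <= K * (v - u) ^+ 2) ->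
  forall u v, 0 <= u -> u <= v -> Psi u v = 0.
Proof.
move=> add quad u v u0 uv; apply/eqP; rewrite -normr_eq0 eq_le normr_ge0 andbT.
pose D := K * (v - u) ^+ 2.
have K0 : 0 <= K by have := quad 0 1 (lexx _) ler01; rewrite subr0 expr1n mulr1; exact: le_trans.
have step (n : nat) (h : R) : 0 <= h -> `|Psi u (u + n%:R * h)| <= n%:R * (K * h ^+ 2).
  move=> h0; elim: n => [|n IH].
    by rewrite !mul0r addr0 (le_trans (quad u u u0 (lexx _)))// subrr expr0n mulr0.
  rewrite (add u (u + n%:R * h)) ?lerDl ?mulr_ge0//; last first.
    by rewrite lerD2l ler_wpM2r// ler_nat.
  rewrite (le_trans (ler_normD _ _))//.
  rewrite [leRHS](_ : _ = n%:R * (K * h ^+ 2) + K * h ^+ 2); last first.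
    by rewrite -natr1; ring.
  rewrite lerD//.
  rewrite (le_trans (quad _ _ _ _))//.
  - by rewrite addr_ge0// mulr_ge0.
  - by rewrite lerD2l ler_wpM2r// ler_nat.
  rewrite (_ : u + _ - _ = h)//; rewrite -natr1; ring.
have bound n : `|Psi u v| <= D / n.+1%:R.
  have := step n.+1 ((v - u) / n.+1%:R).
  rewrite divr_ge0 ?subr_ge0// => /(_ isT).
  rewrite [in X in X -> _]mulrCA divff ?mulr1 ?pnatr_eq0// addrC subrK.
  move/le_trans; apply.
  rewrite (_ : _ * _ = D / n.+1%:R)// /D.
  have : n.+1%:R != 0 :> R by rewrite pnatr_eq0.
  by move: (n.+1%:R : R) => m m0; field.
rewrite leNgt; apply/negP => Psi0.
have [n hn] : exists n : nat, D / n.+1%:R < `|Psi u v|.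
  exists (Num.truncn (D / `|Psi u v|)).
  rewrite ltr_pdivrMr// -ltr_pdivrMl// mulrC.
  by rewrite truncnS_gt.
by have := bound n; rewrite leNgt hn.
Qed.

Variable O : set R.
Hypothesis mO : measurable O.
Variables (F G : R -> R) (K M : R).
Hypothesis FG : forall x y, `|F x - F y - G y * (x - y)| <= K * (x - y) ^+ 2.
Hypothesis Glip : forall x y, `|G x - G y| <= K * `|x - y|.
Hypothesis mG : measurable_fun setT G.
Hypothesis GM : forall x, `|G x| <= M.

Let C := clk O.

Lemma measurable_clk1 : measurable_fun setT C.
Proof.
apply: (@measurable_clk _ R R [set p | O p.2] id) => //.
by rewrite -[X in measurable X]setTI; exact: measurable_snd.
Qed.

Lemma chain_rule_clk (L u v : R) : 0 <= u -> u <= v ->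
  F (L - C v) - F (L - C u) = - \int[mu]_(z in `[u, v[) (G (L - C z) * \1_O z).
Proof.
have bG : bmf (fun z => G (L - C z)).
  split; last by exists M.
  by apply: measurableT_comp => //; apply: measurable_funB => //; exact: measurable_clk1.
have bO : bmf (\1_O : R -> R) by exact: bmf_indic.
have bGO : bmf (fun z => G (L - C z) * \1_O z) by exact: bmfM.
have muI (x y : R) : (mu `[x, y[%classic < +oo)%E.
  by have := mu_itv_lty x y true true measurableT; rewrite setIT.
have int (x y : R) (f : R -> R) : bmf f -> mu.-integrable `[x, y[ (EFin \o f).
  by move=> bf; apply: (@bmf_integrable _ (measurableTypeR R) R mu) => //; exact: muI.
pose Psi u v := F (L - C v) - F (L - C u) + \int[mu]_(z in `[u, v[) (G (L - C z) * \1_O z).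
suff h : forall u v, 0 <= u -> u <= v -> Psi u v = 0.
  by move=> u0 uv; apply/eqP; rewrite -subr_eq0 opprK; apply/eqP; exact: h.
(* One [K] comes from the second-order remainder of [F], the other from the variation of
   [G (L - C z)] over the interval; both use that the clock advances no faster than time. *)
apply: (@quadratic_additive0 _ (2 * K)).
  move=> x y z x0 xy yz; rewrite /Psi.
  have e : `[x, z[%classic = `[x, y[%classic `|` `[y, z[%classic.
    apply/seteqP; split=> w /=.
      rewrite !in_itv/= => /andP[h1 h2]; have [wy|yw] := ltP w y.
        by left; rewrite h1.
      by right; rewrite h2.
    by move=> []; rewrite !in_itv/= => /andP[h1 h2]; apply/andP; split; lra.
  rewrite e Rintegral_setU//.
  - ring.
  - by rewrite -e; exact: int.
  - apply/disj_set2P; apply/seteqP; split=> w //= [].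
    by rewrite !in_itv/= => /andP[_ h1] /andP[h2 _]; lra.
move=> x y x0 xy; rewrite /Psi.
have CE : C y - C x = \int[mu]_(z in `[x, y[) (\1_O z).
  rewrite /C (clkD mO x0 xy) addrC addKr /Rintegral integral_indic//.
  by rewrite setIC.
pose I := \int[mu]_(z in `[x, y[) ((G (L - C z) - G (L - C x)) * \1_O z).
have IE : \int[mu]_(z in `[x, y[) (G (L - C z) * \1_O z) =
    I + G (L - C x) * (C y - C x).
  rewrite CE -RintegralZl//; last exact: int.
  rewrite /I -RintegralD//.
  - by apply: eq_Rintegral => z _; ring.
  - by apply: int; apply: bmfM => //; apply: bmfB => //; exact: bmf_cst.
  - by apply: int; apply: bmfM => //; exact: bmf_cst.
have Ilt : `|I| <= K * (y - x) ^+ 2.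
  apply: le_trans.
    apply: le_normr_Rintegral => //.
    by apply: int; apply: bmfM => //; apply: bmfB => //; exact: bmf_cst.
  apply: (@le_trans _ _ (\int[mu]_(z in `[x, y[) (K * (y - x)))).
    have K0 : 0 <= K.
      by have := Glip 1 0; rewrite subr0 normr1 mulr1; exact: le_trans.
    apply: le_Rintegral => //.
    - apply: int; split.
        apply: measurableT_comp => //; apply: measurable_funM => //.
        apply: measurable_funB => //; exact: bG.1.
      exists (2 * M) => z; rewrite normr_id normrM.
      apply: (@le_trans _ _ (`|G (L - C z) - G (L - C x)| * 1)).
        by rewrite ler_wpM2l// indicE; case: (_ \in _); rewrite ?normr1 ?normr0.
      rewrite mulr1 (le_trans (ler_normB _ _))// mulr_natl mulr2n.
      by rewrite lerD// GM.
    - by apply: int; exact: bmf_cst.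
    - move=> z /=; rewrite in_itv/= => /andP[xz zy].
      have z0 : 0 <= z by exact: le_trans xz.
      rewrite normrM; apply: (@le_trans _ _ (`|G (L - C z) - G (L - C x)| * 1)).
        by rewrite ler_wpM2l// indicE; case: (_ \in _); rewrite ?normr1 ?normr0.
      rewrite mulr1 (le_trans (Glip _ _))// ler_wpM2l//.
      rewrite (_ : _ - _ = - (C z - C x)); last by ring.
      rewrite normrN ger0_norm; last by rewrite subr_ge0 clk_le.
      have := clk_lip mO x0 xz; rewrite -/C; lra.
  have mE : fine (mu `[x, y[%classic) = y - x.
    rewrite lebesgue_measure_itv/= lte_fin; case: ltP => //= yx.
    by apply/esym/eqP; rewrite subr_eq0 eq_le yx xy.
  by rewrite Rintegral_cst// [X in _ * X]mE expr2 mulrA.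
rewrite IE.
have -> : F (L - C y) - F (L - C x) + (I + G (L - C x) * (C y - C x)) =
   (F (L - C y) - F (L - C x) - G (L - C x) * ((L - C y) - (L - C x))) + I by ring.
rewrite (le_trans (ler_normD _ _))// mulr2n mulrDl mul1r mulrDl lerD//.
rewrite (le_trans (FG _ _))//.
have K0 : 0 <= K.
  by have := Glip 1 0; rewrite subr0 normr1 mulr1; exact: le_trans.
rewrite ler_wpM2l// -[leRHS]real_normK ?num_real// -[leLHS]real_normK ?num_real//.
rewrite lerXn2r ?nnegrE//.
rewrite (_ : L - _ - _ = - (C y - C x)); last by ring.
rewrite normrN !ger0_norm ?subr_ge0//; last exact: clk_le.
have := clk_lip mO x0 xy; rewrite -/C; lra.
Qed.

End chain_rule.

(** * Lindley recursion in clock time *)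

Section paths.
Context (R : realType).
Notation mu := (@lebesgue_measure R).

Definition epoch (r : nat -> R) (n : nat) : R := \sum_(k < n) r k.

Definition server (on : nat -> bool) (r : nat -> R) : set R :=
  \bigcup_(m in [set m | on m]) `[epoch r m, epoch r m.+1[%classic.

(* [C] is the clock of the queue, [x0] the backlog; customer [k] arrives at
   [epoch a k.+1] and needs [b k]. [level n] is the clock reading at which the
   first [n] customers are gone, [wl n] the workload if no others ever arrive. *)
Fixpoint level (C : R -> R) (a b : nat -> R) (x0 : R) (n : nat) : R :=
  if n is m.+1
  then Num.max (level C a b x0 m) (C (epoch a m.+1)) + b m else x0.

Fixpoint wl (C : R -> R) (a b : nat -> R) (x0 : R) (n : nat) (t : R) : R :=
  if n is m.+1
  then if epoch a m.+1 <= t then Num.max 0 (level C a b x0 m.+1 - C t)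
       else wl C a b x0 m t
  else Num.max 0 (x0 - C t).

Lemma epochS (r : nat -> R) n : epoch r n.+1 = epoch r n + r n.
Proof. by rewrite /epoch big_ord_recr. Qed.

Lemma epoch0 (r : nat -> R) : epoch r 0 = 0.
Proof. by rewrite /epoch big_ord0. Qed.

Lemma epoch_le (r : nat -> R) m n : (forall k, 0 <= r k) -> (m <= n)%N ->
  epoch r m <= epoch r n.
Proof.
move=> r0 /subnKC <-; elim: (n - m)%N => [|k IH]; first by rewrite addn0.
by rewrite addnS epochS (le_trans IH)// lerDl.
Qed.

Lemma epoch_ge0 (r : nat -> R) n : (forall k, 0 <= r k) -> 0 <= epoch r n.
Proof. by move=> r0; rewrite -(epoch0 r) epoch_le. Qed.

Lemma measurable_server on r : measurable (server on r).
Proof. by apply: bigcup_measurable => m _; exact: measurable_itv. Qed.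

Variables (C : R -> R) (a b : nat -> R) (x0 : R).
Hypothesis a0 : forall k, 0 <= a k.
Hypothesis b0 : forall k, 0 <= b k.

Local Notation lev := (level C a b x0).
Local Notation W := (wl C a b x0).
Local Notation A := (epoch a).

Lemma wl_ge0 n t : 0 <= W n t.
Proof.
by elim: n => [|n IH] /=; [|case: ifP => // _]; rewrite le_max lexx.
Qed.

Lemma wlE n t : A n <= t -> W n t = Num.max 0 (lev n - C t).
Proof. by case: n => [//|n] /= ->. Qed.

(** The [max] in [level] restarts from the current clock reading when the queue has run empty, which
    is what truncates the old workload at 0. *)
Lemma level_jump n : lev n.+1 - C (A n.+1) = W n (A n.+1) + b n.
Proof.
rewrite wlE; last by rewrite epoch_le.
rewrite /=; case: (leP (lev n) (C (A n.+1))) => h.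
  by rewrite max_l ?subr_le0//; lra.
by rewrite max_r ?subr_ge0 ?ltW//; lra.
Qed.

Definition jump_sum (f : R -> R) (n : nat) (u v : R) : R :=
  \sum_(k < n) (if u < A k.+1 <= v
    then f (W k (A k.+1) + b k) - f (W k (A k.+1)) else 0).

Variables (O : set R) (F G : R -> R) (u0 v0 : R).
Hypothesis mO : measurable O.
Hypothesis bG : bmf G.
Hypothesis mC : measurable_fun setT C.
Hypothesis drift : forall L u v, u0 <= u -> u <= v -> v <= v0 ->
  F (Num.max 0 (L - C v)) - F (Num.max 0 (L - C u)) =
  - \int[mu]_(z in `[u, v[) (G (Num.max 0 (L - C z)) * \1_O z).

Lemma measurable_wl1 n : measurable_fun setT (W n).
Proof.
have mL L : measurable_fun setT (fun t => Num.max 0 (L - C t)).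
  by apply: measurable_maxr => //; exact: measurable_funB.
elim: n => [|n IH]; first exact: mL.
by apply: measurable_fun_ifT => //; exact: measurable_fun_ler.
Qed.

(** Between arrivals the workload is the positive part of a fixed level minus the clock, which
    [drift] covers; each arrival adds one jump. Asking for [drift] on [[u0, v0]] only lets the lemma
    serve two cases: smooth [F] on [[0, t]], and an arbitrary bounded function with [G] = 0 on a
    visit to the other queue. *)
Lemma wl_increment n u v : u0 <= u -> u <= v -> v <= v0 ->
  F (W n v) - F (W n u) =
  jump_sum F n u v - \int[mu]_(z in `[u, v[) (G (W n z) * \1_O z).
Proof.
elim: n u v => [|n IH] u v u0u uv vv0.
  by rewrite /jump_sum big_ord0 add0r drift.
rewrite /jump_sum big_ord_recr/= -/(jump_sum F n u v).
have [Av|vA] := leP (A n.+1) v; last first.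
  rewrite andbF addr0 (lt_geF (le_lt_trans uv vA)) IH//.
  congr (_ - _); apply: eq_Rintegral => z; rewrite inE/= in_itv/= => /andP[_ zv].
  by rewrite (lt_geF (lt_trans zv vA)).
rewrite andbT; have [Au|uA] := leP (A n.+1) u.
  rewrite addr0 drift// /jump_sum big1 ?add0r; last first.
    move=> k _; rewrite ltNge (le_trans _ Au)//.
    by apply: epoch_le => //; rewrite ltnS ltnW.
  congr (- _); apply: eq_Rintegral => z; rewrite inE/= in_itv/= => /andP[uz _].
  by rewrite (le_trans Au uz).
have bI : bmf (fun z => G (W n.+1 z) * \1_O z).
  apply: bmfM; last exact: bmf_indic.
  by apply: (bmf_comp bG); exact: measurable_wl1.
have e : `[u, v[%classic = `[u, A n.+1[%classic `|` `[A n.+1, v[%classic.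
  apply/seteqP; split=> w /=.
    rewrite !in_itv/= => /andP[h1 h2]; have [wy|yw] := ltP w (A n.+1).
      by left; rewrite h1.
    by right; rewrite h2.
  by move=> []; rewrite !in_itv/= => /andP[h1 h2]; apply/andP; split; lra.
have -> : \int[mu]_(z in `[u, v[) (G (W n.+1 z) * \1_O z) =
    (\int[mu]_(z in `[u, A n.+1[) (G (W n z) * \1_O z)) +
    \int[mu]_(z in `[A n.+1, v[) (G (Num.max 0 (lev n.+1 - C z)) * \1_O z).
  rewrite e Rintegral_setU//.
  - congr (_ + _); apply: eq_Rintegral => z; rewrite inE/= in_itv/= => /andP[h1 h2].
      by rewrite (lt_geF h2).
    by rewrite h1.
  - rewrite -e; apply: (@bmf_integrable _ (measurableTypeR R) R mu) => //.
    by have := mu_itv_lty u v true true measurableT; rewrite setIT.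
  - apply/disj_set2P; apply/seteqP; split=> w //= [].
    by rewrite !in_itv/= => /andP[_ h1] /andP[h2 _]; lra.
have := IH u (A n.+1) u0u (ltW uA) (le_trans Av vv0).
have := @drift (lev n.+1) (A n.+1) v (le_trans u0u (ltW uA)) Av vv0.
rewrite level_jump (@max_r _ _ 0 (W n (A n.+1) + b n)) ?addr_ge0 ?wl_ge0//.
have -> : jump_sum F n u v = jump_sum F n u (A n.+1).
  apply: eq_bigr => k _.
  have Ak : A k.+1 <= A n.+1 by apply: epoch_le => //; rewrite ltnS ltnW.
  by rewrite Ak (le_trans Ak Av).
lra.
Qed.

End paths.

(** * Causality and measurability of paths *)

Section locality.
Context (R : realType).
Notation mu := (@lebesgue_measure R).
Implicit Types (a b r : nat -> R) (C : R -> R).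

Lemma level_ext C C' a b x0 n : (forall k, (k <= n)%N -> C (epoch a k) = C' (epoch a k)) ->
  level C a b x0 n = level C' a b x0 n.
Proof.
elim: n => [//|n IH] h /=; rewrite IH ?h// => k kn.
by apply: h; rewrite ltnW.
Qed.

Lemma wl_ext C C' a b x0 n t : (forall k, 0 <= a k) -> 0 <= t ->
  (forall z, 0 <= z <= t -> C z = C' z) ->
  wl C a b x0 n t = wl C' a b x0 n t.
Proof.
move=> a0 t0 CC'; elim: n => [|n IH]; rewrite /wl -/wl.
  by rewrite CC'// t0 lexx.
case: ifPn => // At; rewrite CC' ?t0 ?lexx//; congr (Num.max 0 (_ - _)).
apply: level_ext => k kn; apply: CC'.
by rewrite epoch_ge0//= (le_trans _ At)// epoch_le.
Qed.

Lemma clk0 (O : set R) : clk O 0 = 0.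
Proof.
rewrite /clk set_itv1; have [oz|noz] := pselect (O 0).
  by rewrite setIidl ?lebesgue_measure_set1// => _ ->.
by rewrite (_ : _ `&` _ = set0) ?measure0//; apply/seteqP; split=> // z [->].
Qed.

Lemma clk_co (O : set R) v : measurable O -> 0 <= v ->
  clk O v = fine (mu (`[0, v[%classic `&` O)).
Proof. by move=> mO v0; rewrite (clkD mO (lexx 0) v0) clk0 add0r. Qed.

Lemma epoch_inj r z k m : (forall j, 0 <= r j) ->
  epoch r k <= z < epoch r k.+1 -> epoch r m <= z < epoch r m.+1 -> k = m.
Proof.
move=> r0 /andP[k1 k2] /andP[m1 m2]; apply/eqP; rewrite eqn_leq.
apply/andP; split; rewrite leqNgt; apply/negP => km.
  by have := le_lt_trans (le_trans (epoch_le r0 km) k1) m2; rewrite ltxx.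
by have := le_lt_trans (le_trans (epoch_le r0 km) m1) k2; rewrite ltxx.
Qed.

Lemma clk_off on r m u v : (forall j, 0 <= r j) -> ~~ on m ->
  epoch r m <= u -> u <= v -> v <= epoch r m.+1 ->
  clk (server on r) u = clk (server on r) v.
Proof.
move=> r0 offm mu1 uv vm; have u0 : 0 <= u by exact: le_trans (epoch_ge0 m r0) mu1.
rewrite (clkD (measurable_server on r) u0 uv).
rewrite (_ : _ `&` _ = set0) ?measure0 ?addr0//.
apply/seteqP; split=> // z [/=]; rewrite in_itv/= => /andP[uz zv].
move=> [k /= onk]; rewrite in_itv/= => kz; move: offm.
rewrite -(@epoch_inj r z k m) ?onk//.
by rewrite (le_trans mu1 uz) (lt_le_trans zv vm).
Qed.

Lemma epoch_ext r r' m : (forall j, (j < m)%N -> r j = r' j) ->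
  epoch r m = epoch r' m.
Proof. by move=> h; apply: eq_bigr => k _; exact: h. Qed.

Lemma server_sub on r r' m v : (forall j, 0 <= r j) ->
  (forall j, (j < m)%N -> r j = r' j) ->
  v <= epoch r m + r m -> v <= epoch r' m + r' m ->
  `[0, v[%classic `&` server on r `<=` `[0, v[%classic `&` server on r'.
Proof.
move=> r0 rr' vr vr' z [zv [k /= onk]]; rewrite in_itv/= => /andP[kz zk].
split=> //; exists k => //=.
have zv' : z < v by move: zv; rewrite /= in_itv/= => /andP[].
have [km|] := leqP k m; last first.
  move=> mk; have := lt_le_trans zv' vr; rewrite -epochS.
  by move/(le_lt_trans (le_trans (epoch_le r0 mk) kz)); rewrite ltxx.
rewrite in_itv/= -(@epoch_ext r r' k); last first.
  by move=> j jk; apply: rr'; exact: leq_trans km.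
rewrite kz/=; move: km; rewrite leq_eqVlt => /predU1P[->|km].
  by rewrite epochS (lt_le_trans zv' vr').
by rewrite -(@epoch_ext r r' k.+1)// => j jk; apply: rr'; exact: leq_trans km.
Qed.

(** The lengths of visit m itself may differ: at time [v] that visit is not over in either schedule.
    This allows a visit to be lengthened without changing the path before its end. *)
Lemma clk_ext on r r' m v : (forall j, 0 <= r j) -> (forall j, 0 <= r' j) ->
  (forall j, (j < m)%N -> r j = r' j) -> 0 <= v ->
  v <= epoch r m + r m -> v <= epoch r' m + r' m ->
  clk (server on r) v = clk (server on r') v.
Proof.
move=> r0 r'0 rr' v0 vr vr'.
rewrite !clk_co//; try exact: measurable_server.
congr (fine (mu _)); apply/seteqP; split; apply: (@server_sub _ _ _ m) => //.
by move=> j jm; rewrite rr'.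
Qed.

End locality.

Section path_measurability.
Context d (Y : measurableType d) (R : realType).
Variables (on : nat -> bool) (a b r : nat -> Y -> R) (x0 : R).
Hypothesis mr : forall k, measurable_fun setT (r k).

Lemma measurable_epoch (a' : nat -> Y -> R) n :
  (forall k, (k < n)%N -> measurable_fun setT (a' k)) ->
  measurable_fun setT (fun y => epoch (a' ^~ y) n).
Proof.
elim: n => [|n IH] ma; first by under eq_fun do rewrite epoch0; exact: measurable_cst.
under eq_fun do rewrite epochS; apply: measurable_funD; last exact: ma.
by apply: IH => k kn; apply: ma; rewrite ltnS ltnW.
Qed.

Lemma measurable_server2 :
  measurable [set p : Y * R | server on (r ^~ p.1) p.2].
Proof.
rewrite (_ : [set _ | _] = \bigcup_(m in [set m | on m])
  [set p : Y * R | epoch (r ^~ p.1) m <= p.2 < epoch (r ^~ p.1) m.+1]); last first.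
  apply/seteqP; split=> p /= [m onm]; rewrite ?in_itv/= => h; exists m => //=; by rewrite ?in_itv.
apply: bigcup_measurable => m _.
have mS k : measurable_fun setT (fun p : Y * R => epoch (r ^~ p.1) k).
  by apply: (measurableT_comp (measurable_epoch _)) => // j _; exact: mr.
have mb : measurable_fun setT (fun p : Y * R => epoch (r ^~ p.1) m <= p.2 < epoch (r ^~ p.1) m.+1).
  by apply: measurable_and; [exact: measurable_fun_ler|exact: measurable_fun_ltr].
rewrite -[X in measurable X]setTI.
exact: (mb measurableT [set true]).
Qed.

Lemma measurable_clk_server tau : measurable_fun setT tau ->
  measurable_fun setT (fun y => clk (server on (r ^~ y)) (tau y)).
Proof. by move=> mtau; exact: (measurable_clk measurable_server2 mtau). Qed.

Lemma measurable_level n :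
  (forall k, (k < n)%N -> measurable_fun setT (a k)) ->
  (forall k, (k < n)%N -> measurable_fun setT (b k)) ->
  measurable_fun setT
    (fun y => level (clk (server on (r ^~ y))) (a ^~ y) (b ^~ y) x0 n).
Proof.
elim: n => [|n IH] ma mb; first exact: measurable_cst.
apply: measurable_funD; last exact: mb.
apply: measurable_maxr.
  by apply: IH => k kn; [apply: ma|apply: mb]; rewrite ltnS ltnW.
by apply: measurable_clk_server; exact: measurable_epoch.
Qed.

Lemma measurable_wl n tau : measurable_fun setT tau ->
  (forall k, (k < n)%N -> measurable_fun setT (a k)) ->
  (forall k, (k < n)%N -> measurable_fun setT (b k)) ->
  measurable_fun setT
    (fun y => wl (clk (server on (r ^~ y))) (a ^~ y) (b ^~ y) x0 n (tau y)).
Proof.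
move=> mtau; elim: n => [|n IH] ma mb.
  apply: measurable_maxr => //; apply: measurable_funB => //.
  exact: measurable_clk_server.
apply: measurable_fun_ifT.
- by apply: measurable_fun_ler => //; exact: measurable_epoch.
- apply: measurable_maxr => //; apply: measurable_funB; first exact: measurable_level.
  exact: measurable_clk_server.
- by apply: IH => k kn; [apply: ma|apply: mb]; rewrite ltnS ltnW.
Qed.

End path_measurability.

(** * Expectations and their integrals over time *)

Section expectation.
Context d (T : measurableType d) (R : realType) (P : probability T R).
Implicit Types f g : T -> R.

Lemma bmf_P f : bmf f -> P.-integrable setT (EFin \o f).
Proof.
have PT : (P setT < +oo)%E by rewrite probability_setT ltry.
by move=> bf; apply: bmf_integrable.
Qed.

Lemma Rexp_bound f M : bmf f -> (forall w, `|f w| <= M) -> `|\int[P]_w f w| <= M.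
Proof.
move=> bf fM; apply: le_trans.
  by apply: le_normr_Rintegral => //; exact: bmf_P.
apply: (@le_trans _ _ (\int[P]_w M)).
  apply: le_Rintegral => //; last exact: bmf_P (bmf_cst _ _).
  apply: bmf_P; split; first by apply: measurableT_comp => //; exact: bf.1.
  by exists M => w; rewrite normr_id.
have PT : fine (P setT) = 1 by rewrite probability_setT.
by rewrite Rintegral_cst// [X in _ * X]PT mulr1.
Qed.

Lemma Rexp_prob (A : set T) : measurable A -> \int[P]_w \1_A w = fine (P A).
Proof. by move=> mA; rewrite /Rintegral integral_indic// setIT. Qed.

Lemma Rexp_le_prob f (A : set T) M : bmf f -> measurable A ->
  (forall w, `|f w| <= M * \1_A w) -> `|\int[P]_w f w| <= M * fine (P A).
Proof.
move=> bf mA fM; apply: le_trans.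
  by apply: le_normr_Rintegral => //; exact: bmf_P.
rewrite -Rexp_prob// -RintegralZl//; last exact: bmf_P (bmf_indic _ mA).
apply: le_Rintegral => //.
- apply: bmf_P; split; first by apply: measurableT_comp => //; exact: bf.1.
  by have [M' fM'] := bf.2; exists M' => w; rewrite normr_id.
- by apply: bmf_P; apply: bmfM; [exact: bmf_cst|exact: bmf_indic].
Qed.

Lemma Rexp_EFin f : bmf f -> (\int[P]_w (f w)%:E)%E = (\int[P]_w f w)%:E.
Proof. by move=> bf; rewrite /Rintegral fineK//; apply: integrable_fin_num => //; exact: bmf_P. Qed.

End expectation.

Section space_time.
Context d (T : measurableType d) (R : realType) (P : probability T R).
Notation mu := (@lebesgue_measure R).
Local Notation Pmu := (P \x mu)%E.
Implicit Types g : T * R -> R.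

(** A single integral over the product space, so that either time or chance can be integrated first;
    division by t gives the averages of the balances. *)
Definition ED (t : R) g : R :=
  \int[Pmu]_(p in [set p : T * R | 0 < p.2 <= t]) g p.

Let D t : set (T * R) := [set p : T * R | 0 < p.2 <= t].

Lemma measurable_D t : measurable (D t).
Proof.
have mb : measurable_fun setT (fun p : T * R => 0 < p.2 <= t).
  by apply: measurable_and; [exact: measurable_fun_ltr|exact: measurable_fun_ler].
by rewrite -[X in measurable X]setTI; exact: (mb measurableT [set true]).
Qed.

Lemma measure_D t : 0 <= t -> (Pmu (D t) = t%:E)%E.
Proof.
move=> t0; have -> : D t = setT `*` `]0, t]%classic.
  by apply/seteqP; split=> p /=; rewrite in_itv/= => // -[].
rewrite product_measure1E//= probability_setT mul1e lebesgue_measure_itv/= lte_fin.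
by case: ltP => // t0'; [rewrite oppr0 adde0|congr _%:E; apply/eqP; rewrite eq_le t0 t0'].
Qed.

Lemma ED_integrable t g : 0 <= t -> bmf g -> Pmu.-integrable (D t) (EFin \o g).
Proof.
move=> t0 bg; have h : (Pmu (D t) < +oo)%E by rewrite measure_D// ltry.
apply: (@bmf_integrable _ (T * measurableTypeR R)%type R Pmu) => //.
exact: measurable_D.
Qed.

Lemma EDD t g1 g2 : 0 <= t -> bmf g1 -> bmf g2 ->
  ED t (fun p => g1 p + g2 p) = ED t g1 + ED t g2.
Proof. by move=> t0 b1 b2; apply: RintegralD; [exact: measurable_D|exact: ED_integrable..]. Qed.

Lemma EDB t g1 g2 : 0 <= t -> bmf g1 -> bmf g2 ->
  ED t (fun p => g1 p - g2 p) = ED t g1 - ED t g2.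
Proof. by move=> t0 b1 b2; apply: RintegralB; [exact: measurable_D|exact: ED_integrable..]. Qed.

Lemma EDZ t c g : 0 <= t -> bmf g -> ED t (fun p => c * g p) = c * ED t g.
Proof. by move=> t0 b1; apply: RintegralZl; [exact: measurable_D|exact: ED_integrable]. Qed.

Lemma ED0 t : ED t (fun=> 0) = 0.
Proof. by rewrite /ED Rintegral_cst ?mul0r//; exact: measurable_D. Qed.

Lemma ED_sum t n (g : nat -> T * R -> R) : 0 <= t -> (forall k, bmf (g k)) ->
  ED t (fun p => \sum_(k < n) g k p) = \sum_(k < n) ED t (g k).
Proof.
move=> t0 bg; elim: n => [|n IH].
  by rewrite big_ord0; under eq_fun do rewrite big_ord0; exact: ED0.
rewrite big_ord_recr/=; under eq_fun do rewrite big_ord_recr/=.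
by rewrite EDD ?IH//; exact: bmf_sum.
Qed.

Lemma eq_ED t g1 g2 : (forall w v, 0 < v <= t -> g1 (w, v) = g2 (w, v)) ->
  ED t g1 = ED t g2.
Proof. by move=> h; apply: eq_Rintegral => -[w v]; rewrite inE/=; exact: h. Qed.

Lemma ED_le t g1 g2 : 0 <= t -> bmf g1 -> bmf g2 ->
  (forall w v, 0 < v <= t -> g1 (w, v) <= g2 (w, v)) -> ED t g1 <= ED t g2.
Proof.
move=> t0 b1 b2 h; apply: le_Rintegral; [exact: measurable_D|exact: ED_integrable..|].
by move=> [w v] /=; exact: h.
Qed.

Lemma ED_tonelli t g : 0 <= t -> bmf g -> (forall p, 0 <= g p) ->
  (\int[P]_w \int[mu]_v (if 0 < v <= t then g (w, v) else 0)%:E)%E = (ED t g)%:E.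
Proof.
move=> t0 bg g0.
have bh : bmf (fun p : T * R => if 0 < p.2 <= t then g p else 0).
  apply: bmf_if => //; last exact: bmf_cst.
  by apply: measurable_and; [exact: measurable_fun_ltr|exact: measurable_fun_ler].
rewrite -(@fubini_tonelli1 _ _ _ _ _ P mu (fun p => (if 0 < p.2 <= t then g p else 0)%:E))//; last 2 first.
- by apply/measurable_EFinP; exact: bh.1.
- by move=> p; rewrite lee_fin; case: ifP.
rewrite /ED /Rintegral fineK; last by apply: integrable_fin_num; [exact: measurable_D|exact: ED_integrable].
rewrite [RHS]integral_mkcond; apply: eq_integral => p _; rewrite patchE.
by case: ifPn => h; case: ifPn => //; [rewrite notin_setE/= h|rewrite inE/= (negbTE h)].
Qed.

Lemma bmf_slice1 g w : bmf g -> bmf (fun v : R => g (w, v)).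
Proof.
move=> bg; apply: (bmf_comp bg); exact: measurable_fun_pair.
Qed.

Lemma bmf_slice2 g v : bmf g -> bmf (fun w : T => g (w, v)).
Proof.
move=> bg; apply: (bmf_comp bg); exact: measurable_fun_pair.
Qed.

Lemma mu_oc_lty (u v : R) : (mu `]u, v]%classic < +oo)%E.
Proof. by have := mu_itv_lty u v false false measurableT; rewrite setIT. Qed.

Lemma ED_w t g : 0 <= t -> bmf g ->
  ED t g = \int[P]_w \int[mu]_(v in `]0, t]) g (w, v).
Proof.
move=> t0 bg; rewrite {1}/ED {1}/Rintegral integral_mkcond.
rewrite -integral12_prod_meas1; last first.
  by refine ((integrable_mkcond _ _).1 (ED_integrable t0 bg)); exact: measurable_D.
congr fine; apply: eq_integral => w _; rewrite /fubini_F.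
rewrite /Rintegral fineK; last first.
  apply: integrable_fin_num => //; apply: (@bmf_integrable _ (measurableTypeR R) R mu) => //.
    exact: mu_oc_lty.
  exact: bmf_slice1.
rewrite [RHS]integral_mkcond; apply: eq_integral => v _; rewrite !patchE.
by rewrite !mem_setE in_itv.
Qed.

Lemma ED_v t g : 0 <= t -> bmf g ->
  ED t g = \int[mu]_(v in `]0, t]) \int[P]_w g (w, v).
Proof.
move=> t0 bg; rewrite {1}/ED {1}/Rintegral integral_mkcond.
rewrite -integral21_prod_meas1; last first.
  by refine ((integrable_mkcond _ _).1 (ED_integrable t0 bg)); exact: measurable_D.
congr fine; rewrite [RHS]integral_mkcond; apply: eq_integral => v _; rewrite /fubini_G patchE.
rewrite mem_setE in_itv/=; case: ifPn => vt.
  rewrite -Rexp_EFin; last exact: bmf_slice2.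
  by apply: eq_integral => w _; rewrite patchE; case: ifPn => //; rewrite notin_setE/= vt.
by apply: integral0_eq => w _; rewrite patchE; case: ifPn => //; rewrite inE/= (negbTE vt).
Qed.

Lemma ED_fst t (f : T -> R) : 0 <= t -> bmf f -> ED t (f \o fst) = t * \int[P]_w f w.
Proof.
move=> t0 bf; rewrite ED_v//; last exact: (bmf_comp bf).
transitivity (\int[mu]_(v in `]0, t]) (\int[P]_w f w)) => //.
rewrite Rintegral_cst// mulrC; congr (_ * _).
rewrite [X in fine X](_ : _ = mu `]0, t]%classic)// lebesgue_measure_itv/= lte_fin.
by case: ltP => //= t0'; [rewrite subr0|apply/eqP; rewrite eq_le t0 t0'].
Qed.

Lemma ED_norm_le t g (A : set T) M : 0 <= t -> bmf g -> measurable A ->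
  (forall w v, 0 < v <= t -> `|g (w, v)| <= M * \1_A w) ->
  `|ED t g| <= M * (t * fine (P A)).
Proof.
move=> t0 bg mA gM.
have bA : bmf (fun w => M * \1_A w : R).
  by apply: bmfM; [exact: bmf_cst|exact: bmf_indic].
have bA' : bmf (fun p : T * R => M * \1_A p.1).
  by apply: (bmf_comp bA).
have E : ED t (fun p : T * R => M * \1_A p.1) = M * (t * fine (P A)).
  rewrite (@ED_fst t (fun w => M * \1_A w))// RintegralZl//.
    by rewrite Rexp_prob//; ring.
  by apply: bmf_P; exact: bmf_indic.
rewrite ler_norml -E -[X in - X]mul1r -mulNr -EDZ//; apply/andP; split.
  apply: ED_le => //; first by apply: bmfM => //; exact: bmf_cst.
  by move=> w v vt; have := gM w v vt; rewrite ler_norml mulN1r => /andP[].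
by apply: ED_le => // w v vt; have := gM w v vt; rewrite ler_norml => /andP[].
Qed.

(** One instant per path has Lebesgue measure 0. This reconciles windows open on the left, natural
    for jumps, with windows open on the right, natural for visits. *)
Lemma ED_null t g1 g2 (tau : T -> R) : 0 <= t -> bmf g1 -> bmf g2 ->
  (forall w v, v != tau w -> g1 (w, v) = g2 (w, v)) -> ED t g1 = ED t g2.
Proof.
move=> t0 b1 b2 h; rewrite !ED_w//; apply: eq_Rintegral => w _.
have mi (g : T * R -> R) : bmf g -> measurable_fun (`]0, t]%classic : set (measurableTypeR R)) (fun v => (g (w, v))%:E).
  move=> bg; apply/measurable_EFinP; apply: measurable_funTS.
  exact: (bmf_slice1 w bg).1.
congr fine; apply: ae_eq_integral => //; [exact: mi|exact: mi|].
exists [set tau w]; split=> //; first exact: lebesgue_measure_set1.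
move=> v /=; apply: contra_notP => /eqP vt _; congr EFin; exact: h.
Qed.

End space_time.

(** * Damped trigonometric test functions *)

Section truncated_smooth.
Context (R : realType).
Variables (f g h : R -> R) (K : R).
Hypothesis df : forall x : R, is_derive x 1 f (g x).
Hypothesis dg : forall x : R, is_derive x 1 g (h x).
Hypothesis hK : forall x, 0 <= x -> `|h x| <= K.
Hypothesis g0 : g 0 = 0.

Let continuous_der (u v : R -> R) : (forall x : R, is_derive x 1 u (v x)) -> continuous u.
Proof.
move=> d x; apply: differentiable_continuous; apply/derivable1_diffP.
by have [] := d x.
Qed.

Let MVT01 (u v : R -> R) (x y : R) : (forall x : R, is_derive x 1 u (v x)) -> x <= y ->
  exists2 c, x <= c <= y & u y - u x = v c * (y - x).
Proof.
move=> d xy; have [|c] := @MVT_segment R u v x y xy (fun z _ => d z).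
  by apply: continuous_subspaceT; exact: (continuous_der d).
by rewrite in_itv/=; exists c.
Qed.

Let K0 : 0 <= K. Proof. exact: le_trans (hK (lexx 0)). Qed.

Let lip_pos x y : 0 <= x -> x <= y -> `|g y - g x| <= K * (y - x).
Proof.
move=> x0 xy; have [c /andP[xc cy] ->] := MVT01 dg xy.
rewrite normrM [X in _ * X]ger0_norm ?subr_ge0// ler_wpM2r ?subr_ge0//.
by apply: hK; exact: le_trans xc.
Qed.

Let lip_pos2 x y : 0 <= x -> 0 <= y -> `|g x - g y| <= K * `|x - y|.
Proof.
move=> x0 y0; have [xy|yx] := leP x y.
  by rewrite distrC (distrC x) (ger0_norm (x := y - x)) ?subr_ge0// lip_pos.
by rewrite (ger0_norm (x := x - y)) ?subr_ge0 ?lip_pos// ltW.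
Qed.

Let max_lip (x y : R) : `|Num.max 0 x - Num.max 0 y| <= `|x - y|.
Proof.
have h' (u v : R) : u <= v -> `|Num.max 0 u - Num.max 0 v| <= `|u - v|.
  move=> uv; rewrite distrC (distrC u) (ger0_norm (x := v - u)) ?subr_ge0//.
  rewrite ger0_norm; last by rewrite subr_ge0 ge_max !le_max lexx uv orbT.
  by case: (leP 0 u) => u0; case: (leP 0 v) => v0; lra.
have [xy|yx] := leP x y; first exact: h'.
by rewrite distrC (distrC x) h'// ltW.
Qed.

Lemma max0_lipschitz (x y : R) :
  `|g (Num.max 0 x) - g (Num.max 0 y)| <= K * `|x - y|.
Proof.
apply: le_trans (lip_pos2 _ _) _; rewrite ?le_max ?lexx//.
by rewrite ler_wpM2l// max_lip.
Qed.

Let quad_pos x y : 0 <= x -> 0 <= y -> `|f x - f y - g y * (x - y)| <= K * (x - y) ^+ 2.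
Proof.
move=> x0 y0.
have [c hc ->] : exists2 c, (0 <= c) && (`|c - y| <= `|x - y|) & f x - f y = g c * (x - y).
  have [xy|yx] := leP x y.
    have [c /andP[xc cy] e] := MVT01 df xy.
    exists c; last by rewrite -opprB e; ring.
    rewrite (le_trans x0 xc)/= distrC (distrC x) !ger0_norm; lra.
  have [c /andP[yc cx] e] := MVT01 df (ltW yx).
  exists c => //; rewrite (le_trans y0 yc)/= !ger0_norm; lra.
move: hc => /andP[c0 cy].
rewrite -mulrBl normrM -[(x - y) ^+ 2]real_normK ?num_real// expr2 mulrA.
rewrite ler_wpM2r// (le_trans (lip_pos2 c0 y0))//.
by rewrite ler_wpM2l.
Qed.

(** Since [g 0 = 0], the function [f] precomposed with the positive part stays differentiable across
    0, with Lipschitz derivative. The bound on [h] is asked on the half-line only, because damped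
    functions blow up on the negative side. *)
Lemma max0_quadratic (x y : R) :
  `|f (Num.max 0 x) - f (Num.max 0 y) - g (Num.max 0 y) * (x - y)| <= K * (x - y) ^+ 2.
Proof.
case: (leP 0 y) => y0; case: (leP 0 x) => x0.
- exact: quad_pos.
- have h1 := quad_pos (lexx 0) y0.
  have h2 := lip_pos2 y0 (lexx 0).
  rewrite g0 !subr0 (ger0_norm y0) in h2.
  have -> : f 0 - f y - g y * (x - y) = (f 0 - f y - g y * (0 - y)) - g y * x by ring.
  rewrite (le_trans (ler_normB _ _))//.
  have -> : K * (x - y) ^+ 2 = K * (0 - y) ^+ 2 + (K * (x ^+ 2) + 2 * K * y * (- x)) by ring.
  rewrite lerD// normrM (ltr0_norm x0).
  have x0' : 0 <= - x by lra.
  have h3 : `|g y| * (- x) <= K * y * (- x) by exact: ler_wpM2r x0' _ _ h2.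
  have h4 : 0 <= K * x ^+ 2 by rewrite mulr_ge0// sqr_ge0.
  have h5 : 0 <= K * y * (- x) by apply: mulr_ge0; [exact: mulr_ge0|rewrite oppr_ge0 ltW].
  lra.
- rewrite g0 mul0r subr0.
  have h1 := quad_pos x0 (lexx 0).
  rewrite g0 mul0r !subr0 in h1.
  apply: le_trans h1 _; rewrite ler_wpM2l// lerXn2r ?nnegrE//; lra.
- by rewrite subrr g0 mul0r subrr normr0 mulr_ge0// sqr_ge0.
Qed.

End truncated_smooth.

Section damped.
Context (R : realType).
Implicit Types a b x y : R.

(* real and imaginary parts of exp(-(a + i b) x) *)
Definition dcos a b x : R := expR (- a * x) * cos (b * x).
Definition dsin a b x : R := - (expR (- a * x) * sin (b * x)).

Lemma is_derive_dcos a b x : is_derive x 1 (dcos a b) (- a * dcos a b x + b * dsin a b x).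
Proof.
rewrite /dcos; apply: is_derive_eq.
rewrite /dsin /GRing.scale/=; ring.
Qed.

Lemma is_derive_dsin a b x : is_derive x 1 (dsin a b) (- a * dsin a b x - b * dcos a b x).
Proof.
rewrite /dsin; apply: is_derive_eq.
rewrite /dcos /GRing.scale/=; ring.
Qed.

Lemma dcosD a b x y : dcos a b (x + y) = dcos a b x * dcos a b y - dsin a b x * dsin a b y.
Proof. by rewrite /dcos /dsin !mulrDr expRD cosD; ring. Qed.

Lemma dsinD a b x y : dsin a b (x + y) = dcos a b x * dsin a b y + dsin a b x * dcos a b y.
Proof. by rewrite /dcos /dsin !mulrDr expRD sinD; ring. Qed.

Let expR_le1 a x : 0 <= a -> 0 <= x -> expR (- a * x) <= 1.
Proof. by move=> a0 x0; rewrite -expR0 ler_expR mulNr oppr_le0 mulr_ge0. Qed.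

Lemma dcos_bound a b x : 0 <= a -> 0 <= x -> `|dcos a b x| <= 1.
Proof.
move=> a0 x0; rewrite normrM ger0_norm ?expR_ge0// -[leRHS]mulr1 ler_pM ?expR_ge0//.
  exact: expR_le1.
by rewrite ler_norml cos_geN1 cos_le1.
Qed.

Lemma dsin_bound a b x : 0 <= a -> 0 <= x -> `|dsin a b x| <= 1.
Proof.
move=> a0 x0; rewrite normrN normrM ger0_norm ?expR_ge0// -[leRHS]mulr1 ler_pM ?expR_ge0//.
  exact: expR_le1.
by rewrite ler_norml sin_geN1 sin_le1.
Qed.

End damped.

Section combinations.
Context (R : realType).
Variables (a b : R).
Hypothesis a0 : 0 <= a.
Implicit Types c x y : R.

(** [dcos 1 0 x] is exp(-x). The span of the three functions is stable under derivation and, on the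
    half-line, under averaging over a service time, so each balance becomes a linear relation
    between coefficients. *)
Definition comb (c1 c2 c3 x : R) : R :=
  c1 * dcos a b x + c2 * dsin a b x + c3 * dcos 1 0 x.

Lemma is_derive_comb c1 c2 c3 (x : R) :
  is_derive x 1 (comb c1 c2 c3) (comb (- a * c1 - b * c2) (b * c1 - a * c2) (- c3) x).
Proof.
have h1 := is_derive_dcos a b x; have h2 := is_derive_dsin a b x.
have h3 := is_derive_dcos 1 0 x.
rewrite /comb; apply: is_derive_eq.
rewrite /GRing.scale/=; ring.
Qed.

Lemma comb_bound c1 c2 c3 x : 0 <= x -> `|comb c1 c2 c3 x| <= `|c1| + `|c2| + `|c3|.
Proof.
move=> x0; rewrite /comb.
have le1 (c y : R) : `|y| <= 1 -> `|c * y| <= `|c|.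
  by move=> y1; rewrite normrM -[leRHS]mulr1 ler_wpM2l.
rewrite (le_trans (ler_normD _ _))// lerD//; last by rewrite le1// dcos_bound.
rewrite (le_trans (ler_normD _ _))// lerD// le1//; first exact: dcos_bound.
exact: dsin_bound.
Qed.

Lemma comb_continuous c1 c2 c3 : continuous (comb c1 c2 c3).
Proof.
move=> x; apply: differentiable_continuous; apply/derivable1_diffP.
by have [] := is_derive_comb c1 c2 c3 x.
Qed.

(* [exp(-s x)] alone has nonzero slope at the boundary [x = 0]; the third
   coefficient is there to cancel it. *)
Definition pcomb (c1 c2 c3 x : R) : R := comb c1 c2 c3 (Num.max 0 x).

Lemma pcomb_max c1 c2 c3 x : pcomb c1 c2 c3 (Num.max 0 x) = pcomb c1 c2 c3 x.
Proof. by rewrite /pcomb maxA maxxx. Qed.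

Lemma pcomb_bound c1 c2 c3 x : `|pcomb c1 c2 c3 x| <= `|c1| + `|c2| + `|c3|.
Proof. by apply: comb_bound; rewrite le_max lexx. Qed.

Lemma pcomb_continuous c1 c2 c3 : continuous (pcomb c1 c2 c3).
Proof.
move=> x; apply: (@continuous_comp R R R (fun x => Num.max 0 x) (comb c1 c2 c3));
  last exact: comb_continuous.
by apply: continuous_max; [exact: cvg_cst|exact: cvg_id].
Qed.

Lemma bmf_pcomb c1 c2 c3 : bmf (pcomb c1 c2 c3).
Proof.
split; last by exists (`|c1| + `|c2| + `|c3|) => x; exact: pcomb_bound.
by apply: continuous_measurable_fun; exact: pcomb_continuous.
Qed.

Lemma pcombE c1 c2 c3 x :
  pcomb c1 c2 c3 x = c1 * pcomb 1 0 0 x + c2 * pcomb 0 1 0 x + c3 * pcomb 0 0 1 x.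
Proof. rewrite /pcomb /comb; ring. Qed.

(** A bound for the second derivative on the half-line: the coefficient map of [is_derive_comb]
    applied twice. *)
Definition comb_const (c1 c2 c3 : R) : R :=
  let d1 := - a * c1 - b * c2 in let d2 := b * c1 - a * c2 in
  `|- a * d1 - b * d2| + `|b * d1 - a * d2| + `|c3|.

Lemma pcomb_lip (c1 c2 c3 x y : R) (g := pcomb (- a * c1 - b * c2) (b * c1 - a * c2) (- c3)) :
  `|g x - g y| <= comb_const c1 c2 c3 * `|x - y|.
Proof.
apply: (max0_lipschitz (is_derive_comb _ _ _)).
move=> z z0; apply: (le_trans (comb_bound _ _ _ z0)).
by rewrite /comb_const opprK.
Qed.

(** The linear condition is the vanishing of the derivative at 0, where [dcos] is 1 and [dsin] is
    0. *)
Lemma pcomb_quad c1 c2 c3 x y : - a * c1 - b * c2 - c3 = 0 ->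
  `|pcomb c1 c2 c3 x - pcomb c1 c2 c3 y
     - pcomb (- a * c1 - b * c2) (b * c1 - a * c2) (- c3) y * (x - y)|
  <= comb_const c1 c2 c3 * (x - y) ^+ 2.
Proof.
move=> c0.
apply: (max0_quadratic (is_derive_comb c1 c2 c3) (is_derive_comb _ _ _)).
  move=> z z0; apply: (le_trans (comb_bound _ _ _ z0)).
  by rewrite /comb_const opprK.
by rewrite /comb /dcos /dsin !mulr0 expR0 cos0 sin0 !mulr1 mulr0 oppr0 mulr0 addr0.
Qed.

End combinations.

(** * Errors of order 1/t and the limit of the balances *)

Section negligible.
Context (R : realType).

Definition negl (f : R -> R) := exists C, forall t : R, 1 <= t -> `|f t| <= C / t.

Lemma neglD f g : negl f -> negl g -> negl (fun t => f t + g t).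
Proof.
move=> [C fC] [D gD]; exists (C + D) => t t1.
by rewrite (le_trans (ler_normD _ _))// mulrDl lerD ?fC ?gD.
Qed.

Lemma neglZ c f : negl f -> negl (fun t => c * f t).
Proof.
move=> [C fC]; exists (`|c| * C) => t t1.
by rewrite normrM -mulrA ler_wpM2l// fC.
Qed.

Lemma negl_lim (f : R -> R) l : negl f -> f t @[t --> +oo] --> l -> l = 0.
Proof.
move=> [C fC] fl.
have f0 : f t @[t --> +oo] --> (0 : R).
  apply/cvgrPdist_le => e e0.
  exists (Num.max 1 (C / e)); split; first exact: num_real.
  move=> t; rewrite gt_max => /andP[t1 tC].
  rewrite sub0r normrN (le_trans (fC t (ltW t1)))//.
  have t0 : 0 < t by exact: lt_trans t1.
  by rewrite ler_pdivrMr// mulrC -ler_pdivrMr// ltW.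
exact: (cvg_unique _ fl f0).
Qed.

(* With z = z1 + i z2, o = o1 + i o2, Lambda = x + i y and s = a + i b, the
   hypotheses say (coff + Lambda) z = (con + coff + Lambda) o, its instance at
   s = 1, and s o - Lambda z = s (oe - l1 ze), up to O(1/t). *)
Lemma balance_limit (con coff a b x y l1 Z1 Z2 E : R) (z1 z2 o1 o2 ze oe : R -> R) :
  0 < con + coff + l1 ->
  negl (fun t => (coff + x) * z1 t - y * z2 t - ((con + coff + x) * o1 t - y * o2 t)) ->
  negl (fun t => (coff + x) * z2 t + y * z1 t - ((con + coff + x) * o2 t + y * o1 t)) ->
  negl (fun t => (coff + l1) * ze t - (con + coff + l1) * oe t) ->
  negl (fun t => a * o1 t - b * o2 t - (x * z1 t - y * z2 t) - a * (oe t - l1 * ze t)) ->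
  negl (fun t => a * o2 t + b * o1 t - (x * z2 t + y * z1 t) - b * (oe t - l1 * ze t)) ->
  z1 t @[t --> +oo] --> Z1 -> z2 t @[t --> +oo] --> Z2 -> ze t @[t --> +oo] --> E ->
  let kappa := ((coff + l1) / (con + coff + l1) - l1) * E in
  let m := con + coff + x in let n := coff + x in
  let pr := a * n - b * y - (x * m - y * y) in
  let pi := a * y + b * n - (x * y + y * m) in
  pr * Z1 - pi * Z2 = (m * a - y * b) * kappa /\
  pr * Z2 + pi * Z1 = (m * b + y * a) * kappa.
Proof.
move=> c0 n1 n2 n3 n4 n5 l1' l2 l3 kappa m n pr pi.
set c := con + coff + l1 in c0 kappa *.
pose k := l1 * c - (coff + l1).
have cne : c != 0 by rewrite gt_eqF.
have kE : kappa * c = - k * E by rewrite /kappa /k; field.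
have e1 : c * pr * Z1 - c * pi * Z2 + (m * a - y * b) * k * E = 0.
  apply: (@negl_lim (fun t => c * pr * z1 t - c * pi * z2 t + (m * a - y * b) * k * ze t)).
    (* Real part of c (m + i y) times the drift relation, plus c s times the switch relation, minus
       (m + i y) s times its instance at s = 1. All of [o1], [o2] and [oe] cancel. The second
       identity is the imaginary part of the same combination. *)
    have := neglD (neglD (neglD (neglZ (c * m) n4) (neglZ (- c * y) n5))
      (neglD (neglZ (c * a) n1) (neglZ (- c * b) n2))) (neglZ (- (m * a - y * b)) n3).
    congr negl; apply/funext => t; rewrite /k /pr /pi /n /m /c; ring.
  by apply: cvgD; [apply: cvgB|]; apply: cvgMr.
have e2 : c * pr * Z2 + c * pi * Z1 + (m * b + y * a) * k * E = 0.
  apply: (@negl_lim (fun t => c * pr * z2 t + c * pi * z1 t + (m * b + y * a) * k * ze t)).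
    have := neglD (neglD (neglD (neglZ (c * m) n5) (neglZ (c * y) n4))
      (neglD (neglZ (c * a) n2) (neglZ (c * b) n1))) (neglZ (- (m * b + y * a)) n3).
    congr negl; apply/funext => t; rewrite /k /pr /pi /n /m /c; ring.
  by apply: cvgD; [apply: cvgD|]; apply: cvgMr.
split; apply: (mulfI cne).
  rewrite [RHS](_ : _ = (m * a - y * b) * (kappa * c)); last by ring.
  rewrite kE; move: e1 => /eqP; rewrite addr_eq0 => /eqP e1.
  by rewrite mulrBr !mulrA e1; ring.
rewrite [RHS](_ : _ = (m * b + y * a) * (kappa * c)); last by ring.
rewrite kE; move: e2 => /eqP; rewrite addr_eq0 => /eqP e2.
by rewrite mulrDr !mulrA e2; ring.
Qed.

End negligible.

(** Tonelli gives measurability for nonnegative integrands, hence the shift by the bound [M]. The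
    same shift carries the rate formulas below from nonnegative to bounded functions. *)
Lemma bmf_Rexp d d' (U : measurableType d') (T : measurableType d) (R : realType)
    (P : probability T R) (g : U * T -> R) :
  bmf g -> bmf (fun y => \int[P]_w g (y, w)).
Proof.
move=> bg; have [mg [M gM]] := bg.
have bgy y : bmf (fun w => g (y, w)).
  by apply: (bmf_comp bg); exact: measurable_fun_pair.
split; last by exists M => y; exact: Rexp_bound.
have bgM : bmf (fun p => g p + M) by apply: bmfD => //; exact: bmf_cst.
apply: (eq_measurable_fun (fun y => fine (\int[P]_w (g (y, w) + M)%:E)%E - M)).
  move=> y _; rewrite -/(Rintegral P setT (fun w => g (y, w) + M)).
  rewrite RintegralD//; try by apply: bmf_P; [exact: bgy|exact: bmf_cst].
  - have PT : fine (P setT) = 1 by rewrite probability_setT.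
    by rewrite [X in _ + X - _]Rintegral_cst// [X in _ * X]PT mulr1 addrK.
  - exact: bmf_P.
  - by apply: bmf_P; exact: bmf_cst.
apply: measurable_funB => //; apply: measurableT_comp => //.
apply: (@measurable_fun_fubini_tonelli_F _ _ _ _ _ P (fun p => (g p + M)%:E)).
  by apply/measurable_EFinP; exact: bgM.1.
by move=> p; rewrite lee_fin; have := gM p; rewrite ler_norml => /andP[]; lra.
Qed.

(** * Balance equations *)

Section model.
Context d (T : measurableType d) (R : realType) (P : probability T R).
Variables (I : choiceType) (X : I -> {RV P >-> R}).
Variables (ia ib ir : nat -> I) (on : nat -> bool) (lam con coff x0 : R).
Notation mu := (@lebesgue_measure R).
Hypothesis indX : mutually_independent X.
Hypothesis X0 : forall j w, 0 <= X j w.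
Hypothesis ia_inj : injective ia.
Hypothesis ib_inj : injective ib.
Hypothesis ir_inj : injective ir.
Hypothesis iab : forall k l, ia k != ib l.
Hypothesis iar : forall k l, ia k != ir l.
Hypothesis ibr : forall k l, ib k != ir l.
Hypothesis lam0 : 0 < lam.
Hypothesis con0 : 0 < con.
Hypothesis coff0 : 0 < coff.
Hypothesis a_law : forall k, exponential_rv (X (ia k)) lam.
Hypothesis r_law : forall m, exponential_rv (X (ir m)) (if on m then con else coff).
Hypothesis b_law : forall k E, measurable E ->
  P (X (ib k) @^-1` E) = P (X (ib 0%N) @^-1` E).
Hypothesis alt : forall m, on m.+1 = ~~ on m.

Definition arrivals (w : T) (k : nat) : R := X (ia k) w.
Definition services (w : T) (k : nat) : R := X (ib k) w.
Definition visits (w : T) (k : nat) : R := X (ir k) w.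
Definition server_set (w : T) : set R := server on (visits w).
Definition W (n : nat) (v : R) (w : T) : R :=
  wl (clk (server_set w)) (arrivals w) (services w) x0 n v.
Definition after_arrival (f : R -> R) (x : R) : R := \int[P]_w f (x + X (ib 0%N) w).
Definition jump_mean (f : R -> R) (x : R) : R := after_arrival f x - f x.

Local Notation alpha n w := (epoch (arrivals w) n).
Local Notation S m w := (epoch (visits w) m).

(** Such a time can be computed without any given single interarrival or service time, so it may
    bound a window in which arrivals are counted. *)
Definition visit_measurable (tau : T -> R) : Prop :=
  forall j, (forall m, ir m != j) -> measurable_fun setT (tau : others X j -> R).

Lemma measurable_X j : measurable_fun setT (X j).
Proof. exact: measurable_funPT. Qed.

Lemma bmf_after_arrival f : bmf f -> bmf (after_arrival f).
Proof.
move=> bf; apply: (bmf_Rexp P (g := fun p : R * T => f (p.1 + X (ib 0%N) p.2))).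
apply: (bmf_comp bf); apply: measurable_funD => //.
by apply: measurableT_comp => //; exact: measurable_X.
Qed.

Lemma bmf_jump_mean f : bmf f -> bmf (jump_mean f).
Proof. by move=> bf; apply: bmfB => //; exact: bmf_after_arrival. Qed.

Lemma measurable_others_r j : (forall m, ir m != j) -> forall k,
  measurable_fun setT ((fun w => visits w k) : others X j -> R).
Proof. by move=> h k; apply: measurable_others => //; rewrite h. Qed.

(** The identity into the coarser sigma-algebra is a random element standing for all variables
    except [X j] at once. *)
Definition others_id (j : I) : T -> others X j := id.
HB.instance Definition _ j :=
  isMeasurableFun.Build _ _ _ _ (others_id j) (@measurable_id_others _ _ _ _ _ X j).

Lemma measurable_W_others j n (Y := (R * others X j)%type) :
  (forall m, ir m != j) ->
  (forall k, (k < n)%N -> ia k != j) -> (forall k, (k < n)%N -> ib k != j) ->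
  measurable_fun setT (fun p : R * others X j => W n p.1 p.2).
Proof.
move=> hr ha hb.
have m2 (f : others X j -> R) : measurable_fun setT f ->
    measurable_fun setT (fun p : R * others X j => f p.2).
  by move=> mf; exact: measurableT_comp.
apply: (@measurable_wl _ (R * others X j)%type R on
  (fun k p => arrivals p.2 k) (fun k p => services p.2 k) (fun k p => visits p.2 k)) => //.
- by move=> k; apply: m2; exact: measurable_others_r.
- by move=> k kn; apply: m2; apply: measurable_others; exact: ha.
- by move=> k kn; apply: m2; apply: measurable_others; exact: hb.
Qed.

Lemma measurable_alpha_others j n : (forall k, (k < n)%N -> ia k != j) ->
  measurable_fun setT ((fun w => alpha n w) : others X j -> R).
Proof.
move=> ha; apply: (@measurable_epoch _ (others X j) R (fun k w => arrivals w k)).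
by move=> k kn; apply: measurable_others; exact: ha.
Qed.

Lemma measurable_W n : measurable_fun setT (fun p : T * R => W n p.2 p.1).
Proof.
have m2 j : measurable_fun setT (fun p : T * R => X j p.1).
  by apply: measurableT_comp => //; exact: measurable_X.
apply: (@measurable_wl _ (T * R)%type R on
  (fun k p => arrivals p.1 k) (fun k p => services p.1 k) (fun k p => visits p.1 k)) => //.
- by move=> k; exact: m2.
- by move=> k _; exact: m2.
- by move=> k _; exact: m2.
Qed.

Lemma measurable_alpha n : measurable_fun setT (fun w => alpha n w).
Proof.
apply: (@measurable_epoch _ T R (fun k w => arrivals w k)) => k _.
exact: measurable_X.
Qed.

Lemma measurable_S n : measurable_fun setT (fun w => S n w).
Proof.
apply: (@measurable_epoch _ T R (fun k w => visits w k)) => k _.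
exact: measurable_X.
Qed.

(** This is [compensator] with [sig] the previous arrival epoch and [X] the next interarrival time.
    [W n] knows only the n earlier customers: it is the workload just before the arrival, and as a
    process in time it does not involve [X (ia n)]. *)
Lemma arrival_rate_ge0 (g : R -> R) (n : nat) (tau1 tau2 : T -> R) (t : R) :
  bmf g -> (forall x, 0 <= g x) -> visit_measurable tau1 -> visit_measurable tau2 ->
  measurable_fun setT tau1 -> measurable_fun setT tau2 ->
  (forall w, 0 <= tau1 w) -> (forall w, tau2 w <= t) -> 0 <= t ->
  \int[P]_w (if tau1 w < alpha n.+1 w <= tau2 w then g (W n (alpha n.+1 w) w) else 0) =
  lam * ED P t (fun p => if (alpha n p.1 <= p.2 < alpha n.+1 p.1) &&
    (tau1 p.1 < p.2 <= tau2 p.1) then g (W n p.2 p.1) else 0).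
Proof.
move=> bg g0 vt1 vt2 mt1 mt2 t1_0 t2_t t0.
have anr m : ir m != ia n by rewrite eq_sym iar.
have ank k : (k < n)%N -> ia k != ia n.
  by move=> kn; apply/eqP => /ia_inj e; rewrite e ltnn in kn.
have abk k : (k < n)%N -> ib k != ia n by rewrite eq_sym iab.
pose Z (p : R * others X (ia n)) : \bar R :=
  (if tau1 p.2 < p.1 <= tau2 p.2 then g (W n p.1 p.2) else 0)%:E.
have mZ : measurable_fun setT Z.
  apply/measurable_EFinP; apply: measurable_fun_ifT => //.
    apply: measurable_and.
      by apply: measurable_fun_ltr => //; apply: (measurableT_comp (vt1 _ anr)).
    by apply: measurable_fun_ler => //; apply: (measurableT_comp (vt2 _ anr)).
  apply: (measurableT_comp bg.1); exact: measurable_W_others.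
have Z0 p : (0 <= Z p)%E by rewrite lee_fin; case: ifP.
have := @compensator _ T R P _ (others X (ia n)) lam (X (ia n))
  (others_id (ia n)) (fun w => alpha n w) Z lam0 (a_law n) (indep_others indX)
  (measurable_alpha_others ank) mZ Z0.
have bgW : bmf (fun p : T * R => g (W n p.2 p.1)).
  by apply: (bmf_comp bg); exact: measurable_W.
have bh : bmf (fun p : T * R => if (alpha n p.1 <= p.2 < alpha n.+1 p.1) &&
    (tau1 p.1 < p.2 <= tau2 p.1) then g (W n p.2 p.1) else 0).
  apply: bmf_if => //; last exact: bmf_cst.
  apply: measurable_and; apply: measurable_and.
  - by apply: measurable_fun_ler => //; apply: (measurableT_comp (measurable_alpha n)).
  - by apply: measurable_fun_ltr => //; apply: (measurableT_comp (measurable_alpha n.+1)).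
  - by apply: measurable_fun_ltr => //; apply: (measurableT_comp mt1).
  - by apply: measurable_fun_ler => //; apply: (measurableT_comp mt2).
move=> h; apply: EFin_inj; rewrite EFinM -ED_tonelli//; last first.
  by move=> p; case: ifP.
rewrite -Rexp_EFin; last first.
  have mA := measurable_alpha n.+1.
  apply: bmf_if; last exact: bmf_cst.
    by apply: measurable_and; [exact: measurable_fun_ltr|exact: measurable_fun_ler].
  apply: (bmf_comp bgW (g := fun w => (w, alpha n.+1 w))).
  exact: measurable_fun_pair.
transitivity (\int[P]_w Z ((alpha n w + X (ia n) w)%R, others_id (ia n) w))%E.
  by apply: eq_integral => w _; rewrite /Z/= epochS.
rewrite h; congr (_ * _)%E; apply: eq_integral => w _; apply: eq_integral => v _.
rewrite /Z/= epochS /others_id.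
have -> : arrivals w n = X (ia n) w by [].
case: (boolP (_ <= v < _)) => _ /=; last by case: ifP.
have [|_] := ifPn; last by case: ifP.
by move=> /andP[h1 h2]; rewrite (le_lt_trans (t1_0 w) h1) (le_trans h2).
Qed.

Lemma bmf_arrival_event (g : R -> R) n (tau1 tau2 : T -> R) : bmf g ->
  measurable_fun setT tau1 -> measurable_fun setT tau2 ->
  bmf (fun w => if tau1 w < alpha n.+1 w <= tau2 w
                then g (W n (alpha n.+1 w) w) else 0).
Proof.
move=> bg mt1 mt2; have mA := measurable_alpha n.+1.
apply: bmf_if; last exact: bmf_cst.
  by apply: measurable_and; [exact: measurable_fun_ltr|exact: measurable_fun_ler].
apply: (bmf_comp bg).
apply: (measurableT_comp (measurable_W n) (g := fun w => (w, alpha n.+1 w))).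
exact: measurable_fun_pair.
Qed.

Lemma bmf_W (g : R -> R) n : bmf g -> bmf (fun p : T * R => g (W n p.2 p.1)).
Proof. by move=> bg; apply: (bmf_comp bg); exact: measurable_W. Qed.

Lemma measurable_in_co (u v : T -> R) : measurable_fun setT u ->
  measurable_fun setT v -> measurable_fun setT (fun p : T * R => u p.1 <= p.2 < v p.1).
Proof.
move=> mf mg; apply: measurable_and.
  by apply: measurable_fun_ler => //; apply: (measurableT_comp mf).
by apply: measurable_fun_ltr => //; apply: (measurableT_comp mg).
Qed.

Lemma measurable_in_oc (u v : T -> R) : measurable_fun setT u ->
  measurable_fun setT v -> measurable_fun setT (fun p : T * R => u p.1 < p.2 <= v p.1).
Proof.
move=> mf mg; apply: measurable_and.
  by apply: measurable_fun_ltr => //; apply: (measurableT_comp mf).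
by apply: measurable_fun_ler => //; apply: (measurableT_comp mg).
Qed.

Lemma bmf_arrival_window (g : R -> R) n (tau1 tau2 : T -> R) : bmf g ->
  measurable_fun setT tau1 -> measurable_fun setT tau2 ->
  bmf (fun p : T * R => if (alpha n p.1 <= p.2 < alpha n.+1 p.1) &&
    (tau1 p.1 < p.2 <= tau2 p.1) then g (W n p.2 p.1) else 0).
Proof.
move=> bg mt1 mt2; apply: bmf_if; [|exact: bmf_W|exact: bmf_cst].
apply: measurable_and.
  exact: (measurable_in_co (measurable_alpha n) (measurable_alpha n.+1)).
exact: (measurable_in_oc mt1 mt2).
Qed.

Section window.
Variables (tau1 tau2 : T -> R) (t : R).
Hypothesis vt1 : visit_measurable tau1.
Hypothesis vt2 : visit_measurable tau2.
Hypothesis mt1 : measurable_fun setT tau1.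
Hypothesis mt2 : measurable_fun setT tau2.
Hypothesis t1_ge0 : forall w, 0 <= tau1 w.
Hypothesis t2_let : forall w, tau2 w <= t.
Hypothesis t0 : 0 <= t.

Lemma arrival_rate (g : R -> R) (n : nat) : bmf g ->
  \int[P]_w (if tau1 w < alpha n.+1 w <= tau2 w then g (W n (alpha n.+1 w) w) else 0) =
  lam * ED P t (fun p => if (alpha n p.1 <= p.2 < alpha n.+1 p.1) &&
    (tau1 p.1 < p.2 <= tau2 p.1) then g (W n p.2 p.1) else 0).
Proof.
move=> bg; have [M gM] := bg.2.
have M0 : 0 <= M by exact: le_trans (gM 0).
have bM : bmf ((fun=> M) : R -> R) by exact: bmf_cst.
have bgM : bmf (fun x => g x + M) by exact: bmfD.
have gM0 x : 0 <= g x + M by have := gM x; rewrite ler_norml => /andP[]; lra.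
have h1 := arrival_rate_ge0 n bgM gM0 vt1 vt2 mt1 mt2 t1_ge0 t2_let t0.
have h2 := arrival_rate_ge0 n bM (fun=> M0) vt1 vt2 mt1 mt2 t1_ge0 t2_let t0.
have ifB (c : bool) (x y : R) : (if c then x else 0) =
  (if c then x + y else 0) - (if c then y else 0) by case: c; lra.
under eq_Rintegral do rewrite (ifB _ _ M).
rewrite RintegralB//; last 2 first.
- by apply: bmf_P; exact: (bmf_arrival_event n bgM mt1 mt2).
- by apply: bmf_P; exact: (bmf_arrival_event n bM mt1 mt2).
rewrite h1 h2 -mulrBr -EDB//; last 2 first.
- exact: (bmf_arrival_window n bgM mt1 mt2).
- exact: (bmf_arrival_window n bM mt1 mt2).
by congr (_ * _); apply: eq_ED => w v _; rewrite -ifB.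
Qed.

Lemma after_arrivalE (f : R -> R) n y : bmf f -> (forall x, 0 <= f x) ->
  (\int[distribution P (X (ib n))]_x (f (y + x))%:E)%E = (after_arrival f y)%:E.
Proof.
move=> bf f0.
have bfy : bmf (fun x : R => f (y + x)).
  by apply: (bmf_comp bf); exact: measurable_funD.
rewrite -Rexp_EFin; last by apply: (bmf_comp bfy); exact: measurable_X.
transitivity (\int[distribution P (X (ib 0%N))]_x (f (y + x))%:E)%E.
  by apply: eq_measure_integral => A mA _; exact: b_law.
rewrite ge0_integral_distribution//.
  by apply/measurable_EFinP; exact: bfy.1.
by move=> x; rewrite lee_fin.
Qed.

(** The epoch, the window and [W n] do not involve [X (ib n)], so the service time of the arriving
    customer can be integrated out; its law is that of the first service time. *)
Lemma after_arrival_mean_ge0 (f : R -> R) (n : nat) : bmf f -> (forall x, 0 <= f x) ->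
  \int[P]_w (if tau1 w < alpha n.+1 w <= tau2 w
     then f (W n (alpha n.+1 w) w + services w n) else 0) =
  \int[P]_w (if tau1 w < alpha n.+1 w <= tau2 w
     then after_arrival f (W n (alpha n.+1 w) w) else 0).
Proof.
move=> bf f0.
have bnr m : ir m != ib n by rewrite eq_sym ibr.
have ank k : ia k != ib n by rewrite iab.
have bbk k : (k < n)%N -> ib k != ib n.
  by move=> kn; apply/eqP => /ib_inj e; rewrite e ltnn in kn.
pose U := others X (ib n).
pose F (p : R * U) : \bar R := (if tau1 p.2 < alpha n.+1 p.2 <= tau2 p.2
     then f (W n (alpha n.+1 p.2) p.2 + p.1) else 0)%:E.
have mal : measurable_fun setT (fun p : R * U => alpha n.+1 p.2).
  by apply: (measurableT_comp (measurable_alpha_others _)).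
have mF : measurable_fun setT F.
  apply/measurable_EFinP; apply: measurable_fun_ifT => //.
    apply: measurable_and.
      by apply: measurable_fun_ltr => //; apply: (measurableT_comp (vt1 bnr)).
    by apply: measurable_fun_ler => //; apply: (measurableT_comp (vt2 bnr)).
  apply: (measurableT_comp bf.1); apply: measurable_funD => //.
  apply: (measurableT_comp (measurable_W_others (j := ib n) bnr (fun k _ => ank k) bbk)
    (g := fun p : R * U => (alpha n.+1 p.2, p.2))).
  exact: measurable_fun_pair.
have F0 p : (0 <= F p)%E by rewrite lee_fin; case: ifP.
have bE : bmf (fun w => if tau1 w < alpha n.+1 w <= tau2 w
     then f (W n (alpha n.+1 w) w + services w n) else 0).
  have mA := measurable_alpha n.+1.
  apply: bmf_if; last exact: bmf_cst.
    by apply: measurable_and; [exact: measurable_fun_ltr|exact: measurable_fun_ler].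
  apply: (bmf_comp bf); apply: measurable_funD; last exact: measurable_X.
  apply: (measurableT_comp (measurable_W n) (g := fun w => (w, alpha n.+1 w))).
  exact: measurable_fun_pair.
apply: EFin_inj; rewrite -!Rexp_EFin//; last first.
  by apply: (bmf_arrival_event n (bmf_after_arrival bf)).
have := @indep_integral _ T R P _ U (X (ib n)) (others_id (ib n)) F
  (indep_others indX) mF F0.
rewrite /F/= => ->; apply: eq_integral => w _.
case: ifPn => _; last by rewrite integral0.
by rewrite after_arrivalE.
Qed.

Lemma jump_mean_event (f : R -> R) (n : nat) : bmf f ->
  \int[P]_w (if tau1 w < alpha n.+1 w <= tau2 w
     then f (W n (alpha n.+1 w) w + services w n) - f (W n (alpha n.+1 w) w) else 0) =
  \int[P]_w (if tau1 w < alpha n.+1 w <= tau2 w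
     then jump_mean f (W n (alpha n.+1 w) w) else 0).
Proof.
move=> bf; have [M fM] := bf.2.
have bM : bmf ((fun=> M) : R -> R) by exact: bmf_cst.
have bfM : bmf (fun x => f x + M) by exact: bmfD.
have fM0 x : 0 <= f x + M by have := fM x; rewrite ler_norml => /andP[]; lra.
have h := after_arrival_mean_ge0 n bfM fM0.
have mA := measurable_alpha n.+1.
have bE : bmf (fun w => if tau1 w < alpha n.+1 w <= tau2 w
     then f (W n (alpha n.+1 w) w + services w n) + M else 0).
  apply: bmf_if; last exact: bmf_cst.
    by apply: measurable_and; [exact: measurable_fun_ltr|exact: measurable_fun_ler].
  apply: (bmf_comp bfM); apply: measurable_funD; last exact: measurable_X.
  apply: (measurableT_comp (measurable_W n) (g := fun w => (w, alpha n.+1 w))).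
  exact: measurable_fun_pair.
have ifB (c : bool) (x y : R) : (if c then x - y else 0) =
  (if c then x + M else 0) - (if c then y + M else 0) by case: c; lra.
under eq_Rintegral do rewrite ifB.
under [RHS]eq_Rintegral do rewrite ifB.
rewrite !RintegralB//; try by apply: bmf_P; exact: (bmf_arrival_event n bfM mt1 mt2).
- rewrite h; congr (_ - _); apply: eq_Rintegral => w _; case: ifPn => // _.
  rewrite /after_arrival RintegralD//.
  + have PT : fine (P setT) = 1 by rewrite probability_setT.
    by congr (_ + _); rewrite Rintegral_cst// [X in _ * X]PT mulr1.
  + apply: bmf_P; apply: (bmf_comp bf); apply: measurable_funD => //.
  + by apply: bmf_P; exact: bmf_cst.
- apply: bmf_P.
  have baM : bmf (fun x => after_arrival f x + M).
    by apply: bmfD => //; exact: bmf_after_arrival.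
  exact: (bmf_arrival_event n baM mt1 mt2).
- exact: bmf_P.
Qed.

(** In the window of index n only the first n customers have arrived, so [W n] and [W N] agree
    there, and the windows partition the time before [alpha N]. *)
Lemma window_telescope (h : R -> R) N w v : 0 <= v ->
  \sum_(n < N) (if alpha n w <= v < alpha n.+1 w then h (W n v w) else 0) =
  (if v < alpha N w then h (W N v w) else 0).
Proof.
move=> v0; elim: N => [|N IH].
  by rewrite big_ord0 epoch0 ltNge v0.
rewrite big_ord_recr/= IH; have [vN|Nv] /= := ltP v (alpha N w).
  have vN1 : v < alpha N.+1 w.
    by apply: lt_le_trans vN _; apply: epoch_le => // k; exact: X0.
  by rewrite vN1 addr0 /W/= (lt_geF vN1).
by rewrite add0r; case: ifPn => // vN1; rewrite /W/= (lt_geF vN1).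
Qed.

(** Poisson arrivals see time averages: the jumps are replaced by their conditional means and the
    arrival instants by the intensity [lam] dv. *)
Lemma jump_sum_mean (f : R -> R) (N : nat) : bmf f ->
  \int[P]_w jump_sum (clk (server_set w)) (arrivals w) (services w) x0 f N (tau1 w) (tau2 w) =
  lam * ED P t (fun p => if (p.2 < alpha N p.1) && (tau1 p.1 < p.2 <= tau2 p.1)
    then jump_mean f (W N p.2 p.1) else 0).
Proof.
move=> bf.
transitivity (\sum_(n < N) \int[P]_w (if tau1 w < alpha n.+1 w <= tau2 w
     then f (W n (alpha n.+1 w) w + services w n) - f (W n (alpha n.+1 w) w) else 0)).
  have mA n := measurable_alpha n.+1.
  have bE n : bmf (fun w => if tau1 w < alpha n.+1 w <= tau2 w
     then f (W n (alpha n.+1 w) w + services w n) - f (W n (alpha n.+1 w) w) else 0).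
    have mWA : measurable_fun setT (fun w => W n (alpha n.+1 w) w).
      apply: (measurableT_comp (measurable_W n) (g := fun w => (w, alpha n.+1 w))).
      exact: measurable_fun_pair.
    apply: bmf_if; last exact: bmf_cst.
      by apply: measurable_and; [exact: measurable_fun_ltr|exact: measurable_fun_ler].
    apply: bmfB; last by apply: (bmf_comp bf).
    by apply: (bmf_comp bf); apply: measurable_funD => //; exact: measurable_X.
  elim: N => [|N IH].
    rewrite big_ord0 /jump_sum; under eq_Rintegral do rewrite big_ord0.
    by rewrite Rintegral_cst ?mul0r.
  rewrite big_ord_recr/= -IH -RintegralD//.
  - by apply: eq_Rintegral => w _; rewrite /jump_sum big_ord_recr.
  - by apply: bmf_P; exact: (bmf_sum N bE).
  - exact: bmf_P.
have bj := bmf_jump_mean bf.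
under eq_bigr do rewrite jump_mean_event// arrival_rate//.
rewrite -mulr_sumr; congr (_ * _).
transitivity (ED P t (fun p => \sum_(k < N)
    (if (alpha k p.1 <= p.2 < alpha k.+1 p.1) && (tau1 p.1 < p.2 <= tau2 p.1)
     then jump_mean f (W k p.2 p.1) else 0))).
  rewrite (@ED_sum _ _ _ _ t N (fun k p =>
    (if (alpha k p.1 <= p.2 < alpha k.+1 p.1) && (tau1 p.1 < p.2 <= tau2 p.1)
     then jump_mean f (W k p.2 p.1) else 0)))//.
  by move=> k; exact: bmf_arrival_window.
apply: eq_ED => w v /andP[v0 vt] /=.
case: (tau1 w < v <= tau2 w); last first.
  by rewrite andbF big1// => k _; rewrite andbF.
under eq_bigr do rewrite andbT.
by rewrite andbT window_telescope// ltW.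
Qed.

End window.

(** * Rates of switches *)

Section switches.
Variables (t : R) (N m : nat).
Hypothesis t0 : 0 <= t.

Definition prolonged (w : T) (k : nat) : R := if k == m then t + 1 else visits w k.

(* Up to time min(t, S (m+1)), lengthening the m-th visit to t + 1 changes nothing,
   and it makes the path independent of the true length of that visit. *)
Lemma prolonged_W v w : 0 <= v -> v <= t -> v <= S m.+1 w ->
  wl (clk (server on (prolonged w))) (arrivals w) (services w) x0 N v = W N v w.
Proof.
move=> v0 vt vS; apply: wl_ext => //; first by move=> k; exact: X0.
move=> z /andP[z0 zv]; apply: (@clk_ext _ _ _ _ m) => //.
- by move=> j; rewrite /prolonged; case: ifP => // _; [lra|exact: X0].
- by move=> j; exact: X0.
- by move=> j jm; rewrite /prolonged ltn_eqF.
- rewrite /prolonged eqxx (@epoch_ext _ _ (visits w)); last first.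
    by move=> j jm; rewrite ltn_eqF.
  have : 0 <= S m w by apply: epoch_ge0 => k; exact: X0.
  lra.
- by rewrite -epochS (le_trans zv).
Qed.

Lemma bmf_switch (g : R -> R) : bmf g ->
  bmf (fun w => if S m w <= t then g (W N (S m w) w) else 0).
Proof.
move=> bg; have mS := measurable_S m.
apply: bmf_if; last exact: bmf_cst.
  exact: measurable_fun_ler.
apply: (bmf_comp bg).
apply: (measurableT_comp (measurable_W N) (g := fun w => (w, S m w))).
exact: measurable_fun_pair.
Qed.

Lemma bmf_visit_window (g : R -> R) : bmf g ->
  bmf (fun p : T * R => if S m p.1 <= p.2 < S m.+1 p.1 then g (W N p.2 p.1) else 0).
Proof.
move=> bg; apply: bmf_if; [|exact: bmf_W|exact: bmf_cst].
exact: (measurable_in_co (measurable_S m) (measurable_S m.+1)).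
Qed.

End switches.

(** [compensator] does not apply to [W N] itself, whose path involves the length of visit m. The
    path with the prolonged visit has the same values up to the switch and does not involve that
    length. *)
Lemma switch_rate_ge0 (g : R -> R) t N m : 0 <= t -> bmf g -> (forall x, 0 <= g x) ->
  \int[P]_w (if S m.+1 w <= t then g (W N (S m.+1 w) w) else 0) =
  (if on m then con else coff) *
  ED P t (fun p => if S m p.1 <= p.2 < S m.+1 p.1 then g (W N p.2 p.1) else 0).
Proof.
move=> t0 bg g0; set rate := (if on m then con else coff).
have rate0 : 0 < rate by rewrite /rate; case: ifP.
pose U := others X (ir m).
have mvis k : k != m -> measurable_fun setT ((fun w => visits w k) : U -> R).
  by move=> km; apply: measurable_others; apply: contraNneq km => /ir_inj ->.
have mpro k : measurable_fun setT (fun w : U => prolonged t m w k).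
  by rewrite /prolonged; case: eqVneq => [_|km]; [exact: measurable_cst|exact: mvis].
pose Wp (p : R * U) := wl (clk (server on (prolonged t m p.2))) (arrivals p.2) (services p.2) x0 N p.1.
have m2 (f : U -> R) : measurable_fun setT f -> measurable_fun setT (fun p : R * U => f p.2).
  by move=> mf; exact: measurableT_comp.
have mWp : measurable_fun setT Wp.
  apply: (@measurable_wl _ (R * U)%type R on
    (fun k p => arrivals p.2 k) (fun k p => services p.2 k) (fun k p => prolonged t m p.2 k)) => //.
  - by move=> k; exact: (m2 _ (mpro k)).
  - by move=> k _; apply: (m2 (fun w => arrivals w k)); apply: measurable_others; exact: iar.
  - by move=> k _; apply: (m2 (fun w => services w k)); apply: measurable_others; exact: ibr.
pose Z (p : R * U) : \bar R := (if p.1 <= t then g (Wp p) else 0)%:E.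
have mZ : measurable_fun setT Z.
  apply/measurable_EFinP; apply: measurable_fun_ifT => //.
    exact: measurable_fun_ler.
  by apply: (measurableT_comp bg.1).
have Z0 p : (0 <= Z p)%E by rewrite lee_fin; case: ifP.
have mSm : measurable_fun setT ((fun w => S m w) : U -> R).
  apply: (@measurable_epoch _ U R (fun k w => visits w k)) => k km.
  by apply: mvis; rewrite ltn_eqF.
have := @compensator _ T R P _ U rate (X (ir m))
  (others_id (ir m)) (fun w => S m w) Z rate0 (r_law m) (indep_others indX)
  mSm mZ Z0.
have bE : bmf (fun w => if S m.+1 w <= t then g (W N (S m.+1 w) w) else 0).
  exact: bmf_switch.
have bV := bmf_visit_window N m bg.
move=> h; apply: EFin_inj; rewrite EFinM -ED_tonelli//; last first.
  by move=> p; case: ifP.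
rewrite -Rexp_EFin//.
have S0 k w : 0 <= S k w by apply: epoch_ge0 => j; exact: X0.
transitivity (\int[P]_w Z ((S m w + X (ir m) w)%R, others_id (ir m) w))%E.
  apply: eq_integral => w _; rewrite /Z/=.
  have -> : S m w + X (ir m) w = S m.+1 w by rewrite epochS.
  by case: ifPn => // St; rewrite /Wp/= prolonged_W.
rewrite h; congr (_ * _)%E; apply: eq_integral => w _.
have SE : S m w + X (ir m) w = S m.+1 w by rewrite epochS.
rewrite /others_id SE.
have mt (f : R -> R) (D : R -> bool) : measurable_fun setT f -> measurable_fun setT D ->
    measurable_fun (setT : set (measurableTypeR R)) (fun v => (if D v then f v else 0)%:E).
  by move=> mf mD; apply/measurable_EFinP; apply: measurable_fun_ifT.
transitivity (\int[mu]_v (if (S m w <= v < S m.+1 w) && (v <= t) then g (W N v w) else 0)%:E)%E.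
  apply: eq_integral => v _; rewrite /Z/=.
  case: ifPn => //= /andP[h1 h2]; case: ifPn => // vt.
  by rewrite /Wp/= prolonged_W//; [exact: le_trans (S0 m w) h1|exact: ltW].
have mW : measurable_fun setT (fun v => g (W N v w)).
  exact: (bmf_slice1 w (bmf_W N bg)).1.
have mD1 : measurable_fun setT (fun v : R => (S m w <= v < S m.+1 w) && (v <= t)).
  apply: measurable_and; last exact: measurable_fun_ler.
  by apply: measurable_and; [exact: measurable_fun_ler|exact: measurable_fun_ltr].
have mD2 : measurable_fun setT (fun v : R => (0 < v <= t) && (S m w <= v < S m.+1 w)).
  apply: measurable_and.
    by apply: measurable_and; [exact: measurable_fun_ltr|exact: measurable_fun_ler].
  by apply: measurable_and; [exact: measurable_fun_ler|exact: measurable_fun_ltr].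
transitivity (\int[mu]_v (if (0 < v <= t) && (S m w <= v < S m.+1 w) then g (W N v w) else 0)%:E)%E; last first.
  by apply: eq_integral => v _; case: (0 < v <= t).
(* [ED] leaves out the instant 0, which a visit window starting at 0 contains. *)
apply: ae_eq_integral => //; [exact: mt|exact: mt|].
exists [set 0]; split=> //; first exact: lebesgue_measure_set1.
move=> v /=; apply: contra_notP => /eqP v0 _; congr EFin.
congr (if _ then _ else _).
case: (boolP (S m w <= v < S m.+1 w)) => [/andP[h1 _]|_]; rewrite /= ?andbF//.
by rewrite andbT lt_neqAle eq_sym v0/= (le_trans _ h1).
Qed.

Lemma switch_rate (g : R -> R) t N m : 0 <= t -> bmf g ->
  \int[P]_w (if S m.+1 w <= t then g (W N (S m.+1 w) w) else 0) =
  (if on m then con else coff) *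
  ED P t (fun p => if S m p.1 <= p.2 < S m.+1 p.1 then g (W N p.2 p.1) else 0).
Proof.
move=> t0 bg; have [M gM] := bg.2.
have M0 : 0 <= M by exact: le_trans (gM 0).
have bM : bmf ((fun=> M) : R -> R) by exact: bmf_cst.
have bgM : bmf (fun x => g x + M) by exact: bmfD.
have gM0 x : 0 <= g x + M by have := gM x; rewrite ler_norml => /andP[]; lra.
have h1 := switch_rate_ge0 N m t0 bgM gM0.
have h2 := switch_rate_ge0 N m t0 bM (fun=> M0).
have ifB (c : bool) (x y : R) : (if c then x else 0) =
  (if c then x + y else 0) - (if c then y else 0) by case: c; lra.
under eq_Rintegral do rewrite (ifB _ _ M).
rewrite RintegralB//; last 2 first.
- by apply: bmf_P; exact: (bmf_switch t N m.+1 bgM).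
- by apply: bmf_P; exact: (bmf_switch t N m.+1 bM).
rewrite h1 h2 -mulrBr -EDB//; last 2 first.
- exact: (bmf_visit_window N m bgM).
- exact: (bmf_visit_window N m bM).
by congr (_ * _); apply: eq_ED => w v _; rewrite -ifB.
Qed.

Local Notation O1 := (fun p : T * R => \1_(server_set p.1) p.2 : R).

Lemma bmf_server : bmf O1.
Proof.
have mA : measurable [set p : T * R | server_set p.1 p.2].
  apply: (@measurable_server2 _ T R on (fun k w => visits w k)) => k.
  exact: measurable_X.
have := bmf_indic R mA; congr (bmf _); apply/funext => p.
Qed.

Lemma bmf_jump_sum (f : R -> R) N (tau1 tau2 : T -> R) : bmf f ->
  measurable_fun setT tau1 -> measurable_fun setT tau2 ->
  bmf (fun w => jump_sum (clk (server_set w)) (arrivals w) (services w) x0 f N (tau1 w) (tau2 w)).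
Proof.
move=> bf mt1 mt2.
apply: (@bmf_sum _ T R N (fun n w => if tau1 w < alpha n.+1 w <= tau2 w
  then f (W n (alpha n.+1 w) w + services w n) - f (W n (alpha n.+1 w) w) else 0)) => n.
have mA := measurable_alpha n.+1.
have mWA : measurable_fun setT (fun w => W n (alpha n.+1 w) w).
  apply: (measurableT_comp (measurable_W n) (g := fun w => (w, alpha n.+1 w))).
  exact: measurable_fun_pair.
apply: bmf_if; last exact: bmf_cst.
  by apply: measurable_and; [exact: measurable_fun_ltr|exact: measurable_fun_ler].
apply: bmfB; last by apply: (bmf_comp bf).
by apply: (bmf_comp bf); apply: measurable_funD => //; exact: measurable_X.
Qed.

Lemma bmf_before_alpha (g : R -> R) N : bmf g ->
  bmf (fun p : T * R => if p.2 < alpha N p.1 then g (W N p.2 p.1) else 0).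
Proof.
move=> bg; apply: bmf_if; [|exact: bmf_W|exact: bmf_cst].
by apply: measurable_fun_ltr => //; apply: (measurableT_comp (measurable_alpha N)).
Qed.

Lemma Rintegral_oc_co (g : R -> R) (t : R) : bmf g ->
  \int[mu]_(v in `]0, t]) g v = \int[mu]_(v in `[0, t[) g v.
Proof.
move=> bg.
have int (i j : bool) : mu.-integrable [set` Interval (BSide i 0) (BSide j t)] (EFin \o g).
  apply: (@bmf_integrable _ (measurableTypeR R) R mu) => //.
  by have := @mu_itv_lty R setT 0 t i j measurableT; rewrite setIT.
by rewrite Rintegral_itv_obnd_cbnd// -Rintegral_itv_bndo_bndc.
Qed.

Lemma W_at v N : measurable_fun setT (W N v).
Proof.
apply: (measurableT_comp (measurable_W N) (g := fun w => (w, v))).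
exact: measurable_fun_pair.
Qed.

Lemma mean_drift (F G : R -> R) (K : R) N t : 0 <= t -> bmf F -> bmf G ->
  (forall x, F (Num.max 0 x) = F x) -> (forall x, G (Num.max 0 x) = G x) ->
  (forall x y, `|F x - F y - G y * (x - y)| <= K * (x - y) ^+ 2) ->
  (forall x y, `|G x - G y| <= K * `|x - y|) ->
  \int[P]_w F (W N t w) - \int[P]_w F (W N 0 w) =
  lam * ED P t (fun p => if p.2 < alpha N p.1 then jump_mean F (W N p.2 p.1) else 0)
  - ED P t (fun p => G (W N p.2 p.1) * O1 p).
Proof.
move=> t0 bF bG F0 G0 FG Glip.
have [M GM] := bG.2.
have bGO : bmf (fun p : T * R => G (W N p.2 p.1) * O1 p).
  by apply: bmfM; [exact: bmf_W|exact: bmf_server].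
have bFW v : bmf (fun w => F (W N v w)) by apply: (bmf_comp bF); exact: W_at.
have bJ := bmf_jump_sum N bF (measurable_cst (0 : R)) (measurable_cst t).
have path w : F (W N t w) - F (W N 0 w) =
    jump_sum (clk (server_set w)) (arrivals w) (services w) x0 F N 0 t -
    \int[mu]_(v in `]0, t]) (G (W N v w) * O1 (w, v)).
  have mS : measurable (server_set w) by exact: measurable_server.
  rewrite Rintegral_oc_co; last exact: (bmf_slice1 w bGO).
  refine (@wl_increment R (clk (server_set w)) (arrivals w) (services w) x0
    (fun k => X0 (ia k) w) (fun k => X0 (ib k) w) (server_set w) F G 0 t mS bG
    (measurable_clk1 mS) _ N 0 t (lexx 0) t0 (lexx t)).
  move=> L u v u0 uv _; rewrite !F0.
  rewrite (chain_rule_clk mS FG Glip bG.1 GM L u0 uv).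
  by congr (- _); apply: eq_Rintegral => z _; rewrite G0.
rewrite -RintegralB//; [|exact: bmf_P..].
under eq_Rintegral do rewrite path.
rewrite RintegralB//; last 2 first.
- exact: bmf_P.
- apply: bmf_P; have := bmfB bJ (bmfB (bFW t) (bFW 0)); congr (bmf _).
  by apply/funext => w; rewrite path; lra.
rewrite (@ED_w _ T R P t _ t0 bGO); congr (_ - _).
rewrite (@jump_sum_mean (fun=> 0) (fun=> t) t)//.
- congr (_ * _); apply: eq_ED => w v /andP[h1 h2] /=.
  by rewrite h1 h2 /= andbT.
Qed.

Lemma visit_measurable_S m : visit_measurable (fun w => S m w).
Proof.
move=> j hj; apply: (@measurable_epoch _ (others X j) R (fun k w => visits w k)) => k _.
exact: measurable_others_r.
Qed.

Section switch_balance.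
Variables (f : R -> R) (t : R) (N : nat) (M : R).
Hypothesis bf : bmf f.
Hypothesis fM : forall x, `|f x| <= M.
Hypothesis t0 : 0 <= t.

Let Smin m w := Num.min (S m w) t.

Let vSmin m : visit_measurable (Smin m).
Proof.
by move=> j hj; apply: measurable_minr => //; exact: visit_measurable_S.
Qed.

Let mSmin m : measurable_fun setT (Smin m).
Proof. by apply: measurable_minr => //; exact: measurable_S. Qed.

Let S_ge0 m w : 0 <= S m w.
Proof. by apply: epoch_ge0 => j; exact: X0. Qed.

Let bfW (tau : T -> R) : measurable_fun setT tau -> bmf (fun w => f (W N (tau w) w)).
Proof.
move=> mtau; apply: (bmf_comp bf).
apply: (measurableT_comp (measurable_W N) (g := fun w => (w, tau w))).
exact: measurable_fun_pair.
Qed.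

(** The clock stands still during the visit, so the drift hypothesis holds with zero derivative
    whatever [f] is, and only the jumps are left. Truncation at t makes the interval degenerate if
    the visit starts later. *)
Lemma off_visit_increment m : ~~ on m ->
  \int[P]_w f (W N (Smin m.+1 w) w) - \int[P]_w f (W N (Smin m w) w) =
  lam * ED P t (fun p => if S m p.1 <= p.2 < S m.+1 p.1 then
     (if p.2 < alpha N p.1 then jump_mean f (W N p.2 p.1) else 0) else 0).
Proof.
move=> offm.
have SS w : S m w <= S m.+1 w by apply: epoch_le => // k; exact: X0.
rewrite -RintegralB//; [|by apply: bmf_P; apply: bfW..].
have path w : f (W N (Smin m.+1 w) w) - f (W N (Smin m w) w) =
    jump_sum (clk (server_set w)) (arrivals w) (services w) x0 f N (Smin m w) (Smin m.+1 w).
  have mS : measurable (server_set w) by exact: measurable_server.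
  have uv : Smin m w <= Smin m.+1 w by rewrite /Smin le_min !ge_min SS lexx orbT.
  rewrite (@wl_increment R (clk (server_set w)) (arrivals w) (services w) x0
    (fun k => X0 (ia k) w) (fun k => X0 (ib k) w) (server_set w) f (fun=> 0)
    (Smin m w) (Smin m.+1 w) mS (bmf_cst _ _)
    (measurable_clk1 mS) _ N (Smin m w) (Smin m.+1 w) (lexx _) uv (lexx _)).
    rewrite (_ : (fun z => 0 * \1_(server_set w) z) = fun=> 0); last first.
      by apply/funext => z; rewrite mul0r.
    by rewrite Rintegral_cst// mul0r subr0.
  move=> L u v u0 uv' v0.
  rewrite (_ : (fun z => 0 * \1_(server_set w) z) = fun=> 0); last first.
    by apply/funext => z; rewrite mul0r.
  rewrite Rintegral_cst// mul0r oppr0.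
  have [St|tS] := leP (S m w) t; last first.
    have m1 : Smin m w = t by rewrite /Smin min_r// ltW.
    have m2 : Smin m.+1 w = t by rewrite /Smin min_r// (le_trans (ltW tS)).
    have -> : u = v by apply/eqP; rewrite eq_le uv' (le_trans v0)// m2 -m1.
    by rewrite subrr.
  rewrite (@clk_off R on (visits w) m u v) ?subrr//.
  - by move=> k; exact: X0.
  - by move: u0; rewrite /Smin min_l.
  - by rewrite (le_trans v0)// /Smin ge_min lexx.
under eq_Rintegral do rewrite path.
rewrite (@jump_sum_mean (Smin m) (Smin m.+1) t)//; last 2 first.
- by move=> w; rewrite le_min S_ge0 t0.
- by move=> w; rewrite ge_min lexx orbT.
congr (_ * _).
have bj := bmf_before_alpha N (bmf_jump_mean bf).
pose h (p : T * R) := if S m p.1 < p.2 <= S m.+1 p.1 then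
     (if p.2 < alpha N p.1 then jump_mean f (W N p.2 p.1) else 0) else 0.
have mco : measurable_fun setT (fun p : T * R => S m p.1 <= p.2 < S m.+1 p.1).
  exact: (measurable_in_co (measurable_S m) (measurable_S m.+1)).
have moc : measurable_fun setT (fun p : T * R => S m p.1 < p.2 <= S m.+1 p.1).
  exact: (measurable_in_oc (measurable_S m) (measurable_S m.+1)).
have mcc : measurable_fun setT (fun p : T * R => S m p.1 <= p.2 <= S m.+1 p.1).
  apply: measurable_and.
    by apply: measurable_fun_ler => //; apply: (measurableT_comp (measurable_S m)).
  by apply: measurable_fun_ler => //; apply: (measurableT_comp (measurable_S m.+1)).
transitivity (ED P t h).
  apply: eq_ED => w v /andP[v0 vt]; rewrite /h/= /Smin gt_min le_min vt andbT.
  rewrite (ltNge t v) vt orbF.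
  by case: (v < alpha N w) => //=; case: ifP.
have bz : bmf ((fun=> 0) : T * R -> R) by exact: bmf_cst.
(* The window changes its open end from left to right through the closed window, one instant per
   path at a time. *)
transitivity (ED P t (fun p => if S m p.1 <= p.2 <= S m.+1 p.1 then
     (if p.2 < alpha N p.1 then jump_mean f (W N p.2 p.1) else 0) else 0)).
  apply: (@ED_null _ _ _ _ _ _ _ (fun w => S m w)) => //; try exact: bmf_if.
  by move=> w v vS; rewrite /h/= lt_neqAle eq_sym vS.
apply: (@ED_null _ _ _ _ _ _ _ (fun w => S m.+1 w)) => //; try exact: bmf_if.
by move=> w v vS /=; rewrite [v < S m.+1 w]lt_neqAle vS.
Qed.

(** The value at a truncated epoch splits in two. [p] is about switches that occur by t and is
    evaluated by [switch_rate]; [q] is a boundary part, whose increment over m is the mean of [f] at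
    time t on the event that visit m is then in progress. *)
Let p m : R := \int[P]_w (if S m w <= t then f (W N (S m w) w) else 0).
Let q m : R := \int[P]_w (if S m w <= t then 0 else f (W N t w)).

Let bq m : bmf (fun w => if S m w <= t then 0 else f (W N t w)).
Proof.
apply: bmf_if; [|exact: bmf_cst|exact: bfW].
by apply: measurable_fun_ler => //; exact: measurable_S.
Qed.

Let pqE m : \int[P]_w f (W N (Smin m w) w) = p m + q m.
Proof.
rewrite /p /q -RintegralD//.
- apply: eq_Rintegral => w _; rewrite /Smin; case: leP => h; first by rewrite addr0.
  by rewrite add0r.
- by apply: bmf_P; exact: (bmf_switch t N m bf).
- exact: bmf_P.
Qed.

(** At most one visit is in progress at time t, so at most one term is nonzero. *)
Lemma window_sum_bound (h : nat -> R) K w : (forall m, `|h m| <= M) ->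
  `|\sum_(m < K) (if S m w <= t < S m.+1 w then h m else 0)| <=
  (if t < S K w then M else 0).
Proof.
move=> hM; have M0 := le_trans (normr_ge0 _) (hM 0%N).
elim: K => [|K IH]; first by rewrite big_ord0 normr0; case: ifP.
rewrite big_ord_recr/=; move: IH; have [tK|Kt] /= := ltP t (S K w) => IH.
  have tK1 : t < S K.+1 w by apply: lt_le_trans tK _; apply: epoch_le => // k; exact: X0.
  by rewrite addr0 tK1.
have -> : \sum_(m < K) (if S m w <= t < S m.+1 w then h m else 0) = 0.
  by apply/eqP; rewrite -normr_le0.
by rewrite add0r; case: ifP; rewrite ?normr0.
Qed.

Let M0 : 0 <= M. Proof. exact: le_trans (fM 0). Qed.

Lemma off_exit_bound K :
  `|\sum_(m < K) (~~ on m)%:R * (q m.+1 - q m)| <= M.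
Proof.
have bterm m : bmf (fun w => (~~ on m)%:R * ((if S m.+1 w <= t then 0 else f (W N t w)) -
      (if S m w <= t then 0 else f (W N t w))) : R).
  by apply: bmfM; [exact: bmf_cst|exact: bmfB].
have -> : \sum_(m < K) (~~ on m)%:R * (q m.+1 - q m) =
    \int[P]_w \sum_(m < K) ((~~ on m)%:R * ((if S m.+1 w <= t then 0 else f (W N t w)) -
      (if S m w <= t then 0 else f (W N t w)))).
  elim: K => [|K IH].
    rewrite big_ord0; under eq_Rintegral do rewrite big_ord0.
    by rewrite Rintegral_cst ?mul0r.
  rewrite big_ord_recr/= IH; under [RHS]eq_Rintegral do rewrite big_ord_recr/=.
  rewrite RintegralD//; last 2 first.
  - by apply: bmf_P; exact: (bmf_sum K bterm).
  - exact: bmf_P.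
  congr (_ + _); rewrite RintegralZl//; last by apply: bmf_P; exact: bmfB.
  by rewrite RintegralB//; exact: bmf_P.
apply: Rexp_bound; first exact: (bmf_sum K bterm).
move=> w.
have := @window_sum_bound (fun m => (~~ on m)%:R * f (W N t w)) K w.
have hM m : `|(~~ on m)%:R * f (W N t w)| <= M.
  by case: (on m); rewrite /= ?mul0r ?mul1r ?normr0.
move=> /(_ hM) h; apply: (le_trans _ (le_trans h _)); last by case: ifP.
rewrite le_eqVlt; apply/orP; left; apply/eqP; congr `|_|.
apply: eq_bigr => m _.
have SS : S m w <= S m.+1 w by apply: epoch_le => // k; exact: X0.
have [S1|S1] := leP (S m w) t; have [S2|S2] := leP (S m.+1 w) t; rewrite /= ?subrr ?subr0 ?sub0r ?mulr0//.
by have := le_lt_trans S2 (lt_le_trans S1 SS); rewrite ltxx.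
Qed.

(** By alternation an off visit starts where an on visit ends. Each switch epoch is thus counted
    once, with sign + at the end of an off visit and - at the end of an on visit, apart from the two
    extremes. *)
Lemma summation_by_parts (u : nat -> R) K :
  \sum_(m < K) (~~ on m)%:R * (u m.+1 - u m) =
  \sum_(m < K) ((~~ on m)%:R - (on m)%:R) * u m.+1
   - (~~ on 0%N)%:R * u 0%N + (~~ on K)%:R * u K.
Proof.
elim: K => [|K IH]; first by rewrite !big_ord0; ring.
by rewrite !big_ord_recr/= IH alt; case: (on K) => /=; ring.
Qed.

Lemma p_bound m : `|p m| <= M.
Proof.
apply: Rexp_bound; first exact: (bmf_switch t N m bf).
by move=> w; case: ifP; rewrite ?normr0.
Qed.

(** Of the three [M], one is for the visit in progress at t and two are for the extreme terms of the
    summation by parts. *)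
Lemma mean_switch K :
  `|\sum_(m < K) ((~~ on m)%:R * coff - (on m)%:R * con) *
      ED P t (fun p => if S m p.1 <= p.2 < S m.+1 p.1 then f (W N p.2 p.1) else 0)
    - lam * \sum_(m < K) (~~ on m)%:R *
      ED P t (fun p => if S m p.1 <= p.2 < S m.+1 p.1 then
       (if p.2 < alpha N p.1 then jump_mean f (W N p.2 p.1) else 0) else 0)| <= 3 * M.
Proof.
have -> : lam * \sum_(m < K) (~~ on m)%:R *
      ED P t (fun p => if S m p.1 <= p.2 < S m.+1 p.1 then
       (if p.2 < alpha N p.1 then jump_mean f (W N p.2 p.1) else 0) else 0) =
   \sum_(m < K) (~~ on m)%:R * (p m.+1 - p m) + \sum_(m < K) (~~ on m)%:R * (q m.+1 - q m).
  rewrite mulr_sumr -big_split/=; apply: eq_bigr => m _.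
  case: (boolP (on m)) => [_|offm]; first by rewrite !mul0r mulr0 addr0.
  by rewrite !mul1r -off_visit_increment// !pqE; ring.
rewrite summation_by_parts.
have -> : \sum_(m < K) ((~~ on m)%:R * coff - (on m)%:R * con) *
      ED P t (fun p => if S m p.1 <= p.2 < S m.+1 p.1 then f (W N p.2 p.1) else 0) =
   \sum_(m < K) ((~~ on m)%:R - (on m)%:R) * p m.+1.
  apply: eq_bigr => m _; rewrite /p switch_rate//.
  by case: (on m) => /=; ring.
have h1 := off_exit_bound K; have h2 := p_bound 0; have h3 := p_bound K.
have b1 : `|(~~ on 0%N)%:R * p 0%N| <= M.
  by case: (on 0%N); rewrite /= ?mul0r ?mul1r ?normr0.
have b2 : `|(~~ on K)%:R * p K| <= M.
  by case: (on K); rewrite /= ?mul0r ?mul1r ?normr0.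
move: h1 b1 b2; rewrite !ler_norml => /andP[? ?] /andP[? ?] /andP[? ?].
by apply/andP; split; lra.
Qed.

End switch_balance.

Lemma jump_mean_bound f M : bmf f -> (forall x, `|f x| <= M) ->
  forall x, `|jump_mean f x| <= 2 * M.
Proof.
move=> bf fM x; rewrite (le_trans (ler_normB _ _))// mulr2n mulrDl mul1r lerD//.
apply: Rexp_bound => //; apply: (bmf_comp bf); apply: measurable_funD => //.
Qed.

(** Off this event, cutting off after N customers and N visits is not felt during [[0, t]]. *)
Definition late (N : nat) (t : R) : set T :=
  [set w | (S N w <= t) || (alpha N w <= t)].

Lemma measurable_late N t : measurable (late N t).
Proof.
have mb : measurable_fun setT (fun w => (S N w <= t) || (alpha N w <= t)).
  apply: measurable_or; apply: measurable_fun_ler => //.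
    exact: measurable_S.
  exact: measurable_alpha.
by rewrite -[X in measurable X]setTI; exact: (mb measurableT [set true]).
Qed.

Lemma drift_balance (F G : R -> R) (K M : R) N t : 0 <= t -> bmf F -> bmf G ->
  (forall x, `|F x| <= M) ->
  (forall x, F (Num.max 0 x) = F x) -> (forall x, G (Num.max 0 x) = G x) ->
  (forall x y, `|F x - F y - G y * (x - y)| <= K * (x - y) ^+ 2) ->
  (forall x y, `|G x - G y| <= K * `|x - y|) ->
  `|lam * ED P t (fun p => jump_mean F (W N p.2 p.1)) -
    ED P t (fun p => G (W N p.2 p.1) * O1 p)|
  <= 2 * M + lam * (2 * M * (t * fine (P (late N t)))).
Proof.
move=> t0 bF bG FM F0 G0 FG Glip.
have h := mean_drift N t0 bF bG F0 G0 FG Glip.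
have bj := bmf_jump_mean bF.
have bFW v : bmf (fun w => F (W N v w)) by apply: (bmf_comp bF); exact: W_at.
have b1 : `|\int[P]_w F (W N t w)| <= M by exact: Rexp_bound.
have b2 : `|\int[P]_w F (W N 0 w)| <= M by exact: Rexp_bound.
have bJW : bmf (fun p : T * R => jump_mean F (W N p.2 p.1)) by exact: bmf_W.
have bJA := bmf_before_alpha N bj.
have : `|ED P t (fun p => jump_mean F (W N p.2 p.1)) - ED P t (fun p =>
    if p.2 < alpha N p.1 then jump_mean F (W N p.2 p.1) else 0)|
    <= 2 * M * (t * fine (P (late N t))).
  rewrite -EDB//; apply: ED_norm_le => //; [exact: bmfB|exact: measurable_late|].
  move=> w v /andP[v0 vt] /=; case: ltP => [_|Av].
    rewrite subrr normr0 mulr_ge0//.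
    by rewrite mulr_ge0// (le_trans _ (FM 0)).
  rewrite subr0 indicE mem_set ?mulr1; first exact: jump_mean_bound.
  by rewrite /late/= (le_trans Av vt) orbT.
move: h b1 b2.
set A := ED _ _ _; set B := ED _ _ _; set C := ED _ _ _; set D := _ * (t * _).
move=> h b1 b2 b3.
have b3' : `|lam * (C - A)| <= lam * D by rewrite normrM gtr0_norm// ler_wpM2l// ltW.
have -> : lam * C - B = (\int[P]_w F (W N t w) - \int[P]_w F (W N 0 w)) + lam * (C - A).
  by rewrite h; ring.
rewrite (le_trans (ler_normD _ _))// lerD//.
by rewrite (le_trans (ler_normB _ _))// mulr2n mulrDl mul1r lerD.
Qed.

Lemma window_server (A B : R) K w v : 0 <= v ->
  \sum_(m < K) (if S m w <= v < S m.+1 w then (if on m then A else B) else 0) =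
  (if v < S K w then A * O1 (w, v) + B * (1 - O1 (w, v)) else 0).
Proof.
move=> v0; elim: K => [|K IH]; first by rewrite big_ord0 epoch0 ltNge v0.
rewrite big_ord_recr/= IH; have [vK|Kv] /= := ltP v (S K w).
  have vK1 : v < S K.+1 w by apply: lt_le_trans vK _; apply: epoch_le => // k; exact: X0.
  by rewrite vK1 addr0.
rewrite add0r; case: ifPn => // vK1; rewrite indicE.
case: (boolP (on K)) => [onK|offK].
  rewrite mem_set ?mulr1 ?subrr ?mulr0 ?addr0//.
  by exists K => //=; rewrite in_itv/= Kv.
rewrite memNset ?mulr0 ?subr0 ?mulr1 ?add0r//.
move=> [k /= onk]; rewrite in_itv/= => kv; move: offK.
rewrite -(@epoch_inj R (visits w) v k K) ?onk ?Kv//.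
by move=> j; exact: X0.
Qed.

Definition switch_integrand (f : R -> R) N (p : T * R) : R :=
  (- con * f (W N p.2 p.1)) * O1 p +
  (coff * f (W N p.2 p.1) - lam * jump_mean f (W N p.2 p.1)) * (1 - O1 p).

Lemma bmf_switch_integrand f N : bmf f -> bmf (switch_integrand f N).
Proof.
move=> bf; have bj := bmf_jump_mean bf.
apply: bmfD.
  by apply: bmfM; [apply: bmfM; [exact: bmf_cst|exact: bmf_W]|exact: bmf_server].
apply: bmfM; last by apply: bmfB; [exact: bmf_cst|exact: bmf_server].
by apply: bmfB; apply: bmfM; try exact: bmf_cst; exact: bmf_W.
Qed.

(** [mean_switch] is used with as many visits as customers. Off [late] these visits cover [[0, t]]
    and the truncated integrand is the full one; on [late] each of the two is at most (con + coff +
    2 lam) M, whence the factor 2. *)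
Lemma switch_balance (f : R -> R) (M : R) N t : 0 <= t -> bmf f ->
  (forall x, `|f x| <= M) ->
  `|ED P t (switch_integrand f N)|
  <= 3 * M + 2 * (con + coff + 2 * lam) * M * (t * fine (P (late N t))).
Proof.
move=> t0 bf fM; have h := mean_switch N bf fM t0 N.
have M0 : 0 <= M by exact: le_trans (fM 0).
have bj := bmf_jump_mean bf.
have jM := jump_mean_bound bf fM.
pose J (p : T * R) := if p.2 < alpha N p.1 then jump_mean f (W N p.2 p.1) else 0.
have bJ : bmf J by exact: bmf_before_alpha.
pose win m (p : T * R) := S m p.1 <= p.2 < S m.+1 p.1.
have mwin m : measurable_fun setT (win m).
  exact: (measurable_in_co (measurable_S m) (measurable_S m.+1)).
have bz : bmf ((fun=> 0) : T * R -> R) by exact: bmf_cst.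
have bf1 m : bmf (fun p => if win m p then f (W N p.2 p.1) else 0).
  by apply: bmf_if => //; exact: bmf_W.
have bf2 m : bmf (fun p => if win m p then J p else 0) by exact: bmf_if.
pose trunc (p : T * R) := if p.2 < S N p.1 then
  (- con * f (W N p.2 p.1)) * O1 p + (coff * f (W N p.2 p.1) - lam * J p) * (1 - O1 p) else 0.
have btrunc : bmf trunc.
  apply: bmf_if => //.
    by apply: measurable_fun_ltr => //; apply: (measurableT_comp (measurable_S N)).
  apply: bmfD.
    by apply: bmfM; [apply: bmfM; [exact: bmf_cst|exact: bmf_W]|exact: bmf_server].
  apply: bmfM; last by apply: bmfB; [exact: bmf_cst|exact: bmf_server].
  by apply: bmfB; apply: bmfM => //; try exact: bmf_cst; exact: bmf_W.
have tE : ED P t trunc =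
  \sum_(m < N) ((~~ on m)%:R * coff - (on m)%:R * con) *
      ED P t (fun p => if win m p then f (W N p.2 p.1) else 0)
    - lam * \sum_(m < N) (~~ on m)%:R * ED P t (fun p => if win m p then J p else 0).
  rewrite mulr_sumr -sumrB.
  transitivity (\sum_(m < N) ED P t (fun p =>
      ((~~ on m)%:R * coff - (on m)%:R * con) * (if win m p then f (W N p.2 p.1) else 0) -
      (lam * (~~ on m)%:R) * (if win m p then J p else 0))); last first.
    apply: eq_bigr => m _; rewrite EDB//; last 2 first.
    - by apply: bmfM => //; exact: bmf_cst.
    - by apply: bmfM => //; exact: bmf_cst.
    by rewrite !EDZ// mulrA.
  rewrite -(@ED_sum _ _ _ P t N (fun m p =>
      ((~~ on m)%:R * coff - (on m)%:R * con) * (if win m p then f (W N p.2 p.1) else 0) -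
      (lam * (~~ on m)%:R) * (if win m p then J p else 0)))//; last first.
    by move=> m; apply: bmfB; apply: bmfM => //; exact: bmf_cst.
  apply: eq_ED => w v /andP[v0 _]; rewrite /trunc/=.
  rewrite -window_server//; last exact: ltW.
  apply: eq_bigr => m _; rewrite /win/=; case: ifP => _; last by rewrite !mulr0 subrr.
  by case: (on m) => /=; ring.
rewrite -tE in h.
have bs := bmf_switch_integrand N bf.
have -> : ED P t (switch_integrand f N) = ED P t trunc +
    (ED P t (switch_integrand f N) - ED P t trunc) by ring.
rewrite (le_trans (ler_normD _ _))// lerD// -EDB//.
apply: ED_norm_le => //; [exact: bmfB|exact: measurable_late|].
move=> w v /andP[v0 vt].
have bound (x y : R) (o : R) : o = 0 \/ o = 1 -> `|x| <= M -> `|y| <= 2 * M ->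
    `|(- con * x) * o + (coff * x - lam * y) * (1 - o)| <= (con + coff + 2 * lam) * M.
  have cM : 0 <= con * M by rewrite mulr_ge0// ltW.
  have cM' : 0 <= coff * M by rewrite mulr_ge0// ltW.
  have cM'' : 0 <= lam * M by rewrite mulr_ge0// ltW.
  move=> [->|->] xM yM; rewrite ?mulr0 ?subrr ?mulr0 ?addr0 ?add0r ?subr0 ?mulr1.
    rewrite (le_trans (ler_normB _ _))// !normrM (gtr0_norm coff0) (gtr0_norm lam0).
    have : coff * `|x| <= coff * M by rewrite ler_wpM2l// ltW.
    have : lam * `|y| <= lam * (2 * M) by rewrite ler_wpM2l// ltW.
    lra.
  rewrite normrM normrN (gtr0_norm con0).
  have : con * `|x| <= con * M by rewrite ler_wpM2l// ltW.
  lra.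
have O01 : O1 (w, v) = 0 \/ O1 (w, v) = 1.
  by rewrite indicE; case: (_ \in _); [right|left].
have jM0 : `|0 : R| <= 2 * M by rewrite normr0 mulr_ge0.
have sM : `|switch_integrand f N (w, v)| <= (con + coff + 2 * lam) * M by exact: bound.
rewrite indicE; case: (boolP (w \in late N t)) => [_|/negP wl].
  rewrite mulr1 (le_trans (ler_normB _ _))//.
  have : `|trunc (w, v)| <= (con + coff + 2 * lam) * M.
    rewrite /trunc; case: ifP => _; last first.
      by rewrite normr0 (le_trans _ sM).
    by apply: bound => //; rewrite /J; case: ifP.
  move: sM; lra.
rewrite mulr0 (_ : _ - _ = 0) ?normr0//.
have : ~~ ((S N w <= t) || (alpha N w <= t)).
  by apply/negP => h'; apply: wl; rewrite inE.
rewrite negb_or -!ltNge => /andP[Sl al].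
rewrite /trunc/= (le_lt_trans vt Sl) /J/= (le_lt_trans vt al).
by rewrite /switch_integrand/= subrr.
Qed.

(** A sum of nonnegative terms is at most t only if every term is. With independence this crude
    inclusion already gives a geometric bound. *)
Lemma prob_epoch_le (idx : nat -> I) (rate : nat -> R) (c t : R) n :
  injective idx -> (forall k, 0 < rate k) -> (forall k, rate k <= c) -> 0 <= t ->
  (forall k, exponential_rv (X (idx k)) (rate k)) ->
  fine (P [set w | epoch (fun k => X (idx k) w) n <= t]) <= (1 - expR (- c * t)) ^+ n.
Proof.
move=> idx_inj rate0 ratec t0 law.
have mle : measurable [set w | epoch (fun k => X (idx k) w) n <= t].
  have mb : measurable_fun setT (fun w => epoch (fun k => X (idx k) w) n <= t).
    apply: measurable_fun_ler => //.
    by apply: (@measurable_epoch _ T R (fun k w => X (idx k) w)).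
  by rewrite -[X in measurable X]setTI; exact: (mb measurableT [set true]).
pose s := [seq idx k | k <- iota 0 n].
have us : uniq s by rewrite map_inj_uniq// iota_uniq.
have mE (j : I) : measurable (`]-oo, t]%classic : set R) by exact: measurable_itv.
have sub : [set w | epoch (fun k => X (idx k) w) n <= t] `<=`
    \bigcap_(j in [set` s]) (X j @^-1` `]-oo, t]%classic).
  move=> w /= le_t j /= /mapP[k]; rewrite mem_iota add0n => /andP[_ kn] ->.
  rewrite in_itv/=; apply: le_trans le_t.
  rewrite /epoch (bigD1 (Ordinal kn))//= lerDl.
  by apply: sumr_ge0 => l _; exact: X0.
rewrite -lee_fin fineK ?fin_num_measure//.
apply: (@le_trans _ _ (P (\bigcap_(j in [set` s]) (X j @^-1` `]-oo, t]%classic)))).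
  apply: le_measure => //; rewrite ?inE//.
  exact: (bigcap_RV_measurable X s mE).
rewrite (indX us mE) big_map.
have le1 k : (P (X (idx k) @^-1` `]-oo, t]%classic) <= (1 - expR (- c * t))%:E)%E.
  have -> : X (idx k) @^-1` `]-oo, t]%classic = ~` (X (idx k) @^-1` `]t, +oo[%classic).
    apply/seteqP; split=> w /=; rewrite !in_itv/= andbT.
      by move=> h; apply/negP; rewrite -leNgt.
    by move=> /negP; rewrite -leNgt.
  rewrite probability_setC; last first.
    by rewrite -[_ @^-1` _]setTI; apply: measurable_funP => //; exact: measurable_itv.
  rewrite law; last exact: measurable_itv.
  rewrite exponential_prob_gt// -EFinB lee_fin lerD2l lerN2 ler_expR.
  by rewrite !mulNr lerN2 ler_wpM2r.
have q0 : 0 <= 1 - expR (- c * t).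
  have c0 : 0 < c by exact: lt_le_trans (rate0 0%N) (ratec 0%N).
  by rewrite subr_ge0 -expR0 ler_expR mulNr oppr_le0 mulr_ge0// ltW.
rewrite -[in leRHS](size_iota 0 n).
elim: (iota 0 n) => [|k r IH]; first by rewrite big_nil expr0.
by rewrite big_cons exprS EFinM; apply: lee_pmul => //; exact: prode_ge0.
Qed.

(** For fixed t the geometric ratio is below 1, so N can absorb any factor. The weight t keeps the
    truncation error bounded after integration over [[0, t]]. *)
Lemma exists_late t : 0 <= t -> exists N, t * fine (P (late N t)) <= 1.
Proof.
move=> t0.
pose c := Num.max lam (Num.max con coff).
pose q := 1 - expR (- c * t).
have clam : lam <= c by rewrite le_max lexx.
have q0 : 0 <= q.
  rewrite subr_ge0 -expR0 ler_expR mulNr oppr_le0 mulr_ge0//.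
  by rewrite (le_trans (ltW lam0)).
have q1 : q < 1 by rewrite ltrBlDr ltrDl expR_gt0.
have bnd N : fine (P (late N t)) <= 2 * q ^+ N.
  have h1 : fine (P [set w | alpha N w <= t]) <= q ^+ N.
    by apply: (@prob_epoch_le ia (fun=> lam)).
  have h2 : fine (P [set w | S N w <= t]) <= q ^+ N.
    apply: (@prob_epoch_le ir (fun m => if on m then con else coff)) => //.
      by move=> k; case: ifP.
    by move=> k; case: ifP => _; rewrite !le_max lexx ?orbT.
  have -> : late N t = [set w | S N w <= t] `|` [set w | alpha N w <= t].
    apply/seteqP; split=> w; rewrite /late/=; first by move=> /orP.
    by move=> h; apply/orP.
  have mS' : measurable [set w | S N w <= t].
    have mb : measurable_fun setT (fun w => S N w <= t).
      by apply: measurable_fun_ler => //; exact: measurable_S.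
    by rewrite -[X in measurable X]setTI; exact: (mb measurableT [set true]).
  have mA' : measurable [set w | alpha N w <= t].
    have mb : measurable_fun setT (fun w => alpha N w <= t).
      by apply: measurable_fun_ler => //; exact: measurable_alpha.
    by rewrite -[X in measurable X]setTI; exact: (mb measurableT [set true]).
  apply: (@le_trans _ _ (fine (P [set w | S N w <= t]) + fine (P [set w | alpha N w <= t]))); last lra.
  rewrite -lee_fin EFinD !fineK ?fin_num_measure//; last exact: measurableU.
  exact: measureU2.
have cq : (fun n => q ^+ n) @ \oo --> (0 : R).
  by apply: cvg_expr; rewrite ger0_norm.
have [N _ /(_ N (leqnn N)) hN] : \forall n \near \oo, q ^+ n < (2 * t + 1)^-1.
  have e0 : 0 < (2 * t + 1)^-1 by rewrite invr_gt0; lra.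
  move/cvgrPdist_lt : cq => /(_ _ e0); apply: filterS => n.
  by rewrite sub0r normrN ger0_norm// exprn_ge0.
exists N; apply: (@le_trans _ _ (t * (2 * (2 * t + 1)^-1))).
  by rewrite ler_wpM2l// (le_trans (bnd N))// ler_wpM2l// ltW.
by rewrite mulrA ler_pdivrMr; lra.
Qed.

Let half_bound (x e t : R) : 2 * x < e * t -> x + e / 2 * t <= e * t.
Proof. lra. Qed.

(** Cesaro averaging of a convergent function of time. Times before [A] cost at most [D] each, the
    replacement of [V] by [W (N t)] at most 2 M in total, and the remaining times at most e / 2
    each. *)
Lemma cesaro_W (V : R -> T -> R) (f : R -> R) (M l : R) :
  bmf f -> (forall x, `|f x| <= M) ->
  (forall v, measurable_fun setT (V v)) ->
  (forall n (v : R) w, 0 <= v -> v < alpha n w -> V v w = W n v w) ->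
  (\int[P]_w f (V v w)) @[v --> +oo] --> l ->
  forall N : R -> nat, (forall t : R, 0 <= t -> t * fine (P (late (N t) t)) <= 1) ->
  (ED P t (fun p => f (W (N t) p.2 p.1)) / t) @[t --> +oo] --> l.
Proof.
move=> bf fM mV VW cvl N lateN.
have M0 : 0 <= M by exact: le_trans (fM 0).
have bfV v : bmf (fun w => f (V v w)) by apply: (bmf_comp bf).
have bfW n v : bmf (fun w => f (W n v w)) by apply: (bmf_comp bf); exact: W_at.
apply/cvgrPdist_le => e e0.
have e2 : 0 < e / 2 by rewrite divr_gt0.
move: (cvl) => /cvgrPdist_le /(_ _ e2) [A0 [_ hA]].
pose A := Num.max 0 A0; pose D := M + `|l|.
have A_ge0 : 0 <= A by rewrite le_max lexx.
have D0 : 0 <= D by rewrite addr_ge0.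
have bound (t : R) : 0 < t -> `|ED P t (fun p => f (W (N t) p.2 p.1)) - l * t| <=
    D * A + 2 * M + e / 2 * t.
  move=> t0; have t0' := ltW t0.
  have bW := bmf_W (N t) bf.
  have bl : bmf ((fun=> l) : T * R -> R) by exact: bmf_cst.
  have ED_l : ED P t ((fun=> l) : T * R -> R) = l * t.
    rewrite (@ED_fst _ T R P t (fun=> l))//; last exact: bmf_cst.
    have PT : fine (P setT) = 1 by rewrite probability_setT.
    by rewrite Rintegral_cst// [X in t * (_ * X)]PT mulr1 mulrC.
  rewrite -ED_l -EDB// ED_v//; last exact: bmfB.
  pose h v := \int[P]_w (f (W (N t) v w) - l).
  have bh : bmf h.
    apply: (bmf_Rexp P (g := fun p : R * T => f (W (N t) p.1 p.2) - l)).
    apply: bmfB; last exact: bmf_cst.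
    apply: (bmf_comp bW (g := fun p : R * T => (p.2, p.1))).
    exact: measurable_fun_pair.
  have muI : (mu `]0%R, t]%classic < +oo)%E by exact: mu_oc_lty.
  have int (g : R -> R) : bmf g -> mu.-integrable `]0%R, t]%classic (EFin \o g).
    by move=> bg; apply: (@bmf_integrable _ (measurableTypeR R) R mu).
  pose c := 2 * M * fine (P (late (N t) t)) + e / 2.
  have mI : measurable (`]0%R, A]%classic : set R) by exact: measurable_itv.
  have bD : bmf (fun v : R => D * \1_(`]0%R, A]%classic) v).
    by apply: bmfM; [exact: bmf_cst|exact: bmf_indic].
  have hle (v : R) : 0 < v <= t -> `|h v| <= D * \1_(`]0%R, A]%classic) v + c.
    move=> /andP[v0 vt]; rewrite indicE.
    case: (boolP (v \in _)) => [_|vA].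
      rewrite mulr1; apply: (@le_trans _ _ D); last first.
        by rewrite lerDl addr_ge0 ?mulr_ge0 ?fine_ge0// ltW.
      apply: Rexp_bound; first by apply: bmfB => //; exact: bmf_cst.
      by move=> w; rewrite (le_trans (ler_normB _ _))// lerD.
    rewrite mulr0 add0r.
    have -> : h v = \int[P]_w (f (W (N t) v w) - f (V v w)) + (\int[P]_w f (V v w) - l).
      rewrite /h RintegralB//; [|exact: bmf_P|by apply: bmf_P; exact: bmf_cst].
      rewrite RintegralB//; [|exact: bmf_P|exact: bmf_P].
      have PT : fine (P setT) = 1 by rewrite probability_setT.
      by rewrite Rintegral_cst// [X in _ - _ * X]PT mulr1; ring.
    rewrite (le_trans (ler_normD _ _))// lerD//; last first.
      rewrite distrC; apply: hA; move: vA; rewrite notin_setE/= in_itv/= v0/=.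
      by move=> /negP; rewrite -ltNge /A gt_max => /andP[].
    apply: Rexp_le_prob; [exact: bmfB|exact: measurable_late|].
    move=> w; rewrite indicE; case: (boolP (w \in _)) => [_|/negP wl].
      by rewrite mulr1 (le_trans (ler_normB _ _))// mulr2n mulrDl mul1r lerD.
    have : ~~ ((S (N t) w <= t) || (alpha (N t) w <= t)).
      by apply/negP => h'; apply: wl; rewrite inE.
    rewrite negb_or -!ltNge => /andP[_ al].
    have -> : V v w = W (N t) v w by apply: VW; [exact: ltW|exact: le_lt_trans al].
    by rewrite subrr normr0 mulr0.
  apply: (@le_trans _ _ (\int[mu]_(v in `]0%R, t]) `|h v|)).
    by apply: le_normr_Rintegral => //; exact: int.
  apply: (@le_trans _ _ (\int[mu]_(v in `]0%R, t]) (D * \1_(`]0%R, A]%classic) v + c))).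
    apply: le_Rintegral => //.
    - apply: int; split; first by apply: measurableT_comp => //; exact: bh.1.
      by have [M' hM'] := bh.2; exists M' => v; rewrite normr_id.
    - by apply: int; apply: bmfD => //; exact: bmf_cst.
  rewrite RintegralD//; [|exact: int|by apply: int; exact: bmf_cst].
  have mut : fine (mu `]0%R, t]%classic) = t.
    by rewrite lebesgue_measure_itv/= lte_fin t0/= oppr0 addr0.
  rewrite Rintegral_cst// [X in _ + _ * X <= _]mut.
  have i1 : \int[mu]_(v in `]0%R, t]) (D * \1_(`]0%R, A]%classic) v) <= D * A.
    rewrite RintegralZl//; last by apply: int; exact: bmf_indic.
    rewrite ler_wpM2l// /Rintegral integral_indic//.
    have muA : (mu `]0%R, A]%classic = A%:E)%E.
      rewrite lebesgue_measure_itv/= lte_fin; case: ltP; rewrite ?oppr0 ?addr0 ?adde0// => A0'.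
      by congr (_%:E); apply/eqP; rewrite eq_le A0' A_ge0.
    have le1 : (mu (`]0%R, A]%classic `&` `]0%R, t]%classic) <= A%:E)%E.
      by rewrite -muA; apply: le_measure; rewrite ?inE//; exact: measurableI.
    by rewrite -[leRHS]/(fine A%:E) fine_le// ge0_fin_numE// (le_lt_trans le1)// ltry.
  have i2 : 2 * M * fine (P (late (N t) t)) * t <= 2 * M.
    rewrite -mulrA -[leRHS]mulr1 ler_wpM2l ?mulr_ge0// mulrC.
    exact: lateN.
  by rewrite /c mulrDl -!addrA lerD// lerD.
exists (Num.max 1 (2 * (D * A + 2 * M) / e)); split; first exact: num_real.
move=> t; rewrite gt_max => /andP[t1 t2].
have t0 : 0 < t by exact: lt_trans t1.
have := bound t t0.
set E := ED _ _ _ => hE.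
have -> : l - E / t = - ((E - l * t) / t).
  by rewrite mulrBl mulfK ?gt_eqF//; ring.
rewrite normrN normrM normfV (gtr0_norm t0) ler_pdivrMr//.
apply: (le_trans hE).
move: t2; rewrite ltr_pdivrMr// => t2.
by apply: half_bound; rewrite [e * t]mulrC.
Qed.

(** * Balances as linear relations between averages of damped functions *)

Section damped_balance.
Variable N : R -> nat.
Hypothesis lateN : forall t : R, 0 <= t -> t * fine (P (late (N t) t)) <= 1.

Definition mean_at (g : R -> R) (t : R) : R := ED P t (fun p => g (W (N t) p.2 p.1)) / t.
Definition mean_on (g : R -> R) (t : R) : R :=
  ED P t (fun p => g (W (N t) p.2 p.1) * O1 p) / t.

Let bW (g : R -> R) (t : R) : bmf g -> bmf (fun p : T * R => g (W (N t) p.2 p.1)).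
Proof. by move=> bg; exact: bmf_W. Qed.

Let bWO (g : R -> R) (t : R) : bmf g -> bmf (fun p : T * R => g (W (N t) p.2 p.1) * O1 p).
Proof. by move=> bg; apply: bmfM; [exact: bmf_W|exact: bmf_server]. Qed.

Lemma mean_at_lin (g g1 g2 g3 : R -> R) (c1 c2 c3 t : R) : 0 <= t ->
  bmf g1 -> bmf g2 -> bmf g3 ->
  (forall x, 0 <= x -> g x = c1 * g1 x + c2 * g2 x + c3 * g3 x) ->
  mean_at g t = c1 * mean_at g1 t + c2 * mean_at g2 t + c3 * mean_at g3 t.
Proof.
move=> t0 b1 b2 b3 gE; rewrite /mean_at !mulrA -!mulrDl; congr (_ / _).
have bc (c : R) (g' : R -> R) : bmf g' -> bmf (fun p : T * R => c * g' (W (N t) p.2 p.1)).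
  by move=> bg; apply: bmfM; [exact: bmf_cst|exact: bW].
rewrite -(EDZ P c1 t0 (bW t b1)) -(EDZ P c2 t0 (bW t b2)) -(EDZ P c3 t0 (bW t b3)).
rewrite -EDD//; [|exact: bc..]; rewrite -EDD//; [|by apply: bmfD; exact: bc|exact: bc].
by apply: eq_ED => w v _ /=; rewrite gE// wl_ge0.
Qed.

Lemma mean_on_lin (g g1 g2 g3 : R -> R) (c1 c2 c3 t : R) : 0 <= t ->
  bmf g1 -> bmf g2 -> bmf g3 ->
  (forall x, 0 <= x -> g x = c1 * g1 x + c2 * g2 x + c3 * g3 x) ->
  mean_on g t = c1 * mean_on g1 t + c2 * mean_on g2 t + c3 * mean_on g3 t.
Proof.
move=> t0 b1 b2 b3 gE; rewrite /mean_on !mulrA -!mulrDl; congr (_ / _).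
have bc (c : R) (g' : R -> R) : bmf g' ->
    bmf (fun p : T * R => c * (g' (W (N t) p.2 p.1) * O1 p)).
  by move=> bg; apply: bmfM; [exact: bmf_cst|exact: bWO].
rewrite -(EDZ P c1 t0 (bWO t b1)) -(EDZ P c2 t0 (bWO t b2)) -(EDZ P c3 t0 (bWO t b3)).
rewrite -EDD//; [|exact: bc..]; rewrite -EDD//; [|by apply: bmfD; exact: bc|exact: bc].
apply: eq_ED => w v _ /=; rewrite gE ?wl_ge0//; ring.
Qed.

Lemma mean_switch_integrand (f : R -> R) (t : R) : 0 <= t -> bmf f ->
  ED P t (switch_integrand f (N t)) / t =
  - con * mean_on f t + coff * (mean_at f t - mean_on f t)
    - lam * (mean_at (jump_mean f) t - mean_on (jump_mean f) t).
Proof.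
move=> t0 bf; have bj := bmf_jump_mean bf.
have -> : ED P t (switch_integrand f (N t)) =
    - (con + coff) * ED P t (fun p => f (W (N t) p.2 p.1) * O1 p) +
    coff * ED P t (fun p => f (W (N t) p.2 p.1)) -
    lam * (ED P t (fun p => jump_mean f (W (N t) p.2 p.1)) -
           ED P t (fun p => jump_mean f (W (N t) p.2 p.1) * O1 p)).
  rewrite -EDB//; [|exact: bW|exact: bWO].
  rewrite -!EDZ//; first last;
    try by first [exact: bW|exact: bWO|apply: bmfB; [exact: bW|exact: bWO]].
  have bc (c : R) g : bmf g -> bmf (fun p : T * R => c * g p).
    by move=> bg; apply: bmfM => //; exact: bmf_cst.
  rewrite -EDD//; [|by apply: bc; exact: bWO|by apply: bc; exact: bW].
  rewrite -EDB//; last 2 first.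
  - by apply: bmfD; apply: bc; [exact: bWO|exact: bW].
  - by apply: bc; apply: bmfB; [exact: bW|exact: bWO].
  by apply: eq_ED => w v _; rewrite /switch_integrand/=; ring.
by rewrite /mean_at /mean_on; ring.
Qed.

Section damped_parameters.
Variables (a b : R).
Hypothesis a0 : 0 <= a.

Definition service_cos : R := \int[P]_w dcos a b (X (ib 0%N) w).
Definition service_sin : R := \int[P]_w dsin a b (X (ib 0%N) w).
Definition service_exp : R := \int[P]_w dcos 1 0 (X (ib 0%N) w).

Let bB (a' b' : R) : 0 <= a' -> bmf (fun w => dcos a' b' (X (ib 0%N) w)).
Proof.
move=> a'0; have := bmf_comp (bmf_pcomb b' a'0 1 0 0) (measurable_X (ib 0%N)).
congr (bmf _); apply/funext => w.
by rewrite /pcomb /comb/= max_r ?X0// mul1r !mul0r !addr0.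
Qed.

Let bB' : bmf (fun w => dsin a b (X (ib 0%N) w)).
Proof.
have := bmf_comp (bmf_pcomb b a0 0 1 0) (measurable_X (ib 0%N)).
congr (bmf _); apply/funext => w.
by rewrite /pcomb /comb/= max_r ?X0// mul1r !mul0r addr0 add0r.
Qed.

(** In complex form, averaging over a service multiplies exp(-s x) by the transform of the service
    time. The coefficients are those of c1 times the real part plus c2 times the imaginary part of
    that product, minus the original. *)
Lemma jump_mean_pcomb c1 c2 c3 x : 0 <= x ->
  jump_mean (pcomb a b c1 c2 c3) x =
  (c1 * (service_cos - 1) + c2 * service_sin) * pcomb a b 1 0 0 x +
  (c2 * (service_cos - 1) - c1 * service_sin) * pcomb a b 0 1 0 x +
  c3 * (service_exp - 1) * pcomb a b 0 0 1 x.
Proof.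
move=> xge0; rewrite /jump_mean.
have bc (c : R) g : bmf g -> bmf (fun w : T => c * g w).
  by move=> bg; apply: bmfM => //; exact: bmf_cst.
have b1 := bB b a0; have b3 := bB 0 (@ler01 R).
have -> : after_arrival (pcomb a b c1 c2 c3) x =
    (c1 * dcos a b x + c2 * dsin a b x) * service_cos +
    (c2 * dcos a b x - c1 * dsin a b x) * service_sin + c3 * dcos 1 0 x * service_exp.
  rewrite /service_cos /service_sin /service_exp -!RintegralZl//; try exact: bmf_P.
  rewrite -RintegralD//; [|by apply: bmf_P; exact: bc..].
  rewrite -RintegralD//; [|by apply: bmf_P; apply: bmfD; exact: bc|by apply: bmf_P; exact: bc].
  apply: eq_Rintegral => w _; rewrite /pcomb /comb max_r; last by rewrite addr_ge0// X0.
  rewrite !dcosD dsinD [dsin 1 0 _]/dsin mul0r sin0 mulr0 oppr0 mul0r subr0; ring.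
by rewrite /pcomb max_r// /comb; ring.
Qed.

Local Notation z1 := (mean_at (pcomb a b 1 0 0)).
Local Notation z2 := (mean_at (pcomb a b 0 1 0)).
Local Notation ze := (mean_at (pcomb a b 0 0 1)).
Local Notation o1 := (mean_on (pcomb a b 1 0 0)).
Local Notation o2 := (mean_on (pcomb a b 0 1 0)).
Local Notation oe := (mean_on (pcomb a b 0 0 1)).

Lemma damped_switch c1 c2 c3 : exists C, forall t : R, 1 <= t ->
  `|- con * (c1 * o1 t + c2 * o2 t + c3 * oe t) +
    coff * (c1 * (z1 t - o1 t) + c2 * (z2 t - o2 t) + c3 * (ze t - oe t)) -
    lam * ((c1 * (service_cos - 1) + c2 * service_sin) * (z1 t - o1 t) +
           (c2 * (service_cos - 1) - c1 * service_sin) * (z2 t - o2 t) +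
           c3 * (service_exp - 1) * (ze t - oe t))| <= C / t.
Proof.
pose f := pcomb a b c1 c2 c3; pose M := `|c1| + `|c2| + `|c3|.
have bf : bmf f by exact: bmf_pcomb.
have fM x : `|f x| <= M by exact: pcomb_bound.
have M0 : 0 <= M by exact: le_trans (fM 0).
have b1 := bmf_pcomb b a0 1 0 0; have b2 := bmf_pcomb b a0 0 1 0.
have b3 := bmf_pcomb b a0 0 0 1.
exists (3 * M + 2 * (con + coff + 2 * lam) * M) => t t1.
have t0 : 0 < t by exact: lt_le_trans t1.
have t0' := ltW t0.
have := switch_balance (N t) t0' bf fM.
have c0 : 0 <= 2 * (con + coff + 2 * lam) * M.
  rewrite mulr_ge0// mulr_ge0//.
  have := ltW con0; have := ltW coff0; have := ltW lam0; lra.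
have h := ler_wpM2l c0 (lateN t0').
rewrite mulr1 in h.
move=> /le_trans => /(_ _ (lerD (lexx _) h)) h'.
rewrite ler_pdivlMr//; apply: le_trans h'.
rewrite le_eqVlt; apply/orP; left; apply/eqP.
have -> : ED P t (switch_integrand f (N t)) = ED P t (switch_integrand f (N t)) / t * t.
  by rewrite divfK// gt_eqF.
rewrite normrM (gtr0_norm t0); congr (`|_| * _); apply/esym.
rewrite mean_switch_integrand//.
rewrite (@mean_at_lin f _ _ _ c1 c2 c3 t t0' b1 b2 b3 (fun x _ => pcombE a b c1 c2 c3 x)).
rewrite (@mean_on_lin f _ _ _ c1 c2 c3 t t0' b1 b2 b3 (fun x _ => pcombE a b c1 c2 c3 x)).
rewrite (@mean_at_lin (jump_mean f) _ _ _ _ _ _ t t0' b1 b2 b3 (@jump_mean_pcomb c1 c2 c3)).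
rewrite (@mean_on_lin (jump_mean f) _ _ _ _ _ _ t t0' b1 b2 b3 (@jump_mean_pcomb c1 c2 c3)).
ring.
Qed.

Lemma damped_drift c1 c2 c3 : - a * c1 - b * c2 - c3 = 0 -> exists C, forall t : R, 1 <= t ->
  `|lam * ((c1 * (service_cos - 1) + c2 * service_sin) * z1 t +
           (c2 * (service_cos - 1) - c1 * service_sin) * z2 t +
           c3 * (service_exp - 1) * ze t) -
    ((- a * c1 - b * c2) * o1 t + (b * c1 - a * c2) * o2 t - c3 * oe t)| <= C / t.
Proof.
move=> c0.
pose f := pcomb a b c1 c2 c3; pose M := `|c1| + `|c2| + `|c3|.
pose g := pcomb a b (- a * c1 - b * c2) (b * c1 - a * c2) (- c3).
have bf : bmf f by exact: bmf_pcomb.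
have bg : bmf g by exact: bmf_pcomb.
have fM x : `|f x| <= M by exact: pcomb_bound.
have M0 : 0 <= M by exact: le_trans (fM 0).
have b1 := bmf_pcomb b a0 1 0 0; have b2 := bmf_pcomb b a0 0 1 0.
have b3 := bmf_pcomb b a0 0 0 1.
exists (2 * M + lam * (2 * M)) => t t1.
have t0 : 0 < t by exact: lt_le_trans t1.
have t0' := ltW t0.
have := drift_balance (N t) t0' bf bg fM (@pcomb_max _ a b c1 c2 c3)
  (@pcomb_max _ a b _ _ _) (fun x y => pcomb_quad a0 x y c0) (@pcomb_lip _ a b a0 c1 c2 c3).
have h : lam * (2 * M * (t * fine (P (late (N t) t)))) <= lam * (2 * M).
  by rewrite ler_wpM2l ?(ltW lam0)// -[leRHS]mulr1 ler_wpM2l ?mulr_ge0// lateN.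
move=> /le_trans => /(_ _ (lerD (lexx _) h)).
rewrite ler_pdivlMr// => h'; apply: le_trans h'.
rewrite le_eqVlt; apply/orP; left; apply/eqP.
rewrite -[X in _ * X = _](gtr0_norm t0) -normrM; congr `|_|.
have -> : ED P t (fun p => jump_mean f (W (N t) p.2 p.1)) = mean_at (jump_mean f) t * t.
  by rewrite divfK// gt_eqF.
have -> : ED P t (fun p => g (W (N t) p.2 p.1) * O1 p) = mean_on g t * t.
  by rewrite divfK// gt_eqF.
rewrite (@mean_at_lin (jump_mean f) _ _ _ _ _ _ t t0' b1 b2 b3 (@jump_mean_pcomb c1 c2 c3)).
rewrite (@mean_on_lin g _ _ _ _ _ _ t t0' b1 b2 b3 (fun x _ => pcombE a b _ _ _ x)).
ring.
Qed.

End damped_parameters.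
End damped_balance.

(** * Passage to the limit in law *)

Section stationary.
Variables (V : R -> T -> R) (L : (R -> R) -> R).
Hypothesis mV : forall v, measurable_fun setT (V v).
Hypothesis VW : forall n (v : R) w, 0 <= v -> v < alpha n w -> V v w = W n v w.
Hypothesis cvgL : forall f : R -> R, continuous f ->
  (exists M, forall x, `|f x| <= M) ->
  (\int[P]_w f (V v w)) @[v --> +oo] --> L f.

Lemma service_exp_le1 : 0 <= lam * (1 - service_exp).
Proof.
rewrite mulr_ge0 ?(ltW lam0)// subr_ge0 /service_exp.
have b1 : bmf (fun w => dcos 1 0 (X (ib 0%N) w)).
  have := bmf_comp (bmf_pcomb 0 (@ler01 R) 1 0 0) (measurable_X (ib 0%N)).
  congr (bmf _); apply/funext => w.
  by rewrite /pcomb /comb/= max_r ?X0// mul1r !mul0r !addr0.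
apply: le_trans (ler_norm _) _; apply: Rexp_bound => // w.
by apply: dcos_bound => //; exact: X0.
Qed.

Lemma stationary_equations : exists kappa, forall a b : R, 0 <= a ->
  let x := lam * (1 - service_cos a b) in let y := - lam * service_sin a b in
  let Z1 := L (pcomb a b 1 0 0) in let Z2 := L (pcomb a b 0 1 0) in
  let m := con + coff + x in let n := coff + x in
  let pr := a * n - b * y - (x * m - y * y) in
  let pi := a * y + b * n - (x * y + y * m) in
  pr * Z1 - pi * Z2 = (m * a - y * b) * kappa /\
  pr * Z2 + pi * Z1 = (m * b + y * a) * kappa.
Proof.
have /choice[N hN] : forall t : R, exists N, 0 <= t -> t * fine (P (late N t)) <= 1.
  move=> t; have [t0|t0] := leP 0 t.
    by have [N hN] := exists_late t0; exists N.
  by exists 0%N.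
pose l1 := lam * (1 - service_exp).
(* The function exp(-x) involves neither a nor b; writing it with parameters 0, 0 gives one witness
   for all s. *)
exists (((coff + l1) / (con + coff + l1) - l1) * L (pcomb 0 0 0 0 1)).
move=> a b a0 x y Z1 Z2 m n pr pi.
have lim c1 c2 c3 : mean_at N (pcomb a b c1 c2 c3) t @[t --> +oo] --> L (pcomb a b c1 c2 c3).
  apply: (@cesaro_W V (pcomb a b c1 c2 c3) (`|c1| + `|c2| + `|c3|)) => //.
  - exact: bmf_pcomb.
  - by move=> z; exact: pcomb_bound.
  - apply: cvgL; first exact: pcomb_continuous.
    by exists (`|c1| + `|c2| + `|c3|) => z; exact: pcomb_bound.
have eE : pcomb a b 0 0 1 = pcomb 0 0 0 0 1.
  by apply/funext => z; rewrite /pcomb /comb !mul0r.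
have n1 := damped_switch hN b a0 1 0 0.
have n2 := damped_switch hN b a0 0 1 0.
have n3 := damped_switch hN b a0 0 0 1.
(* The coefficients (1, 0, -a) and (0, 1, -b) are the real and imaginary parts of exp(-s x) - s
   exp(-x), with s = a + i b. *)
have c4 : - a * 1 - b * 0 - (- a) = 0 by ring.
have n4 := damped_drift hN a0 c4.
have c5 : - a * 0 - b * 1 - (- b) = 0 by ring.
have n5 := damped_drift hN a0 c5.
have c0 : 0 < con + coff + l1.
  by rewrite ltr_wpDr ?addr_gt0// service_exp_le1.
apply: (@balance_limit R con coff a b x y l1 Z1 Z2 (L (pcomb 0 0 0 0 1))
  (mean_at N (pcomb a b 1 0 0)) (mean_at N (pcomb a b 0 1 0))
  (mean_on N (pcomb a b 1 0 0)) (mean_on N (pcomb a b 0 1 0))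
  (mean_at N (pcomb a b 0 0 1)) (mean_on N (pcomb a b 0 0 1)) c0).
- move: n1; congr negl; apply/funext => t; rewrite /x /y; ring.
- move: n2; congr negl; apply/funext => t; rewrite /x /y; ring.
- move: n3; congr negl; apply/funext => t; rewrite /l1; ring.
- move: n4; congr negl; apply/funext => t; rewrite /x /y /l1; ring.
- move: n5; congr negl; apply/funext => t; rewrite /x /y /l1; ring.
- exact: lim.
- exact: lim.
- by rewrite -eE; exact: lim.
Qed.

End stationary.

End model.

(** Convergence is not assumed, because on a null set the raw primitives may be negative. A
    divergent [limn] takes the default value [point], hence the case split on equality of the lower
    and upper limits. *)
Lemma measurable_limn d (T : measurableType d) (R : realType)
    (s : nat -> T -> \bar R) :
  (forall n, measurable_fun setT (s n)) ->
  measurable_fun setT (fun w => limn (s ^~ w)).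
Proof.
move=> ms.
have msup : measurable_fun setT (fun w => limn_esup (s ^~ w)).
  exact: measurable_fun_limn_esup.
have minf : measurable_fun setT (fun w => limn_einf (s ^~ w)).
  have -> : (fun w => limn_einf (s ^~ w)) = (fun w => - limn_esup (fun n => - s n w))%E.
    apply/funext => w; rewrite -[LHS]oppeK; congr (- _)%E.
    by rewrite -[in LHS](limn_esupN (s ^~ w)).
  apply: measurableT_comp => //.
  by apply: (@measurable_fun_limn_esup _ _ _ _ (fun n w => - s n w)%E) => // n; exact: measurableT_comp.
apply: (eq_measurable_fun (fun w => if limn_einf (s ^~ w) == limn_esup (s ^~ w)
  then limn_esup (s ^~ w) else point)).
  move=> w _; case: ifPn => [/eqP e|ne].
    suff : s ^~ w @ \oo --> limn_esup (s ^~ w) by move/cvg_lim => ->.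
    apply: (@squeeze_cvge _ _ _ _ (einfs (s ^~ w)) (s ^~ w) (esups (s ^~ w))).
    - near=> n; apply/andP; split.
        by apply: ereal_inf_lbound; exists n => //=.
      by apply: ereal_sup_ubound; exists n => //=.
    - rewrite -e limn_einf_lim; exact: is_cvg_einfs.
    - rewrite limn_esup_lim; exact: is_cvg_esups.
  apply/esym/dvgP => cv; move: ne.
  by rewrite is_cvg_limn_einfE// is_cvg_limn_esupE// eqxx.
apply: measurable_fun_ifT => //.
exact: measurable_fun_eqe.
Unshelve. all: by end_near. Qed.

(** * The polling model *)

Section workload.
Context (R : realType).
Notation mu := (@lebesgue_measure R).

Definition remaining (C : R -> R) (a b : nat -> R) (x0 : R) (n : nat) (t : R) : R :=
  Num.min (b n) (Num.max 0 (level C a b x0 n.+1 - C t)).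

Definition work (C : R -> R) (a b : nat -> R) (x0 t : R) : R :=
  Num.max 0 (x0 - C t) +
  fine (\sum_(n <oo | (epoch a n.+1 <= t)%R) (remaining C a b x0 n t)%:E)%E.

Section nonnegative.
Variables (C : R -> R) (a b : nat -> R) (x0 : R).
Hypothesis a0 : forall k, 0 <= a k.
Hypothesis b0 : forall k, 0 <= b k.
Hypothesis C_le : forall u v, 0 <= u -> u <= v -> C u <= C v.

Lemma remaining_ge0 n t : 0 <= remaining C a b x0 n t.
Proof. by rewrite le_min b0 le_max lexx. Qed.

Lemma work_ge0 t : 0 <= work C a b x0 t.
Proof.
rewrite addr_ge0 ?le_max ?lexx// fine_ge0//.
by apply: nneseries_ge0 => n _ _; rewrite lee_fin remaining_ge0.
Qed.

(** If the queue is empty when customer n arrives, the earlier work is still gone at t because the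
    clock is monotone; otherwise the new level is the old one plus [b n]. Either way the positive
    part of level minus clock splits into earlier work and the remaining service of that
    customer. *)
Lemma wl_sum n t :
  wl C a b x0 n t = Num.max 0 (x0 - C t) +
    \sum_(k < n) (if epoch a k.+1 <= t then remaining C a b x0 k t else 0).
Proof.
elim: n => [|n IH]; first by rewrite big_ord0 addr0.
rewrite big_ord_recr/= addrA -IH; case: ifPn => At; last by rewrite addr0.
have At' : epoch a n <= t by apply: le_trans At; exact: epoch_le.
have CAt : C (epoch a n.+1) <= C t by apply: C_le => //; exact: epoch_ge0.
rewrite (wlE _ _ _ At') /remaining/=.
have bn := b0 n.
case: (leP (level C a b x0 n) (C (epoch a n.+1))) => h1;
  case: (leP 0 (level C a b x0 n - C t)) => h2;
  match goal with |- context [Num.max 0 ?x] => case: (leP 0 x) => h3 end;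
  match goal with |- context [Num.min ?x ?y] => case: (leP x y) => h4 end; lra.
Qed.

Lemma work_wl n t : t < epoch a n -> work C a b x0 t = wl C a b x0 n t.
Proof.
move=> tn; rewrite wl_sum /work; congr (_ + _).
rewrite (_ : (\sum_(k <oo | (epoch a k.+1 <= t)%R) _)%E =
  (\sum_(k < n) (if epoch a k.+1 <= t then remaining C a b x0 k t else 0))%:E)//.
apply: lim_near_cst => //; exists n => // m /= nm.
rewrite big_mkcond big_mkord/= -(subnKC nm).
rewrite -(big_mkord xpredT (fun k => if epoch a k.+1 <= t then (remaining C a b x0 k t)%:E else 0%E)).
rewrite (big_cat_nat (n := n))//= ?leq_addr//.
rewrite [X in (_ + X)%E](_ : _ = 0%E) ?adde0; last first.
  rewrite big_nat_cond big1// => k /andP[/andP[nk _] _].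
  by rewrite leNgt (lt_le_trans tn)//; apply: epoch_le => //; exact: leqW.
rewrite big_mkord -sumEFin; apply: eq_bigr => k _.
by case: ifP.
Qed.

End nonnegative.

Lemma measurable_work d (Y : measurableType d) (on : nat -> bool)
    (a b r : nat -> Y -> R) (x0 t : R) :
  (forall k, measurable_fun setT (a k)) -> (forall k, measurable_fun setT (b k)) ->
  (forall k, measurable_fun setT (r k)) ->
  measurable_fun setT
    (fun y => work (clk (server on (r ^~ y))) (a ^~ y) (b ^~ y) x0 t).
Proof.
move=> ma mb mr.
have mC : measurable_fun setT (fun y => clk (server on (r ^~ y)) t).
  exact: (measurable_clk_server on mr (measurable_cst t)).
apply: measurable_funD.
  by apply: measurable_maxr => //; exact: measurable_funB.
apply: measurableT_comp => //.
apply: (@measurable_limn _ Y R) => n.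
under eq_fun do rewrite big_mkcond/=.
apply: emeasurable_sum => k.
apply: measurable_fun_ifT => //.
  by apply: measurable_fun_ler => //; exact: measurable_epoch.
apply/measurable_EFinP; apply: measurable_minr => //.
apply: measurable_maxr => //; apply: measurable_funB => //.
exact: measurable_level.
Qed.

End workload.

(** * Reduction to everywhere nonnegative primitives *)

Section positive_part.
Context d (T : measurableType d) (R : realType) (P : probability T R).

Lemma preimage_max0 (E : set R) : measurable E ->
  measurable ((fun x : R => Num.max 0 x) @^-1` E).
Proof.
move=> mE; rewrite -[X in measurable X]setTI.
by apply: measurable_maxr.
Qed.

Lemma exponential_prob_max0 (rate : R) (E : set R) :
  exponential_prob rate ((fun x : R => Num.max 0 x) @^-1` E) = exponential_prob rate E.
Proof.
rewrite /exponential_prob integral_mkcond [RHS]integral_mkcond.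
apply: eq_integral => x _; rewrite !patchE.
have [x0|x0] := ltP x 0.
  by rewrite lt0_exponential_pdf//; case: ifP => _; case: ifP.
congr (if _ then _ else _); apply/idP/idP; rewrite !inE /= max_r//.
Qed.

Lemma exponential_rv_ge0 (X : {RV P >-> R}) rate : exponential_rv X rate ->
  {ae P, forall w, 0 <= X w}.
Proof.
move=> Xr; exists (X @^-1` `]-oo, 0[%classic); split.
- by rewrite -[X in measurable X]setTI; apply: measurable_funP => //; exact: measurable_itv.
- rewrite Xr; last exact: measurable_itv.
  rewrite /exponential_prob integral0_eq// => x; rewrite /= in_itv/= => x0.
  by rewrite lt0_exponential_pdf.
- by move=> w /= /negP; rewrite -ltNge in_itv.
Qed.

End positive_part.

Section link.
Context d (T : measurableType d) (R : realType) (P : probability T R).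
Variable (M : polling_model P).

Notation index := ((queue * nat) + (queue * nat) + (queue * nat))%type.

Definition primitive (j : index) : {RV P >-> R} :=
  match j with
  | inl (inl (i, k)) => interarrival M i k
  | inl (inr (i, k)) => service M i k
  | inr (i, k) => residing M i k
  end.

(** The primitives are nonnegative almost surely, whereas the path lemmas require it everywhere.
    Positive parts keep the independence, the exponential laws and the common service law, and alter
    the workload on a null set only. *)
Definition pospart (j : index) (w : T) : R := Num.max 0 (primitive j w).

Lemma measurable_pospart j : measurable_fun setT (pospart j).
Proof. by apply: measurable_maxr => //. Qed.

HB.instance Definition _ j :=
  isMeasurableFun.Build _ _ _ _ (pospart j) (measurable_pospart j).

Definition Xpos (j : index) : {RV P >-> R} := pospart j.

Lemma preimage_pospart j (E : set R) :
  Xpos j @^-1` E = primitive j @^-1` ((fun x : R => Num.max 0 x) @^-1` E).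
Proof. by []. Qed.

Lemma pospart_independent : mutually_independent Xpos.
Proof.
move=> s E us mE.
exact: (primitives_independent M us (fun j => preimage_max0 (mE j))).
Qed.

Lemma pospart_exponential j rate : exponential_rv (primitive j) rate ->
  exponential_rv (Xpos j) rate.
Proof.
move=> h E mE; rewrite preimage_pospart h ?exponential_prob_max0//.
exact: preimage_max0.
Qed.

Lemma primitive_ge0 j : {ae P, forall w, 0 <= primitive j w}.
Proof.
case: j => [[[i k]|[i k]]|[i k]] /=.
- exact: exponential_rv_ge0 (interarrival_law M i k).
- by apply: filterS (service_gt0 M i k) => w; exact: ltW.
- exact: exponential_rv_ge0 (residing_law M i k).
Qed.

(** The index type is countable, so the exceptional sets are collected along [unpickle]. *)
Lemma primitives_ge0 : {ae P, forall w, forall j, 0 <= primitive j w}.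
Proof.
have h (n : nat) : {ae P, forall w, if (unpickle n : option index) is Some j
    then 0 <= primitive j w else true}.
  case: (unpickle n) => [j|]; first exact: primitive_ge0.
  exact: aeW.
apply: filterS (ae_foralln h) => w hw j.
by have := hw (pickle j); rewrite pickleK.
Qed.

Section queue.
Variable i : queue.

Let ia k : index := inl (inl (i, k)).
Let ib k : index := inl (inr (i, k)).
Let ir m : index := inr (visited M m, m./2).
Let on m := visited M m == i.

Lemma workloadE t w : workload M i t w =
  work (clk (server on (fun m => primitive (ir m) w)))
    (fun k => primitive (ia k) w) (fun k => primitive (ib k) w) (backlog M i) t.
Proof.
have serverE : server_at M i w = server on (fun m => primitive (ir m) w).
  rewrite /server_at /server; apply: eq_bigcupl; split=> m /=; rewrite /on.
    by move=> ->.
  by move=> /eqP.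
have clockE u : clock M i u w = clk (server on (fun m => primitive (ir m) w)) u.
  by rewrite /clock serverE.
have levelE n : completion M i n w =
    level (clk (server on (fun m => primitive (ir m) w))) (fun k => primitive (ia k) w)
      (fun k => primitive (ib k) w) (backlog M i) n.+1.
  by elim: n => [|n IH] /=; rewrite clockE// IH.
rewrite /workload /work clockE; congr (_ + fine _).
apply: eq_eseriesr => n _; congr EFin.
by rewrite /remaining_service /remaining levelE clockE.
Qed.

Definition poswork (t : R) (w : T) : R :=
  work (clk (server on (fun m => Xpos (ir m) w)))
    (fun k => Xpos (ia k) w) (fun k => Xpos (ib k) w) (backlog M i) t.

Lemma measurable_workload t : measurable_fun setT (workload M i t).
Proof.
apply: (eq_measurable_fun _ (fun w _ => esym (workloadE t w))).
by apply: (@measurable_work _ _ T on (fun k => primitive (ia k))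
  (fun k => primitive (ib k)) (fun m => primitive (ir m))).
Qed.

Lemma measurable_poswork t : measurable_fun setT (poswork t).
Proof.
by apply: (@measurable_work _ _ T on (fun k => Xpos (ia k))
  (fun k => Xpos (ib k)) (fun m => Xpos (ir m))).
Qed.

Lemma workload_poswork t : {ae P, forall w, workload M i t w = poswork t w}.
Proof.
apply: filterS primitives_ge0 => w w0; rewrite workloadE /poswork.
have E j : primitive j w = Xpos j w by apply/esym/max_r; exact: w0.
have Ea (idx : nat -> index) :
    (fun k => primitive (idx k) w) = (fun k => Xpos (idx k) w).
  by apply/funext => k; exact: E.
by rewrite !Ea.
Qed.

End queue.
End link.

(** * Balance equations for the limit law *)

Section steady_state.
Context d d' (T : measurableType d) (T' : measurableType d') (R : realType).
Variables (P : probability T R) (P' : probability T' R) (M : polling_model P).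
Variables (i : queue) (V : {RV P' >-> R}).
Hypothesis VM : steady_state_workload M i V.

Let con := c M i.
Let coff := c M (~~ i).
Let lam := lambda M i.
Let B (w : T) : R := Xpos M (inl (inr (i, 0%N))) w.

Lemma expectation_poswork (f : R -> R) t : continuous f -> (exists K, forall x, `|f x| <= K) ->
  ('E_P[f \o workload M i t] = (\int[P]_w f (poswork M i t w))%:E)%E.
Proof.
move=> cf [K fK].
have mf : measurable_fun setT f by exact: continuous_measurable_fun.
have bf : bmf (fun w => f (poswork M i t w)).
  split; first by apply: measurableT_comp => //; exact: measurable_poswork.
  by exists K => w; exact: fK.
rewrite -Rexp_EFin// unlock; apply: ae_eq_integral => //.
- apply/measurable_EFinP; apply: (measurableT_comp mf); exact: measurable_workload.
- by apply/measurable_EFinP; exact: bf.1.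
- by apply: filterS (workload_poswork M i t) => w /= -> _.
Qed.

Lemma steady_state_cvg (f : R -> R) : continuous f -> (exists K, forall x, `|f x| <= K) ->
  (\int[P]_w f (poswork M i t w)) @[t --> +oo] --> \int[P']_w f (V w).
Proof.
move=> cf [K fK].
have bf : [bounded f x | x in [set: R]].
  exists K; split; first exact: num_real.
  by move=> x Kx y _; exact: le_trans (fK y) (ltW Kx).
have := VM cf bf.
have bV : bmf (fun w => f (V w)).
  split; last by exists K => w; exact: fK.
  apply: measurableT_comp; last exact: measurable_funPT.
  exact: continuous_measurable_fun.
have -> : 'E_P'[f \o V]%E = (\int[P']_w f (V w))%:E by rewrite unlock Rexp_EFin.
have -> : (fun t => 'E_P[f \o workload M i t]%E) =
    (fun t => (\int[P]_w f (poswork M i t w))%:E).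
  by apply/funext => t; apply: expectation_poswork => //; exists K.
by move/fine_cvg.
Qed.

Lemma visited_alt m : (visited M m.+1 == i) = ~~ (visited M m == i).
Proof. by rewrite /visited /=; case: (start M); case: (odd m); case: i. Qed.

Lemma balance_equations : exists kappa, forall a b : R, 0 <= a ->
  let x := lam * (1 - \int[P]_w dcos a b (B w)) in
  let y := - lam * \int[P]_w dsin a b (B w) in
  let Z1 := \int[P']_w pcomb a b 1 0 0 (V w) in
  let Z2 := \int[P']_w pcomb a b 0 1 0 (V w) in
  let m := con + coff + x in let n := coff + x in
  let pr := a * n - b * y - (x * m - y * y) in
  let pi := a * y + b * n - (x * y + y * m) in
  pr * Z1 - pi * Z2 = (m * a - y * b) * kappa /\
  pr * Z2 + pi * Z1 = (m * b + y * a) * kappa.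
Proof.
apply: (@stationary_equations _ _ _ _ _ (Xpos M)
  (fun k => inl (inl (i, k))) (fun k => inl (inr (i, k)))
  (fun m => inr (visited M m, m./2)) (fun m => visited M m == i)
  lam con coff (backlog M i) _ _ _ _ _ _ _ _ _ _ _ _ _ _ _
  (poswork M i) (fun f => \int[P']_w f (V w))) => //.
- exact: pospart_independent.
- by move=> j w; rewrite /Xpos /pospart/= le_max lexx.
- by move=> k l [].
- by move=> k l [].
(* The visited queue reveals the parity of the visit number, which together with its half determines
   it. *)
- move=> k l [vkl kl]; rewrite -[k]odd_double_half -[l]odd_double_half kl.
  by congr (nat_of_bool _ + _)%N; apply: (@addbI (start M)); exact: vkl.
- exact: lambda_gt0.
- exact: c_gt0.
- exact: c_gt0.
- by move=> k; apply: pospart_exponential; exact: interarrival_law.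
- move=> m; apply: pospart_exponential.
  have := residing_law M (visited M m) m./2.
  case: eqP => [->//|]; rewrite /coff; by case: (visited M m); case: i.
- move=> k E mE; rewrite !preimage_pospart.
  by apply: service_law; exact: preimage_max0.
- exact: visited_alt.
- by move=> v; exact: measurable_poswork.
- move=> n v w v0 vn; apply: work_wl => //.
  + by move=> k; rewrite /Xpos /pospart le_max lexx.
  + by move=> k; rewrite /Xpos /pospart le_max lexx.
  + by move=> u u' u0 uu'; apply: clk_le => //; exact: measurable_server.
- by move=> f cf bf; exact: steady_state_cvg.
Qed.

(** The limit law is accessible through bounded continuous tests only. The test [f] is positive
    exactly on the negative numbers and vanishes on every workload, so its mean under [V] is 0.
    Nonnegativity is what allows exp(-s V) to be replaced by its truncation [pcomb]. *)
Lemma steady_state_ge0 : {ae P', forall w, 0 <= V w}.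
Proof.
pose f (x : R) := Num.min 1 (Num.max 0 (- x)).
have cf : continuous f.
  move=> x; apply: (@continuous_min _ _ (fun=> 1) (fun y : R => Num.max 0 (- y)) x).
    exact: cvg_cst.
  apply: (@continuous_max _ _ (fun=> 0) (fun y : R => - y) x); first exact: cvg_cst.
  by apply: cvgN; exact: cvg_id.
have f0 x : 0 <= f x by rewrite le_min ler01 le_max lexx.
have f1 x : `|f x| <= 1 by rewrite ger0_norm// ge_min lexx.
have mf : measurable_fun setT f by exact: continuous_measurable_fun.
have bV : bmf (fun w => f (V w)).
  split; last by exists 1 => w; exact: f1.
  by apply: (measurableT_comp mf); exact: measurable_funPT.
have lim0 : \int[P']_w f (V w) = 0.
  have h := steady_state_cvg cf (ex_intro _ 1 f1).
  have e t : \int[P]_w f (poswork M i t w) = 0.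
    rewrite (_ : (fun w => _) = fun=> 0); first by rewrite Rintegral_cst// mul0r.
    apply/funext => w; rewrite /f max_l ?min_r// oppr_le0; apply: work_ge0.
    by move=> k; rewrite /Xpos /pospart le_max lexx.
  move: h; under eq_fun do rewrite e.
  by move=> h; apply: (cvg_unique _ h (cvg_cst _)).
have : (\int[P']_w `|(f (V w))%:E| = 0)%E.
  under eq_integral do rewrite gee0_abs ?lee_fin//.
  by rewrite Rexp_EFin// lim0.
have mE : measurable_fun setT (fun w => (f (V w))%:E).
  by apply/measurable_EFinP; exact: bV.1.
move/(ae_eq_integral_abs P' measurableT mE); apply: filterS => w /(_ I) /= [fV].
rewrite leNgt; apply/negP => V0; move: fV; rewrite /f.
rewrite (@max_r _ _ 0 (- V w)); last by rewrite oppr_ge0 ltW.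
by case: leP; lra.
Qed.

End steady_state.

(** * Transforms *)

Section limits_at_zero.
Context d (T : measurableType d) (R : realType) (P : probability T R).

Lemma dominated_Rcvg (f_ : nat -> T -> R) (f g : T -> R) :
  (forall n, measurable_fun setT (f_ n)) ->
  (forall w, f_ ^~ w @ \oo --> f w) ->
  P.-integrable setT (EFin \o g) -> (forall n w, `|f_ n w| <= g w) ->
  (\int[P]_w f_ n w) @[n --> \oo] --> \int[P]_w f w.
Proof.
move=> mf_ f_f ig f_g.
have mE n : measurable_fun setT (EFin \o f_ n) by exact/measurable_EFinP.
have cE w : setT w -> (fun n => (EFin \o f_ n) w) @ \oo --> (EFin \o f) w.
  by move=> _; apply: cvg_EFin; [exact: nearW|exact: f_f].
have leE n w : setT w -> (`|(EFin \o f_ n) w| <= (EFin \o g) w)%E.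
  by move=> _; rewrite /= lee_fin.
have finE w : setT w -> (EFin \o g) w \is a fin_num by [].
have h := @dominated_cvg _ _ _ P setT measurableT _ (EFin \o f) _ mE cE finE ig leE.
have ig' := integrable_fin_num measurableT ig.
have mf : measurable_fun setT f by apply: measurable_fun_cvg mf_ _ => w _; exact: f_f.
have if_ : P.-integrable setT (EFin \o f).
  apply: (le_integrable measurableT _ _ ig) => //; first exact/measurable_EFinP.
  move=> w _; rewrite /= lee_fin [leRHS]ger0_norm; last exact: le_trans (f_g 0%N w).
  apply: (cvgr_to_le (cvg_norm (f_f w))); apply: nearW => n; exact: f_g.
have e : (\int[P]_w (EFin \o f) w = (\int[P]_w f w)%:E)%E.
  by rewrite /Rintegral fineK//; apply: integrable_fin_num.
by move: h; rewrite e => /fine_cvg.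
Qed.

Lemma pcomb_cos_near (a b x : R) : 0 <= a ->
  `|1 - pcomb a b 1 0 0 x| <= Num.min 2 ((a + `|b|) * Num.max 0 x).
Proof.
move=> a0; have p0 : pcomb a b 1 0 0 0 = 1.
  by rewrite /pcomb /comb maxxx /dcos /dsin !mulr0 expR0 cos0 !mul0r !mulr1 !addr0.
rewrite le_min; apply/andP; split.
  rewrite (le_trans (ler_normB _ _))// normr1 -[leRHS]/(1 + 1) lerD2l.
  by rewrite (le_trans (pcomb_bound b a0 _ _ _ x))// normr1 normr0 !addr0.
have h z : 0 <= z -> `|comb a b (- a * 1 - b * 0) (b * 1 - a * 0) (- 0) z| <= a + `|b|.
  move=> z0; rewrite (le_trans (comb_bound b a0 _ _ _ z0))//.
  by rewrite !mulr0 !subr0 !mulr1 normrN oppr0 normr0 addr0 ger0_norm.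
have := max0_lipschitz (is_derive_comb a b 1 0 0) h 0 (Num.max 0 x).
rewrite -/(pcomb a b 1 0 0 0) -/(pcomb a b 1 0 0 (Num.max 0 x)) p0 pcomb_max.
by rewrite sub0r normrN (ger0_norm (x := Num.max 0 x))// le_max lexx.
Qed.

Lemma pcomb_sin_near (a b x : R) : 0 <= a ->
  `|pcomb a b 0 1 0 x| <= Num.min 2 ((a + `|b|) * Num.max 0 x).
Proof.
move=> a0; have p0 : pcomb a b 0 1 0 0 = 0.
  by rewrite /pcomb /comb maxxx /dcos /dsin !mulr0 sin0 !mul0r !mulr0 oppr0 mulr0 !addr0.
rewrite le_min; apply/andP; split.
  rewrite (le_trans (pcomb_bound b a0 _ _ _ x))// normr1 normr0 add0r addr0; lra.
have h z : 0 <= z -> `|comb a b (- a * 0 - b * 1) (b * 0 - a * 1) (- 0) z| <= a + `|b|.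
  move=> z0; rewrite (le_trans (comb_bound b a0 _ _ _ z0))//.
  by rewrite !mulr0 !sub0r !mulr1 !normrN normr0 addr0 (ger0_norm a0) addrC.
have := max0_lipschitz (is_derive_comb a b 0 1 0) h (Num.max 0 x) 0.
rewrite -/(pcomb a b 0 1 0 0) -/(pcomb a b 0 1 0 (Num.max 0 x)) p0 pcomb_max.
by rewrite !subr0 (ger0_norm (x := Num.max 0 x))// le_max lexx.
Qed.

Lemma bmf_pcomb_RV (V : {RV P >-> R}) (a b c1 c2 c3 : R) : 0 <= a ->
  bmf (fun w => pcomb a b c1 c2 c3 (V w)).
Proof. by move=> a0; apply: (bmf_comp (bmf_pcomb b a0 c1 c2 c3)). Qed.

(** [V] may have infinite mean, so the Lipschitz bound of exp(-s x) is capped at 2 before dominated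
    convergence. The capped bound depends on s only through a + |b|, which makes the estimate
    uniform in direction. *)
Lemma transform_near0 (V : {RV P >-> R}) (e : R) : 0 < e ->
  exists n, forall a b : R, 0 <= a -> a + `|b| <= n.+1%:R^-1 ->
    `|1 - \int[P]_w pcomb a b 1 0 0 (V w)| <= e /\ `|\int[P]_w pcomb a b 0 1 0 (V w)| <= e.
Proof.
move=> e0.
pose f_ n w : R := Num.min 2 (n.+1%:R^-1 * Num.max 0 (V w)).
have f0 n w : 0 <= f_ n w.
  by rewrite le_min ler0n mulr_ge0// le_max lexx.
have f2 n w : `|f_ n w| <= 2 by rewrite ger0_norm// ge_min lexx.
have mf n : measurable_fun setT (f_ n).
  by apply: measurable_minr => //; apply: measurable_funM => //; exact: measurable_maxr.
have bf n : bmf (f_ n) by split; [exact: mf|exists 2].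
have : (\int[P]_w f_ n w) @[n --> \oo] --> \int[P]_w (cst 0 w : R).
  apply: (@dominated_Rcvg f_ (cst 0) (cst 2)) => //; last first.
    by apply: bmf_P; exact: bmf_cst.
  move=> w; rewrite /f_.
  have c1 : (fun n => n.+1%:R^-1 * Num.max 0 (V w)) @ \oo --> (0 : R).
    rewrite -[X in _ --> X](mul0r (Num.max 0 (V w))).
    by apply: cvgMl; exact: cvg_harmonic.
  apply: (@squeeze_cvgr _ _ _ _ (fun=> 0) (fun n => n.+1%:R^-1 * Num.max 0 (V w))) => //.
    apply: nearW => n; rewrite ge_min lexx orbT andbT.
    exact: f0.
  exact: cvg_cst.
rewrite Rintegral_cst// mul0r => /cvgrPdist_le /(_ _ e0) [n _ /(_ n (leqnn n))].
rewrite sub0r normrN => hn; exists n => a b a0 abn.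
have fle w : Num.min 2 ((a + `|b|) * Num.max 0 (V w)) <= f_ n w.
  rewrite le_min ge_min lexx /= ge_min; apply/orP; right.
  by rewrite ler_wpM2r// le_max lexx.
have In : \int[P]_w f_ n w <= e by apply: le_trans (ler_norm _) hn.
have b1 := bmf_pcomb_RV V b 1 0 0 a0.
have b2 := bmf_pcomb_RV V b 0 1 0 a0.
have babs (g : T -> R) : bmf g -> bmf (fun w => `|g w|).
  move=> bg; split; first by apply: measurableT_comp => //; exact: bg.1.
  by have [K gK] := bg.2; exists K => w; rewrite normr_id.
have bound (g : T -> R) : bmf g -> (forall w, `|g w| <= f_ n w) -> `|\int[P]_w g w| <= e.
  move=> bg gf; apply: le_trans In.
  apply: le_trans; first by apply: le_normr_Rintegral => //; exact: bmf_P.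
  by apply: le_Rintegral => //; apply: bmf_P => //; exact: babs.
split.
  have -> : 1 - \int[P]_w pcomb a b 1 0 0 (V w) = \int[P]_w (1 - pcomb a b 1 0 0 (V w)).
    rewrite RintegralB//; [|by apply: bmf_P; exact: bmf_cst|exact: bmf_P].
    have PT : fine (P setT) = 1 by rewrite probability_setT.
    by rewrite Rintegral_cst// [X in _ = _ * X - _]PT mulr1.
  apply: bound; first by apply: bmfB => //; exact: bmf_cst.
  by move=> w; apply: le_trans (fle w); exact: pcomb_cos_near.
by apply: bound => // w; apply: le_trans (fle w); exact: pcomb_sin_near.
Qed.

(** Minus the right derivative of the transform at 0 is the mean. With h = 1/(n+1) the quotient
    under the integral lies between B - h B^2 and B, and is dominated by B. *)
Lemma transform_rate (B : T -> R) : measurable_fun setT B -> (forall w, 0 <= B w) ->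
  P.-integrable setT (EFin \o B) ->
  ((1 - \int[P]_w dcos n.+1%:R^-1 0 (B w)) / n.+1%:R^-1) @[n --> \oo] --> \int[P]_w B w.
Proof.
move=> mB B0 iB.
pose f_ n w := (1 - expR (- n.+1%:R^-1 * B w)) / n.+1%:R^-1.
have h0 n : 0 < n.+1%:R^-1 :> R by rewrite invr_gt0.
have up n w : f_ n w <= B w.
  rewrite /f_ ler_pdivrMr//; move: (n.+1%:R^-1) => h.
  by have := expR_ge1Dx (- h * B w); lra.
have low n w : B w - n.+1%:R^-1 * B w ^+ 2 <= f_ n w.
  rewrite /f_ ler_pdivlMr//; set h := n.+1%:R^-1; set y := h * B w.
  have y0 : 0 <= y by apply: mulr_ge0 => //; exact: ltW (h0 n).
  have e1 : expR (- h * B w) <= (1 + y)^-1.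
    rewrite mulNr expRN lef_pV2 ?posrE ?expR_gt0//; last lra.
    exact: expR_ge1Dx.
  have e2 : (1 + y)^-1 <= 1 - y + y ^+ 2.
    rewrite -[leLHS]mul1r ler_pdivrMr; last lra.
    have : 0 <= y ^+ 3 by rewrite exprn_ge0.
    lra.
  have -> : (B w - h * B w ^+ 2) * h = y - y ^+ 2 by rewrite /y; ring.
  lra.
have f0 n w : 0 <= f_ n w.
  apply: divr_ge0; last exact: ltW.
  rewrite subr_ge0 -expR0 ler_expR mulNr oppr_le0.
  by apply: mulr_ge0 => //; exact: ltW.
have mf n : measurable_fun setT (f_ n).
  apply: measurable_funM => //; apply: measurable_funB => //.
  by apply: measurableT_comp => //; exact: measurable_funM.
have : (\int[P]_w f_ n w) @[n --> \oo] --> \int[P]_w B w.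
  apply: (@dominated_Rcvg f_ B B) => //; last by move=> n w; rewrite ger0_norm.
  move=> w; apply: (@squeeze_cvgr _ _ _ _ (fun n => B w - n.+1%:R^-1 * B w ^+ 2) (fun=> B w)).
  - by apply: nearW => n; rewrite low up.
  - rewrite -[X in _ --> X]subr0 -[X in _ - X](mul0r (B w ^+ 2)).
    apply: cvgB; first exact: cvg_cst.
    by apply: cvgMl; exact: cvg_harmonic.
  - exact: cvg_cst.
suff E n : (1 - \int[P]_w dcos n.+1%:R^-1 0 (B w)) / n.+1%:R^-1 = \int[P]_w f_ n w.
  by under eq_fun do rewrite -E.
have bE : bmf (fun w => dcos n.+1%:R^-1 0 (B w)).
  have a0 : 0 <= n.+1%:R^-1 :> R by exact: ltW.
  have := bmf_comp (bmf_pcomb 0 a0 1 0 0) mB; congr (bmf _); apply/funext => w.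
  by rewrite /pcomb /comb/= max_r// mul1r !mul0r !addr0.
have -> : 1 - \int[P]_w dcos n.+1%:R^-1 0 (B w) = \int[P]_w (1 - dcos n.+1%:R^-1 0 (B w)).
  rewrite RintegralB//; [|by apply: bmf_P; exact: bmf_cst|exact: bmf_P].
  have PT : fine (P setT) = 1 by rewrite probability_setT.
  by rewrite Rintegral_cst// [X in _ = _ * X - _]PT mulr1.
rewrite -RintegralZr//.
  by apply: eq_Rintegral => w _; rewrite /f_ /dcos mul0r cos0 mulr1.
by apply: bmf_P; apply: bmfB => //; exact: bmf_cst.
Qed.

End limits_at_zero.

Section transforms.
Context d (T : measurableType d) (R : realType) (P : probability T R).

Lemma cexp_damped (a b x : R) :
  cexp (- (a +i* b) * x%:C) = dcos a b x +i* dsin a b x.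
Proof.
have -> : - (a +i* b) * x%:C = (- a * x) +i* (- (b * x)).
  by apply/eqP; rewrite eq_complex /=; apply/andP; split; apply/eqP; ring.
rewrite /cexp /dcos /dsin /= cosN sinN.
by apply/eqP; rewrite eq_complex /=; apply/andP; split; apply/eqP; ring.
Qed.

Lemma lst_damped (X : T -> R) (a b : R) :
  lst P X (a +i* b) = (\int[P]_w dcos a b (X w)) +i* (\int[P]_w dsin a b (X w)).
Proof.
rewrite /lst /cexpectation unlock /Rintegral; congr (fine _ +i* fine _);
  by apply: eq_integral => w _; rewrite cexp_damped.
Qed.

Lemma Rintegral_ae (f g : T -> R) : measurable_fun setT f -> measurable_fun setT g ->
  {ae P, forall w, f w = g w} -> \int[P]_w f w = \int[P]_w g w.
Proof.
move=> mf mg fg; congr fine; apply: ae_eq_integral => //.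
- exact/measurable_EFinP.
- exact/measurable_EFinP.
- by apply: filterS fg => w /= -> _.
Qed.

Lemma measurable_dcos (a b : R) : measurable_fun setT (dcos a b).
Proof.
apply: continuous_measurable_fun => x; apply: differentiable_continuous.
by apply/derivable1_diffP; have [] := is_derive_dcos a b x.
Qed.

Lemma measurable_dsin (a b : R) : measurable_fun setT (dsin a b).
Proof.
apply: continuous_measurable_fun => x; apply: differentiable_continuous.
by apply/derivable1_diffP; have [] := is_derive_dsin a b x.
Qed.

End transforms.

(** * Algebra of the final formula *)

Section algebra.
Variable R : realType.

Lemma complex_norm_le (x y : R) : `|x +i* y| <= (`|x| + `|y|)%:C.
Proof.
rewrite normc_def lecR/= -[leRHS]ger0_norm ?addr_ge0// -sqrtr_sqr ler_sqrt ?sqr_ge0//.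
rewrite sqrrD !real_normK ?num_real// lerD2r lerDl mulrn_wge0// mulr_ge0//.
Qed.

Lemma complex_near0 (Q : R[i] -> Prop) (d : R) : 0 < d ->
  (forall a b, `|a| < d -> `|b| < d -> Q (a +i* b)) -> nbhs (0 : R[i]^o) Q.
Proof.
move=> d0 h; apply: (proj2 (@nbhs_normP R[i] (R[i]^o) 0 Q)).
exists d%:C; first by rewrite /= ltcR.
case=> a b; rewrite /= sub0r normrN => abd; apply: h.
- rewrite -ltcR; apply: le_lt_trans abd; exact: (normc_ge_Re (a +i* b)).
- rewrite -ltcR; apply: le_lt_trans abd; rewrite normc_def lecR/=.
  by rewrite -sqrtr_sqr ler_wsqrtr// lerDr sqr_ge0.
Qed.
(** The bracket in the denominator is minus the factor of [Z]. If it vanished, so would the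
    right-hand side of the equation, a product of nonzero factors; the zeros of the kernel in the
    half-plane need no separate study. *)
Lemma workload_equation (F : fieldType) (s L Z k r co cf : F) :
  (s * (cf + L) - L * (co + cf + L)) * Z = s * (co + cf + L) * k ->
  s != 0 -> co + cf + L != 0 -> k != 0 -> co + cf != 0 ->
  cf - r * (co + cf) = (co + cf) * k ->
  Z = (s * (r * (co + cf) - cf) * (co + cf + L)) /
      (((cf + L) * (co + L - s) - co * cf) * (co + cf)).
Proof.
move=> eZ s0 L0 k0 c0' ek.
have D0 : (cf + L) * (co + L - s) - co * cf != 0.
  apply/eqP => D0; suff : s * (co + cf + L) * k == 0.
    by rewrite !mulf_eq0 (negbTE s0) (negbTE L0) (negbTE k0).
  rewrite -eZ (_ : s * (cf + L) - _ = 0) ?mul0r//.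
  by rewrite -[RHS]oppr0 -D0; ring.
have den0 : ((cf + L) * (co + L - s) - co * cf) * (co + cf) != 0 by rewrite mulf_neq0.
apply: (mulIf den0); rewrite divfK//.
transitivity (- (co + cf) * ((s * (cf + L) - L * (co + cf + L)) * Z)); first by ring.
have -> : r * (co + cf) - cf = - ((co + cf) * k) by rewrite -ek opprB.
by rewrite eZ; ring.
Qed.

Lemma complex_balance (a b x y Z1 Z2 co cf k : R) :
  let m := co + cf + x in let n := cf + x in
  let pr := a * n - b * y - (x * m - y * y) in
  let pi := a * y + b * n - (x * y + y * m) in
  pr * Z1 - pi * Z2 = (m * a - y * b) * k ->
  pr * Z2 + pi * Z1 = (m * b + y * a) * k ->
  let s := a +i* b in let L := x +i* y in
  (s * (cf%:C + L) - L * (co%:C + cf%:C + L)) * (Z1 +i* Z2) =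
  s * (co%:C + cf%:C + L) * k%:C.
Proof.
move=> /= e1 e2; apply/eqP; rewrite eq_complex/=; apply/andP; split; apply/eqP; lra.
Qed.

End algebra.

Section queue_lst.
Context d d' (T : measurableType d) (T' : measurableType d') (R : realType).
Variables (P : probability T R) (P' : probability T' R) (M : polling_model P).
Variables (i : queue) (V : {RV P' >-> R}).
Hypothesis VM : steady_state_workload M i V.

Let con := c M i.
Let coff := c M (~~ i).
Let lam := lambda M i.
Let EB := mean_service M i.
Let B (w : T) : R := Xpos M (inl (inr (i, 0%N))) w.
Hypothesis stable : rho M i < coff / (con + coff).

Let c0 : 0 < con + coff. Proof. by rewrite addr_gt0// c_gt0. Qed.
Let B0 w : 0 <= B w. Proof. by rewrite /B /Xpos /pospart/= le_max lexx. Qed.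
Let mB : measurable_fun setT B. Proof. exact: measurable_pospart. Qed.

Let serviceB : {ae P, forall w, service M i 0%N w = B w}.
Proof.
apply: filterS (primitives_ge0 M) => w /(_ (inl (inr (i, 0%N)))) /= h.
by apply/esym/max_r.
Qed.

Lemma integrable_pos_service : P.-integrable setT (EFin \o B).
Proof.
apply: (le_integrable measurableT _ _ (service_integrable M i)).
  exact/measurable_EFinP.
move=> w _; rewrite /= lee_fin (ger0_norm (B0 w)) /B /Xpos /pospart/= ge_max normr_ge0/=.
exact: ler_norm.
Qed.

Lemma mean_serviceE : EB = \int[P]_w B w.
Proof.
rewrite /EB /mean_service unlock; apply: (@Rintegral_ae _ _ _ P (service M i 0%N) B) => //.
Qed.

Lemma service_lst (a b : R) :
  lst P (service M i 0%N) (a +i* b) = (\int[P]_w dcos a b (B w)) +i* (\int[P]_w dsin a b (B w)).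
Proof.
rewrite lst_damped; congr (_ +i* _); apply: Rintegral_ae.
- by apply: (measurableT_comp (measurable_dcos a b)).
- by apply: (measurableT_comp (measurable_dcos a b)).
- by apply: filterS serviceB => w ->.
- by apply: (measurableT_comp (measurable_dsin a b)).
- by apply: (measurableT_comp (measurable_dsin a b)).
- by apply: filterS serviceB => w ->.
Qed.

Lemma workload_lst (a b : R) : 0 <= a ->
  lst P' V (a +i* b) = (\int[P']_w pcomb a b 1 0 0 (V w)) +i* (\int[P']_w pcomb a b 0 1 0 (V w)).
Proof.
move=> a0; rewrite lst_damped; congr (_ +i* _); apply: Rintegral_ae.
- by apply: (measurableT_comp (measurable_dcos a b)).
- exact: (bmf_pcomb_RV V b 1 0 0 a0).1.
- apply: filterS (steady_state_ge0 VM) => w V0.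
  by rewrite /pcomb /comb max_r// mul1r !mul0r !addr0.
- by apply: (measurableT_comp (measurable_dsin a b)).
- exact: (bmf_pcomb_RV V b 0 1 0 a0).1.
- apply: filterS (steady_state_ge0 VM) => w V0.
  by rewrite /pcomb /comb max_r// mul1r !mul0r addr0 add0r.
Qed.

Lemma service_cos_le1 (a b : R) : 0 <= a -> 0 <= 1 - \int[P]_w dcos a b (B w).
Proof.
move=> a0; rewrite subr_ge0; apply: le_trans (ler_norm _) _.
apply: Rexp_bound; last by move=> w; exact: dcos_bound.
have := bmf_comp (bmf_pcomb b a0 1 0 0) mB; congr (bmf _); apply/funext => w.
by rewrite /pcomb /comb/= max_r// mul1r !mul0r !addr0.
Qed.

(** Along real s = h the arrival term is lam h r with r tending to the mean service time, so the
    first equation is divisible by h and the quotient has a limit as h tends to 0. *)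
Lemma idle_constant kappa :
  (forall a b : R, 0 <= a ->
  let x := lam * (1 - \int[P]_w dcos a b (B w)) in
  let y := - lam * \int[P]_w dsin a b (B w) in
  let Z1 := \int[P']_w pcomb a b 1 0 0 (V w) in
  let Z2 := \int[P']_w pcomb a b 0 1 0 (V w) in
  let m := con + coff + x in let n := coff + x in
  let pr := a * n - b * y - (x * m - y * y) in
  let pi := a * y + b * n - (x * y + y * m) in
  pr * Z1 - pi * Z2 = (m * a - y * b) * kappa /\
  pr * Z2 + pi * Z1 = (m * b + y * a) * kappa) ->
  coff - lam * EB * (con + coff) = (con + coff) * kappa.
Proof.
move=> eqs.
pose h n : R := n.+1%:R^-1.
have h0 n : 0 < h n by rewrite invr_gt0.
pose r n : R := (1 - \int[P]_w dcos (h n) 0 (B w)) / h n.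
pose z n : R := \int[P']_w pcomb (h n) 0 1 0 0 (V w).
have hl : h @ \oo --> (0 : R) by exact: cvg_harmonic.
have rl : r @ \oo --> EB.
  by rewrite mean_serviceE; exact: (transform_rate mB B0 integrable_pos_service).
have zl : z @ \oo --> (1 : R).
  apply/cvgrPdist_le => e e0; have [n hn] := transform_near0 V e0.
  exists n => // k /= nk; have [] := hn (h k) 0 (ltW (h0 k)); last by [].
  by rewrite normr0 addr0 lef_pV2 ?posrE// ler_nat ltnS.
have eq n : (coff + lam * h n * r n - lam * r n * (con + coff + lam * h n * r n)) * z n =
    (con + coff + lam * h n * r n) * kappa.
  have [+ _] := eqs (h n) 0 (ltW (h0 n)).
  have -> : \int[P]_w dsin (h n) 0 (B w) = 0.
    rewrite (_ : (fun w => dsin (h n) 0 (B w)) = fun=> 0); first by rewrite Rintegral_cst// mul0r.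
    by apply/funext => w; rewrite /dsin mul0r sin0 mulr0 oppr0.
  have -> : 1 - \int[P]_w dcos (h n) 0 (B w) = h n * r n.
    by rewrite /r mulrC divfK// gt_eqF.
  rewrite -/(z n) => e.
  have hn0 : h n != 0 by rewrite gt_eqF.
  by apply: (mulfI hn0); move: e; move: (\int[P']_w _) => Z2 e; lra.
have c1 : (fun n => (coff + lam * h n * r n - lam * r n * (con + coff + lam * h n * r n)) * z n)
    @ \oo --> (coff + lam * 0 * EB - lam * EB * (con + coff + lam * 0 * EB)) * 1.
  have l1 : (fun n => lam * h n * r n) @ \oo --> lam * 0 * EB.
    by apply: cvgM => //; exact: cvgMr.
  apply: cvgM => //; apply: cvgB.
    by apply: cvgD => //; exact: cvg_cst.
  apply: cvgM; first exact: cvgMr.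
  by apply: cvgD => //; exact: cvg_cst.
have c2 : (fun n => (con + coff + lam * h n * r n) * kappa) @ \oo -->
    (con + coff + lam * 0 * EB) * kappa.
  apply: cvgMl; apply: cvgD; first exact: cvg_cst.
  by apply: cvgM => //; exact: cvgMr.
move: c1; under eq_fun do rewrite eq.
move=> /(cvg_unique (@Rhausdorff R) c2); rewrite !(mulr0, mul0r, addr0, mulr1) => ->.
by [].
Qed.

Lemma queue_lst : has_lst P' V (fun s : R[i] =>
  (s * (lam * EB * (con + coff) - coff)%:C
     * ((con + coff)%:C + lam%:C * (1 - lst P (service M i 0%N) s)))
  / (((coff%:C + lam%:C * (1 - lst P (service M i 0%N) s))
      * (con%:C + lam%:C * (1 - lst P (service M i 0%N) s) - s) - (con * coff)%:C)
     * (con + coff)%:C)).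
Proof.
have [kappa eqs] := balance_equations VM.
have hk := idle_constant eqs.
(* Stability enters here: it makes [kappa] positive, so the kernel has no zero at any s != 0 of the
   half-plane. *)
have k0 : 0 < kappa.
  move: stable; rewrite ltr_pdivlMr// -subr_gt0 /rho -/lam -/EB hk.
  by rewrite pmulr_rgt0.
have lst_eq (s : R[i]) : 0 <= complex.Re s -> s != 0 -> lst P' V s =
  (s * (lam * EB * (con + coff) - coff)%:C
     * ((con + coff)%:C + lam%:C * (1 - lst P (service M i 0%N) s)))
  / (((coff%:C + lam%:C * (1 - lst P (service M i 0%N) s))
      * (con%:C + lam%:C * (1 - lst P (service M i 0%N) s) - s) - (con * coff)%:C)
     * (con + coff)%:C).
  case: s => a b /= a0 s0; rewrite workload_lst// service_lst.
  have x0 := service_cos_le1 b a0.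
  have := eqs a b a0; move: x0 => /=.
  move: (\int[P]_w _) (\int[P]_w _) (\int[P']_w _) (\int[P']_w _) => Y X Z2 Z1 x0 [e1 e2].
  have -> : (lam * EB * (con + coff) - coff)%:C =
      (lam * EB)%:C * (con%:C + coff%:C) - coff%:C.
    by rewrite rmorphB rmorphM rmorphD.
  have -> : (con + coff)%:C = con%:C + coff%:C by rewrite rmorphD.
  have -> : (con * coff)%:C = con%:C * coff%:C by rewrite rmorphM.
  have lamE : lam%:C * (1 - (X +i* Y)) = (lam * (1 - X)) +i* (- lam * Y).
    by apply/eqP; rewrite eq_complex /=; apply/andP; split; apply/eqP; ring.
  apply: (@workload_equation _ _ _ _ kappa%:C) => //.
  - by rewrite lamE; exact: complex_balance e1 e2.
  - rewrite lamE eq_complex/=; apply/nandP; left; rewrite gt_eqF//.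
    by rewrite ltr_wpDr// mulr_ge0// ltW// lambda_gt0.
  - by rewrite eq_complex/= gt_eqF.
  - by rewrite eq_complex/= gt_eqF.
  - have := congr1 (real_complex R) hk.
    by rewrite rmorphB !rmorphM !rmorphD.
have lst0 : lst P' V 0 = 1.
  rewrite (_ : 0 = 0 +i* 0)// workload_lst//.
  have PT : fine (P' setT) = 1 by rewrite probability_setT.
  have -> : (fun w => pcomb 0 0 1 0 0 (V w)) = fun=> 1.
    apply/funext => w; rewrite /pcomb /comb /dcos /dsin !(mul0r, oppr0).
    by rewrite expR0 cos0 !mulr1 !addr0.
  have -> : (fun w => pcomb 0 0 0 1 0 (V w)) = fun=> 0.
    apply/funext => w; rewrite /pcomb /comb /dcos /dsin !(mul0r, oppr0).
    by rewrite sin0 mulr0 oppr0 mulr0 !addr0.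
  by rewrite !Rintegral_cst// [X in _ * X]PT mul0r mulr1.
split; first by [].
(* Away from 0 the formula equals the transform of [V], so its limit at 0 follows from continuity of
   that transform rather than from the 0/0 quotient. *)
rewrite lst0; apply/cvgrPdist_lt => e e0.
(* In the order of [R[i]] a positive element is real. *)
have [e1 e1E e10] : exists2 e1 : R, e = e1%:C & 0 < e1.
  by move: e0; case: e => e1 e2; rewrite ltcE/= => /andP[/eqP -> ?]; exists e1.
rewrite {}e1E {e e0}.
have e4 : 0 < e1 / 2 / 2 by rewrite !divr_gt0.
have [n hn] := transform_near0 V e4.
have d0 : 0 < n.+1%:R^-1 / 2 :> R by rewrite divr_gt0.
apply: (complex_near0 d0) => a b ad bd [/= a0 s0].
rewrite -lst_eq// workload_lst//.
have [|z1 z2] := hn a b a0.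
  by rewrite ltW// [ltRHS]splitr ltrD// (le_lt_trans (ler_norm a)).
apply: (@le_lt_trans _ _ (e1 / 2 / 2 + e1 / 2 / 2)%:C); last first.
  by rewrite ltcR -splitr ltr_pdivrMr// mulr_natr mulr2n ltrDl.
move: z1 z2; move: (\int[P']_w _) (\int[P']_w _) => ZI ZR z1 z2.
apply: le_trans (complex_norm_le (1 - ZR) (0 - ZI)) _.
by rewrite lecR sub0r normrN lerD.
Qed.

End queue_lst.

Theorem theorem3p1 (R : realType)
    (d : measure_display) (T : measurableType d) (P : probability T R)
    (M : polling_model P)
    (d' : measure_display) (T' : measurableType d') (P' : probability T' R)
    (V1 V2 : {RV P' >-> R}) :
  let lambda1 := lambda M Q1 in let lambda2 := lambda M Q2 in
  let c1 := c M Q1 in let c2 := c M Q2 in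
  let EB1 := mean_service M Q1 in let EB2 := mean_service M Q2 in
  let b1 := lst P (service M Q1 0%N) in let b2 := lst P (service M Q2 0%N) in
  rho M Q1 < c2 / (c1 + c2) ->
  rho M Q2 < c1 / (c1 + c2) ->
  (steady_state_workload M Q1 V1 ->
   has_lst P' V1 (fun s : R[i] =>
     (s * (lambda1 * EB1 * (c1 + c2) - c2)%:C
        * ((c1 + c2)%:C + lambda1%:C * (1 - b1 s)))
     / (((c2%:C + lambda1%:C * (1 - b1 s))
         * (c1%:C + lambda1%:C * (1 - b1 s) - s) - (c1 * c2)%:C)
        * (c1 + c2)%:C)))
  /\
  (steady_state_workload M Q2 V2 ->
   has_lst P' V2 (fun s : R[i] =>
     (s * (lambda2 * EB2 * (c1 + c2) - c1)%:C
        * ((c1 + c2)%:C + lambda2%:C * (1 - b2 s)))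
     / (((c1%:C + lambda2%:C * (1 - b2 s))
         * (c2%:C + lambda2%:C * (1 - b2 s) - s) - (c1 * c2)%:C)
        * (c1 + c2)%:C))).
Proof.
move=> l1 l2 c1 c2 EB1 EB2 b1 b2 st1 st2; split=> VM; first exact: queue_lst VM st1.
rewrite [X in _ / X]addrC in st2.
have := queue_lst VM st2.
rewrite -[c M Q2]/c2 -[c M (~~ Q2)]/c1 (addrC c2 c1) (mulrC c2 c1).
exact.
Qed.
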